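(* Let $(\mathcal{G},\Sigma)$ be a twisted étale groupoid and let $L=(\mathbb{C}\times\Sigma)/\mathbb{T}$ be the associated Fell line bundle. If $S$ is a wide inverse subsemigroup of $S(\mathcal{G})$ and if $\mathcal{A}=\{C_0(L_U)\}_{U\in S}$ is the associated Fell bundle over $S$ of continuous sections vanishing at infinity, then the twisted groupoid $(\mathcal{G}(\mathcal{A}),\Sigma(\mathcal{A}))$ associated to $\mathcal{A}$ is isomorphic to $(\mathcal{G},\Sigma)$.
   Context: Twisted groupoids: an étale groupoid is a topological groupoid $\mathcal{G}$ (not necessarily Hausdorff) with locally compact Hausdorff unit space $\mathcal{G}^{(0)}$ and range and source maps $\mathrm{r},\mathrm{d}$ that are local homeomorphisms. A twist over $\mathcal{G}$ is a (central) exact sequence of topological groupoids $\mathbb{T}\times\mathcal{G}^{(0)}\xrightarrow{\iota}\Sigma\xrightarrow{\pi}\mathcal{G}$, with $\Sigma$ a locally compact groupoid, $\iota$ a homeomorphism onto its image, and $\pi$ a continuous open surjection; $\mathbb{T}$ acts freely on $\Sigma$ by $z\cdot\sigma=\iota(z,\mathrm{r}(\sigma))\sigma=\sigma\iota(z,\mathrm{d}(\sigma))$. The pair $(\mathcal{G},\Sigma)$ is a twisted étale groupoid. An isomorphism of twisted groupoids is a pair of isomorphisms of topological groupoids between the $\Sigma$'s and between the $\mathcal{G}$'s, compatible with the maps $\iota$ and $\pi$ (the unit spaces being identified through the isomorphism of the $\mathcal{G}$'s). The associated Fell line bundle is $L=(\mathbb{C}\times\Sigma)/\mathbb{T}$,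 the set of classes $[\lambda,\sigma]$ with $[\lambda,z\cdot\sigma]=[z\lambda,\sigma]$ for $z\in\mathbb{T}$, quotient topology, projection $[\lambda,\sigma]\mapsto\pi(\sigma)$, norm $|\lambda|$, product $[\lambda,\sigma][\mu,\tau]=[\lambda\mu,\sigma\tau]$, involution $[\lambda,\sigma]^*=[\bar\lambda,\sigma^{-1}]$. Bissections: an open $U\subseteq\mathcal{G}$ is a bissection if $\mathrm{d}|_U$ and $\mathrm{r}|_U$ are homeomorphisms onto $\mathrm{d}(U)$ and $\mathrm{r}(U)$; $S(\mathcal{G})$ is the inverse semigroup of bissections (product $UV=\{\gamma_1\gamma_2:\gamma_1\in U,\gamma_2\in V,\mathrm{d}(\gamma_1)=\mathrm{r}(\gamma_2)\}$, $U^*=U^{-1}$, order = inclusion). $S\subseteq S(\mathcal{G})$ is wide if $\mathcal{G}=\bigcup_{U\in S}U$ and for all $U,V\in S$, $\gamma\in U\cap V$, there is $W\in S$ with $\gamma\in W\subseteq U\cap V$. $\mathcal{A}=\{C_0(L_U)\}_{U\in S}$, where $C_0(L_U)$ is the space (sup norm) of continuous sections of $L|_U$ vanishing at infinity, has product $(\xi\cdot\eta)(\gamma)=\xi(\gamma_1)\eta(\gamma_2)$ for $\gamma=\gamma_1\gamma_2\in UV$ with $\gamma_1\in U,\gamma_2\in V$, involution $\xi^*(\gamma)=\xi(\gamma^{-1})^*$, and inclusion maps $j_{V,U}$ ($U\subseteq V$) given by extension by zero; it is a saturated semi-abelian Fell bundle over $S$. Fell bundles over inverse semigroups: for an inverse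 semigroup $S$, $E(S)$ is its set of idempotents and $s\le t$ means $s=ts^*s$. A Fell bundle over $S$ is a family $\mathcal{A}=\{\mathcal{A}_s\}_{s\in S}$ of complex Banach spaces with a multiplication, an involution $^*$, and linear isometries $j_{t,s}\colon\mathcal{A}_s\to\mathcal{A}_t$ for $s\le t$, such that: $\mathcal{A}_s\mathcal{A}_t\subseteq\mathcal{A}_{st}$, bilinearly and associatively; $\|ab\|\le\|a\|\|b\|$; $\mathcal{A}_s^*\subseteq\mathcal{A}_{s^*}$, conjugate-linearly; $(a^* )^*=a$, $\|a^*\|=\|a\|$, $(ab)^*=b^*a^*$; $\|a^*a\|=\|a\|^2$ and $a^*a\ge0$ in the $C^*$-algebra $\mathcal{A}_{s^*s}$ for $a\in\mathcal{A}_s$; $j_{t,r}=j_{t,s}j_{s,r}$; $j_{t,s}(a)j_{v,u}(b)=j_{tv,su}(ab)$; $j_{t,s}(a)^*=j_{t^*,s^*}(a^* )$. It is saturated if $\mathcal{A}_s\mathcal{A}_t$ spans a dense subspace of $\mathcal{A}_{st}$, and semi-abelian if $\mathcal{A}_e$ is commutative for all $e\in E(S)$. $C^*(\mathcal{A})$ is the enveloping $C^*$-algebra of the $*$-algebra of finite formal sums $\sum a_s\delta_s$ ($(a\delta_s)(b\delta_t)=(ab)\delta_{st}$, $(a\delta_s)^*=a^*\delta_{s^*}$) modulo the span of all $a\delta_s-j_{t,s}(a)\delta_t$, $s\le t$. With $\mathcal{E}=\mathcal{A}|_{E(S)}$, the fibers $\mathcal{A}_s$ and $C^*(\mathcal{E})$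 embed canonically in $C^*(\mathcal{A})$ and each $\mathcal{A}_e$ is a closed ideal of $C^*(\mathcal{E})$. The twisted groupoid of a saturated semi-abelian $\mathcal{A}$: $C^*(\mathcal{E})=C_0(X)$ is commutative with spectrum $X$; $\mathcal{A}_e=C_0(\mathcal{U}_e)$ for an open $\mathcal{U}_e\subseteq X$, $e\in E(S)$. For $a\in\mathcal{A}$, $\mathrm{dom}(a)=\{x:(a^*a)(x)>0\}$ and $\theta_a\colon\mathrm{dom}(a)\to\mathrm{dom}(a^* )$ is the unique homeomorphism with $(a^*ba)(x)=(a^*a)(x)b(\theta_a(x))$ for $b\in C_0(X)$; $\theta_s\colon\mathcal{U}_{s^*s}\to\mathcal{U}_{ss^*}$ is the homeomorphism restricting to $\theta_a$ on $\mathrm{dom}(a)$ for every $a\in\mathcal{A}_s$; $\theta$ is an action of $S$ on $X$. $\mathcal{G}(\mathcal{A})$ is the groupoid of germs $[s,x]$, $x\in\mathcal{U}_{s^*s}$ ($[s,x]=[t,y]$ iff $x=y$ and $se=te$ for some $e\in E(S)$ with $x\in\mathcal{U}_e$), with source $x$, range $\theta_s(x)$, $[s,x][t,y]=[st,y]$ if $\theta_t(y)=x$, $[s,x]^{-1}=[s^*,\theta_s(x)]$, topology generated by the sets $\{[s,x]:x\in U\}$, $U\subseteq\mathcal{U}_{s^*s}$ open, and unit space identified with $X$. For $a,b\in\mathcal{A}_s$ write $a\overset{x}{=}b$ if $((a-b)^*(a-b))(x)=0$. $L(\mathcal{A})$ is the set of classes $[a,s,x]$ of triples with $a\in\mathcal{A}_s$,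 $x\in\mathcal{U}_{s^*s}$, where $[a,s,x]=[a',s',x']$ iff $x=x'$ and there are $e\in E(S)$, $b\in\mathcal{A}_e$ with $b(x)\ne0$, $se=s'e$, $ab\overset{x}{=}a'b$; projection $[a,s,x]\mapsto[s,x]$; $\lambda[a,s,x]=[\lambda a,s,x]$, $[a,s,x]+[b,t,x]=[ac+bc,se,x]$ ($se=te$, $x\in\mathcal{U}_e$, $c\in\mathcal{A}_e$, $c(x)=1$), norm $\sqrt{(a^*a)(x)}$, product $[a,s,x][b,t,y]=[ab,st,y]$ if $\theta_t(y)=x$, involution $[a^*,s^*,\theta_s(x)]$, and the unique topology making it a continuous Banach bundle (continuous open projection, continuous norm, continuous fiberwise addition and scalar multiplications, and $v_i\to0_\gamma$ whenever the projections converge to $\gamma$ and $\|v_i\|\to0$) for which all sections $[s,x]\mapsto[a,s,x]$ ($a\in\mathcal{A}_s$) are continuous on $\{[s,x]:x\in\mathcal{U}_{s^*s}\}$. It is a Fell line bundle over $\mathcal{G}(\mathcal{A})$. $\Sigma(\mathcal{A})$ is the subspace of unitary (equivalently, norm-one) elements of $L(\mathcal{A})$, a groupoid under the multiplication and involution of $L(\mathcal{A})$, with $\pi$ the restricted bundle projection to $\mathcal{G}(\mathcal{A})$ and $\iota\colon\mathbb{T}\times X\to\Sigma(\mathcal{A})$, $(z,x)\mapsto z\cdot1_x$, $1_x$ being the unit of the $C^*$-algebra $L(\mathcal{A})_x\cong\mathbb{C}$. *)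

(* Defs.v *)
From HB Require Import structures.
From mathcomp Require Import all_boot all_order all_algebra.
From mathcomp Require Import generic_quotient complex.
From mathcomp Require Import all_classical all_reals all_analysis.

Set Implicit Arguments.
Unset Strict Implicit.
Unset Printing Implicit Defensive.

Import Order.TTheory GRing.Theory Num.Theory.
Import numFieldNormedType.Exports.

Local Open Scope classical_set_scope.
Local Open Scope ring_scope.
Local Open Scope complex_scope.
Local Open Scope quotient_scope.

(** Conventions. A construction whose well-definedness is a theorem about the
    objects at hand (and not a typing matter) is given as a total operation:
    [insubd d y] is [y] whenever [y] lies in the expected subset, [xget d P] is
    the element satisfying [P] whenever there is one; the default [d] is only a
    junk value, taken outside the mathematically meaningful cases. *)

HB.instance Definition _ (R : realType) := NormedModule.copy R[i] R[i]^o.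

(** * Topological preliminaries *)

Section Topology.

(* [f] restricts to a homeomorphism from [A] onto its image, both sets carrying
   the relative topology. *)
Definition homeo_on (T T' : topologicalType) (A : set T) (f : T -> T') :=
  [/\ {within A, continuous f},
      {in A &, injective f} &
      forall O : set T, open O ->
        exists2 O' : set T', open O' & f @` (A `&` O) = f @` A `&` O'].

Definition homeomorphism (T T' : topologicalType) (f : T -> T') :=
  exists g : T' -> T,
    [/\ continuous f, continuous g, cancel f g & cancel g f].

Definition open_map (T T' : topologicalType) (f : T -> T') :=
  forall O : set T, open O -> open (f @` O).

(* [f : T -> B] is a local homeomorphism, where [B] has the relative topology *)
Definition local_homeo (T T' : topologicalType) (B : set T') (f : T -> T') :=
  (forall x, B (f x)) /\
  forall x, exists U : set T,
    [/\ open U, U x, exists2 O : set T', open O & f @` U = O `&` B &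
        homeo_on U f].

(* The library's [locally_compact] asks for closed compact neighbourhoods,
   which is too strong for a space that need not be Hausdorff. *)
Definition has_compact_nbhs (T : topologicalType) :=
  forall x : T, exists2 K, nbhs x K & compact K.

Lemma pair_continuous (T T' : topologicalType) (c : T') :
  continuous (fun x : T => (c, x)).
Proof.
move=> x; rewrite /continuous_at /=.
by apply: cvg_pair; [exact: cvg_cst|exact: cvg_id].
Qed.

End Topology.

(** A topology on a fixed type, as an object that can be quantified over;
    [retop O] is the type [T] endowed with [O]. *)
Record topology_on (T : Type) := TopologyOn {
  tops : set_system T;
  topsT : tops setT;
  topsI : setI_closed tops;
  tops_bigU : forall (I : Type) (f : I -> set T),
    (forall i, tops (f i)) -> tops (\bigcup_i f i) }.

HB.instance Definition _ (T : Type) := gen_eqMixin (topology_on T).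
HB.instance Definition _ (T : Type) := gen_choiceMixin (topology_on T).

Definition discrete_top (T : Type) : topology_on T.
Proof. by exists setT. Defined.

Definition retop (T : choiceType) (O : topology_on T) : Type := T.
HB.instance Definition _ (T : choiceType) (O : topology_on T) :=
  Choice.on (retop O).
HB.instance Definition _ (T : choiceType) (O : topology_on T) :=
  isOpenTopological.Build (retop O) (@topsT T O) (@topsI T O) (@tops_bigU T O).

(** * Quotients by relations valued in [Prop] *)

(** The classes are the sets [r x]; they are the usual equivalence classes as
    soon as [r] is an equivalence relation. *)
Section ClassicalQuotient.
Variables (T : Type) (r : T -> T -> Prop).

Definition cquot := {c : set T | exists x, c = r x}.

Definition cquot_pi (x : T) : cquot :=
  exist (fun c : set T => exists y, c = r y) (r x) (ex_intro _ x erefl).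

Definition cquot_repr (c : cquot) : T := projT1 (cid (svalP c)).

Lemma cquot_reprK : cancel cquot_repr cquot_pi.
Proof.
move=> c; rewrite /cquot_repr; case: (cid _) => x /= cx.
by apply: eq_sig_hprop => [? ? ?|/=]; [exact: Prop_irrelevance|].
Qed.

HB.instance Definition _ := gen_eqMixin cquot.
HB.instance Definition _ := gen_choiceMixin cquot.
HB.instance Definition _ := isQuotient.Build T cquot cquot_reprK.

End ClassicalQuotient.

(** * Groupoids and twists *)

(** A groupoid is given by its arrows; its unit space is the subspace of the
    arrows that are their own source. The product [gmul x y] is meaningful when
    [gdom x = grng y]. *)
Record groupoid_data := GroupoidData {
  garr :> topologicalType;
  gdom : garr -> garr;
  grng : garr -> garr;
  gmul : garr -> garr -> garr;
  ginv : garr -> garr }.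

Definition gunits (G : groupoid_data) : set G := [set x | gdom x = x].
Definition gcomposable (G : groupoid_data) : set (G * G) :=
  [set p | gdom p.1 = grng p.2].
Arguments gunits : clear implicits.
Arguments gcomposable : clear implicits.

Record is_groupoid (G : groupoid_data) : Prop := IsGroupoid {
  gdom_dom : forall x : G, gdom (gdom x) = gdom x;
  grng_dom : forall x : G, grng (gdom x) = gdom x;
  gdom_rng : forall x : G, gdom (grng x) = grng x;
  grng_rng : forall x : G, grng (grng x) = grng x;
  gdomM : forall x y : G, gdom x = grng y -> gdom (gmul x y) = gdom y;
  grngM : forall x y : G, gdom x = grng y -> grng (gmul x y) = grng x;
  gmulA : forall x y z : G, gdom x = grng y -> gdom y = grng z ->
    gmul x (gmul y z) = gmul (gmul x y) z;
  gmul_dom : forall x : G, gmul x (gdom x) = x;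
  gmul_rng : forall x : G, gmul (grng x) x = x;
  gdomV : forall x : G, gdom (ginv x) = grng x;
  grngV : forall x : G, grng (ginv x) = gdom x;
  gmulV : forall x : G, gmul x (ginv x) = grng x;
  gmulVl : forall x : G, gmul (ginv x) x = gdom x }.

Definition is_topological_groupoid (G : groupoid_data) :=
  [/\ is_groupoid G,
      {within gcomposable G, continuous (fun p => gmul p.1 p.2)} &
      continuous (@ginv G)].

Definition is_etale_groupoid (G : groupoid_data) :=
  [/\ is_topological_groupoid G,
      hausdorff_space (gunits G),
      locally_compact [set: gunits G],
      local_homeo (gunits G) (@gdom G) &
      local_homeo (gunits G) (@grng G)].

(* All the operations are preserved, so that an isomorphism from mere data to
   a groupoid makes the former a groupoid. *)
Definition groupoid_hom (G H : groupoid_data) (f : G -> H) :=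
  [/\ forall x, gdom (f x) = f (gdom x),
      forall x, grng (f x) = f (grng x),
      forall x y, gdom x = grng y -> f (gmul x y) = gmul (f x) (f y) &
      forall x, f (ginv x) = ginv (f x)].

Definition topological_groupoid_iso (G H : groupoid_data) (f : G -> H) :=
  homeomorphism f /\ groupoid_hom f.

Section Twists.
Variable R : realType.

(** [tw_iota] is meaningful on the product of the circle and of the unit space *)
Record twist_data := TwistData {
  tw_G : groupoid_data;
  tw_S : groupoid_data;
  tw_iota : R[i] -> tw_G -> tw_S;
  tw_pi : tw_S -> tw_G }.
Arguments tw_iota : clear implicits.

Definition circle : set R[i] := [set z | `|z| = 1].

Record is_twisted_etale_groupoid (D : twist_data) : Prop := IsTwisted {
  tw_etale : is_etale_groupoid (tw_G D);
  tw_topological : is_topological_groupoid (tw_S D);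
  tw_lcompact : has_compact_nbhs (tw_S D);
  (* [tw_iota] is a homomorphism from the group bundle T x G^(0) *)
  tw_iota_dom : forall z x, circle z -> gunits (tw_G D) x ->
    gdom (tw_iota D z x) = tw_iota D 1 x;
  tw_iota_rng : forall z x, circle z -> gunits (tw_G D) x ->
    grng (tw_iota D z x) = tw_iota D 1 x;
  tw_iotaM : forall z w x, circle z -> circle w -> gunits (tw_G D) x ->
    tw_iota D (z * w) x = gmul (tw_iota D z x) (tw_iota D w x);
  tw_iota_homeo : homeo_on (circle `*` gunits (tw_G D))
    (fun p => tw_iota D p.1 p.2);
  tw_pi_hom : groupoid_hom (@tw_pi D);
  tw_pi_continuous : continuous (@tw_pi D);
  tw_pi_open : open_map (@tw_pi D);
  tw_pi_surj : forall x, exists s, tw_pi s = x :> tw_G D;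
  (* exactness, with the identification of the unit spaces *)
  tw_pi_iota : forall z x, circle z -> gunits (tw_G D) x ->
    tw_pi (tw_iota D z x) = x;
  tw_exact : forall s, gunits (tw_G D) (tw_pi s) ->
    exists z x, [/\ circle z, gunits (tw_G D) x & s = tw_iota D z x];
  tw_central : forall z s, circle z ->
    gmul (tw_iota D z (grng (tw_pi s))) s =
    gmul s (tw_iota D z (gdom (tw_pi s))) }.

Definition twisted_groupoid_iso (D D' : twist_data) :=
  exists (fS : tw_S D -> tw_S D') (fG : tw_G D -> tw_G D'),
    [/\ topological_groupoid_iso fS,
        topological_groupoid_iso fG,
        forall s, tw_pi (fS s) = fG (tw_pi s) &
        forall z x, circle z -> gunits (tw_G D) x ->
          fS (tw_iota D z x) = tw_iota D' z (fG x)].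

End Twists.
Arguments tw_iota {R} _ _ _.

(** * Inverse semigroups *)

Record inverse_semigroup := InverseSemigroup {
  isort :> Type;
  imul : isort -> isort -> isort;
  istar : isort -> isort;
  imulA : associative imul;
  imulVK : forall s, imul (imul s (istar s)) s = s;
  imulKV : forall s, imul (imul (istar s) s) (istar s) = istar s;
  istar_uniq : forall s t,
    imul (imul s t) s = s -> imul (imul t s) t = t -> t = istar s }.

Declare Scope isg_scope.
Delimit Scope isg_scope with isg.
Local Open Scope isg_scope.
Notation "s ** t" := (imul s t) (at level 40, left associativity) : isg_scope.
Notation "s ^!" := (istar s) (at level 1, format "s ^!") : isg_scope.

Definition ile (S : inverse_semigroup) (s t : S) := s = t ** s^! ** s.

Section Idempotents.
Variable S : inverse_semigroup.
Implicit Types s t e f : S.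

Definition idempotent e := e ** e = e.

Lemma istar_idem e : idempotent e -> e^! = e.
Proof. by move=> ee; apply/esym/istar_uniq; rewrite !ee. Qed.

Lemma idemM e f : idempotent e -> idempotent f -> idempotent (e ** f).
Proof.
move=> ee ff; set x := (e ** f)^!.
have efx z : e ** (f ** (x ** (e ** (f ** z)))) = e ** (f ** z).
  by have := congr1 (fun y => y ** z) (imulVK (e ** f)); rewrite -!imulA.
have xef z : x ** (e ** (f ** (x ** z))) = x ** z.
  by have := congr1 (fun y => y ** z) (imulKV (e ** f)); rewrite -!imulA.
have eeK z : e ** (e ** z) = e ** z by rewrite imulA ee.
have ffK z : f ** (f ** z) = f ** z by rewrite imulA ff.
have xE : f ** (x ** e) = x.
  apply: istar_uniq; rewrite -!imulA eeK ffK; last by rewrite xef.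
  by have := imulVK (e ** f); rewrite -!imulA.
have xx : idempotent x.
  rewrite /idempotent; have -> : x ** x = f ** (x ** e) ** (f ** (x ** e)) by rewrite xE.
  by rewrite -!imulA xef xE.
have : x^! = e ** f.
  by apply/esym/istar_uniq; [exact: imulKV|exact: imulVK].
by rewrite istar_idem // => <-.
Qed.

Lemma idem_starK s : idempotent (s^! ** s).
Proof. by rewrite /idempotent imulA imulKV. Qed.

Lemma idem_Kstar s : idempotent (s ** s^!).
Proof. by rewrite /idempotent imulA imulVK. Qed.

Definition E_sort := {e : S | idempotent e}.
Definition E_mul (e f : E_sort) : E_sort :=
  exist idempotent (sval e ** sval f) (idemM (svalP e) (svalP f)).

Lemma E_inj (e f : E_sort) : sval e = sval f -> e = f.
Proof. by move=> ?; apply: eq_sig_hprop => // ? ? ?; exact: Prop_irrelevance. Qed.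

Lemma idem_star e : idempotent e -> idempotent (e^!).
Proof. by move=> ee; rewrite istar_idem. Qed.

Definition E_star (e : E_sort) : E_sort :=
  exist idempotent ((sval e)^!) (idem_star (svalP e)).

(** The semilattice E(S), itself an inverse semigroup *)
Definition Eisg : inverse_semigroup.
Proof.
refine (@InverseSemigroup E_sort E_mul E_star _ _ _ _).
- by move=> e f g; apply: E_inj; exact: imulA.
- by move=> e; apply: E_inj; exact: imulVK.
- by move=> e; apply: E_inj; exact: imulKV.
- move=> e f /(congr1 sval) efe /(congr1 sval) fef.
  by apply: E_inj; exact: istar_uniq.
Defined.

Definition src_idem s : Eisg := exist idempotent _ (idem_starK s).
Definition rng_idem s : Eisg := exist idempotent _ (idem_Kstar s).

End Idempotents.

(** * Fell bundles over inverse semigroups and their C*-algebras *)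

Section FellBundles.
Variable R : realType.
Local Notation C := R[i].

(** The fibres, operations and inclusions of a Fell bundle. The constructions
    below only use these data; they have their usual meaning when the axioms of
    a saturated semi-abelian Fell bundle hold. *)
Record fell_data (S : inverse_semigroup) := FellData {
  fib :> S -> Type;
  fzero : forall s, fib s;
  fadd : forall s, fib s -> fib s -> fib s;
  fscale : forall s, C -> fib s -> fib s;
  fnorm : forall s, fib s -> R;
  fmul : forall s t, fib s -> fib t -> fib (s ** t);
  fstar : forall s, fib s -> fib s^!;
  fincl : forall s t, ile s t -> fib s -> fib t }.

Definition fsub S (A : fell_data S) s (a b : A s) := fadd a (fscale (-1) b).

(** The restriction of a Fell bundle to E(S) *)
Lemma ile_val S (e f : Eisg S) : ile e f -> ile (sval e) (sval f).
Proof. by move=> /(congr1 sval). Qed.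

Definition restrE S (A : fell_data S) : fell_data (Eisg S) :=
  @FellData (Eisg S) (fun e => A (sval e))
    (fun e => fzero A (sval e))
    (fun e => @fadd S A (sval e))
    (fun e => @fscale S A (sval e))
    (fun e => @fnorm S A (sval e))
    (fun e f => @fmul S A (sval e) (sval f))
    (fun e => @fstar S A (sval e))
    (fun e f ef => @fincl S A (sval e) (sval f) (ile_val ef)).

Section CStar.
Variables (S : inverse_semigroup) (A : fell_data S).

(** The finite formal sums [\sum a_s \delta_s], as lists of their terms *)
Definition ftot := {s : S & A s}.
Definition dlt s (a : A s) : ftot := existT A s a.
Definition fsum := seq ftot.

Definition fs_scale (l : C) (u : fsum) : fsum :=
  [seq dlt (fscale l (projT2 p)) | p <- u].
Definition fs_sub (u v : fsum) : fsum := u ++ fs_scale (-1) v.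
Definition fs_mul (u v : fsum) : fsum :=
  [seq dlt (fmul (projT2 p) (projT2 q)) | p <- u, q <- v].
Definition fs_star (u : fsum) : fsum :=
  [seq dlt (fstar (projT2 p)) | p <- u].

(** Equality of formal sums modulo the [a \delta_s - j_{t,s}(a) \delta_t]. The
    latter elements span an additive subgroup, whence this presentation of the
    additive group of the quotient. *)
Inductive fs_eq : fsum -> fsum -> Prop :=
| fs_eq_refl u : fs_eq u u
| fs_eq_sym u v : fs_eq u v -> fs_eq v u
| fs_eq_trans u v w : fs_eq u v -> fs_eq v w -> fs_eq u w
| fs_eq_cat u u' v v' : fs_eq u u' -> fs_eq v v' -> fs_eq (u ++ v) (u' ++ v')
| fs_eq_catC u v : fs_eq (u ++ v) (v ++ u)
| fs_eq_zero s : fs_eq [:: dlt (fzero A s)] [::]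
| fs_eq_add s (a b : A s) : fs_eq [:: dlt a; dlt b] [:: dlt (fadd a b)]
| fs_eq_incl s t (st : ile s t) (a : A s) :
    fs_eq [:: dlt a] [:: dlt (fincl st a)].

(** C*-seminorms on the quotient *-algebra *)
Record cstar_seminorm (p : fsum -> R) : Prop := CstarSeminorm {
  csn_eq : forall u v, fs_eq u v -> p u = p v;
  csn_add : forall u v, p (u ++ v) <= p u + p v;
  csn_scale : forall l u, p (fs_scale l u) = complex.Re `|l| * p u;
  csn_mul : forall u v, p (fs_mul u v) <= p u * p v;
  csn_cstar : forall u, p (fs_mul (fs_star u) u) = p u ^+ 2 }.

(** The largest C*-seminorm (the supremum is finite for a Fell bundle, since a
    C*-seminorm is contractive on the C*-algebras A_e); the enveloping C*-algebra is the (separated)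
    completion for it, realised as classes of Cauchy sequences. *)
Definition env_norm (u : fsum) : R :=
  sup [set r | exists2 p, cstar_seminorm p & r = p u].

Definition env_cauchy : set (nat -> fsum) := [set u |
  forall eps : R, 0 < eps -> exists N, forall m n,
    (N <= m)%N -> (N <= n)%N -> env_norm (fs_sub (u m) (u n)) < eps].

Lemma env_cauchy0 : env_cauchy (fun=> [::]).
Proof.
move=> eps eps0; exists 0%N => m n _ _; rewrite /fs_sub /=.
suff -> : env_norm [::] = 0 by [].
rewrite /env_norm; set P := (X in sup X).
have P0 : P `<=` [set 0].
  move=> r [p pP ->]; have := csn_scale pP 0 [::].
  by rewrite normr0 mul0r.
have [->|Pn0] := eqVneq P set0; first exact: sup0.
suff -> : P = [set 0] by exact: sup1.
apply/seteqP; split => // _ ->; move/set0P: Pn0 => [r Pr].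
by rewrite -(P0 _ Pr).
Qed.

Definition cauchy_fsum := set_type env_cauchy.

Definition env_eq (u v : cauchy_fsum) :=
  env_norm (fs_sub (val u n) (val v n)) @[n --> \oo] --> (0 : R).

Definition Cstar := cquot env_eq.

Definition mkC (u : nat -> fsum) : Cstar :=
  \pi_Cstar (insubd (SigSub (mem_set env_cauchy0) : cauchy_fsum) u).
Definition repC (x : Cstar) (n : nat) : fsum := val (repr x : cauchy_fsum) n.

Definition Cadd (x y : Cstar) := mkC (fun n => repC x n ++ repC y n).
Definition Cscale (l : C) (x : Cstar) := mkC (fun n => fs_scale l (repC x n)).
Definition Cmul (x y : Cstar) := mkC (fun n => fs_mul (repC x n) (repC y n)).
Definition Cinvol (x : Cstar) := mkC (fun n => fs_star (repC x n)).
Definition Cnorm (x : Cstar) : R := lim (env_norm (repC x n) @[n --> \oo]).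

(** The canonical map from the fibres *)
Definition Cdelta s (a : A s) : Cstar := mkC (fun=> [:: dlt a]).

Record is_character (chi : Cstar -> C) : Prop := IsCharacter {
  chr_add : forall x y, chi (Cadd x y) = chi x + chi y;
  chr_scale : forall l x, chi (Cscale l x) = l * chi x;
  chr_mul : forall x y, chi (Cmul x y) = chi x * chi y;
  chr_star : forall x, chi (Cinvol x) = (chi x)^*;
  chr_bounded : exists M : R, forall x, complex.Re `|chi x| <= M * Cnorm x;
  chr_neq0 : exists x, chi x <> 0 }.

(** The spectrum, with the topology of pointwise convergence *)
Definition spectrum :=
  set_type [set chi : {ptws Cstar -> C} | is_character chi].
HB.instance Definition _ := Topological.on spectrum.

End CStar.

(** The canonical map from C*(E) to C*(A) *)
Definition fs_incl S (A : fell_data S) (u : fsum (restrE A)) : fsum A :=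
  [seq @dlt S A (sval (projT1 p)) (projT2 p) | p <- u].
Definition Cincl S (A : fell_data S) (x : Cstar (restrE A)) : Cstar A :=
  mkC (fun n => fs_incl (repC x n)).

(** * The twisted groupoid of a saturated semi-abelian Fell bundle *)

Section TwistedGroupoid.
Variables (S : inverse_semigroup) (A : fell_data S).
Local Notation E := (Eisg S).

(* the space X with C*(E) = C_0(X) *)
Definition Xsp := spectrum (restrE A).
HB.instance Definition _ := Topological.on Xsp.

Definition evalX (b : Cstar (restrE A)) (x : Xsp) : C := (val x : _ -> _) b.

(* b(x), for b in A_e *)
Definition evalE (e : E) (b : A (sval e)) (x : Xsp) : C :=
  evalX (@Cdelta E (restrE A) e b) x.

(* the open set U_e with A_e = C_0(U_e) *)
Definition Uset (e : E) : set Xsp :=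
  [set x | exists b : A (sval e), evalE b x != 0].

(* ( a^* a )(x) *)
Definition sqv s (a : A s) (x : Xsp) : C :=
  @evalE (src_idem s) (fmul (fstar a) a) x.

Definition domv s (a : A s) : set Xsp := [set x | 0 < sqv a x].

Definition theta_elt s (a : A s) (x : Xsp) : Xsp :=
  xget x [set y | domv (fstar a) y /\
    forall b : Cstar (restrE A), exists2 c : Cstar (restrE A),
      Cincl c = Cmul (Cmul (Cdelta (fstar a)) (Cincl b)) (Cdelta a) &
      evalX c x = sqv a x * evalX b y].

Definition theta s (x : Xsp) : Xsp :=
  xget x [set y | Uset (rng_idem s) y /\
    forall a : A s, domv a x -> theta_elt a x = y].

(** ** The groupoid of germs *)

Definition pregerm :=
  set_type [set p : S * Xsp | Uset (src_idem p.1) p.2].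

Definition germ_eq (p q : pregerm) :=
  (val p).2 = (val q).2 /\
  exists e : E, Uset e (val p).2 /\ (val p).1 ** sval e = (val q).1 ** sval e.

Definition germ := cquot germ_eq.
HB.instance Definition _ := Choice.on germ.
HB.instance Definition _ := Quotient.on germ.

(* [s, x], with a junk value *)
Definition mkgerm (d : pregerm) s x : germ := \pi_germ (insubd d (s, x)).
Definition germ_s (g : germ) : S := (val (repr g : pregerm)).1.
Definition germ_x (g : germ) : Xsp := (val (repr g : pregerm)).2.

Definition germ_basic (s : S) (U : set Xsp) : set germ :=
  [set g | exists2 p : pregerm,
    (val p).1 = s /\ U (val p).2 & g = \pi_germ p].

HB.instance Definition _ := isSubBaseTopological.Build germ
  [set B | exists s U,
     [/\ open U, U `<=` Uset (src_idem s) & B = germ_basic s U]] id.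

(* A point x of X is identified with the unit [e, x], for any e with x in U_e;
   in particular the source of [s, x] is the germ of s^* s at x. *)
Definition germ_dom (g : germ) : germ :=
  mkgerm (repr g) ((germ_s g)^! ** germ_s g) (germ_x g).
Definition germ_rng (g : germ) : germ :=
  mkgerm (repr g) (germ_s g ** (germ_s g)^!) (theta (germ_s g) (germ_x g)).
Definition germ_mul (g h : germ) : germ :=
  mkgerm (repr h) (germ_s g ** germ_s h) (germ_x h).
Definition germ_inv (g : germ) : germ :=
  mkgerm (repr g) (germ_s g)^! (theta (germ_s g) (germ_x g)).

Definition germ_groupoid : groupoid_data :=
  @GroupoidData germ germ_dom germ_rng germ_mul germ_inv.

(** ** The Fell line bundle *)

(* The relation a = b at x, for a and b in the same fibre *)
Inductive eq_at (x : Xsp) : ftot A -> ftot A -> Prop :=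
  EqAt s (a b : A s) : sqv (fsub a b) x = 0 -> eq_at x (dlt a) (dlt b).

Definition preL :=
  set_type [set p : ftot A * Xsp | Uset (src_idem (projT1 p.1)) p.2].

Definition preL_eq (p q : preL) :=
  let x := (val p).2 in
  x = (val q).2 /\
  exists (e : E) (b : A (sval e)),
    [/\ evalE b x != 0,
        projT1 (val p).1 ** sval e = projT1 (val q).1 ** sval e &
        eq_at x (dlt (fmul (projT2 (val p).1) b))
                (dlt (fmul (projT2 (val q).1) b))].

Definition LA := cquot preL_eq.
HB.instance Definition _ := Choice.on LA.
HB.instance Definition _ := Quotient.on LA.

(* [a, s, x], with a junk value *)
Definition mkL (d : preL) s (a : A s) (x : Xsp) : LA :=
  \pi_LA (insubd d (dlt a, x)).
Definition L_s (v : LA) : S := projT1 (val (repr v : preL)).1.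
Definition L_a (v : LA) : A (L_s v) := projT2 (val (repr v : preL)).1.
Definition L_x (v : LA) : Xsp := (val (repr v : preL)).2.

Lemma L_mem (v : LA) :
  (L_s v, L_x v) \in [set p : S * Xsp | Uset (src_idem p.1) p.2].
Proof. by apply: mem_set; have := set_mem (valP (repr v : preL)). Qed.

Definition L_proj (v : LA) : germ := \pi_germ (SigSub (L_mem v) : pregerm).
Definition L_norm (v : LA) : R := Num.sqrt (complex.Re (sqv (L_a v) (L_x v))).
Definition L_scale (l : C) (v : LA) : LA :=
  mkL (repr v) (fscale l (L_a v)) (L_x v).
Definition L_mul (v w : LA) : LA :=
  mkL (repr w) (fmul (L_a v) (L_a w)) (L_x w).
Definition L_star (v : LA) : LA :=
  mkL (repr v) (fstar (L_a v)) (theta (L_s v) (L_x v)).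

(* [a, s, x] + [b, t, x] = [a c + b c, s e, x], where s e = t e, c is in A_e
   and c(x) = 1; below, d is b c seen in the fibre of s e. *)
Definition L_add (v w : LA) : LA :=
  xget v [set u | exists (p q : preL) (e : E) (c : A (sval e))
      (d : A (projT1 (val p).1 ** sval e)),
    [/\ v = \pi_LA p /\ w = \pi_LA q,
        (val p).2 = (val q).2,
        evalE c (val p).2 = 1,
        dlt d = dlt (fmul (projT2 (val q).1) c) &
        u = mkL p (fadd (fmul (projT2 (val p).1) c) d) (val p).2]].

Lemma germ_memL (g : germ) :
  (dlt (fzero A (germ_s g)), germ_x g) \in
  [set p : ftot A * Xsp | Uset (src_idem (projT1 p.1)) p.2].
Proof. by apply: mem_set; have := set_mem (valP (repr g : pregerm)). Qed.

Definition germ_zero (g : germ) : preL := SigSub (germ_memL g).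

(* the section [s, x] |-> [a, s, x] on the set of all germs [s, x] *)
Definition L_section s (a : A s) (g : germ) : LA :=
  mkL (germ_zero g) a (germ_x g).

Definition is_L_topology (O : topology_on LA) :=
  let L : topologicalType := retop O in
  [/\ continuous (L_proj : L -> germ) /\ open_map (L_proj : L -> germ),
      continuous (L_norm : L -> R),
      {within [set p : L * L | L_proj p.1 = L_proj p.2],
        continuous (fun p : L * L => L_add p.1 p.2 : L)} /\
      (forall l : C, continuous (L_scale l : L -> L)),
      (forall (F : set_system L) (g : germ) (z : L), ProperFilter F ->
        L_proj z = g -> L_norm z = 0 ->
        L_proj v @[v --> F] --> g -> L_norm v @[v --> F] --> (0 : R) ->
        F --> z) &
      (forall s (a : A s),
        {within germ_basic s setT, continuous (L_section a : germ -> L)})].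

(** [LA] with the unique topology satisfying [is_L_topology] *)
Definition LB : topologicalType :=
  retop (xget (discrete_top LA) is_L_topology).

(** ** The twist *)

Definition SigmaA := set_type [set v : LB | L_norm v = 1].
HB.instance Definition _ := Topological.on SigmaA.

Definition Sigma_mul (v w : SigmaA) : SigmaA :=
  insubd v (L_mul (val v) (val w) : LB).
Definition Sigma_inv (v : SigmaA) : SigmaA := insubd v (L_star (val v) : LB).

Definition Sigma_groupoid : groupoid_data :=
  @GroupoidData SigmaA
    (fun v => Sigma_mul (Sigma_inv v) v)
    (fun v => Sigma_mul v (Sigma_inv v))
    Sigma_mul Sigma_inv.

Definition Sigma_pi (v : Sigma_groupoid) : germ_groupoid := L_proj (val v).

(* v is the unit of the C*-algebra L(A)_u *)
Definition L_unit (u : germ) (v : LA) :=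
  L_proj v = u /\
  forall w, L_proj w = u -> L_mul v w = w /\ L_mul w v = w.

(* the map (z, x) |-> z 1_x *)
Definition is_Sigma_iota (iota : C -> germ_groupoid -> Sigma_groupoid) :=
  forall z u, circle z -> gunits germ_groupoid u ->
    exists2 v, L_unit u v & val (iota z u) = L_scale z v :> LA.

(** The components of the twisted groupoid associated to [A] *)
Definition is_twisted_groupoid_of (D : twist_data R) :=
  exists2 iota, is_Sigma_iota iota &
    D = @TwistData R germ_groupoid Sigma_groupoid iota Sigma_pi.

End TwistedGroupoid.
End FellBundles.

(** * Bissections *)

Section Bissections.
Variable G : groupoid_data.

Definition bissection (U : set G) :=
  [/\ open U, homeo_on U (@gdom G) & homeo_on U (@grng G)].

Definition bmul (U V : set G) : set G :=
  [set g | exists g1 g2,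
    [/\ U g1, V g2, gdom g1 = grng g2 & g = gmul g1 g2]].

Definition binv (U : set G) : set G := [set ginv g | g in U].

Definition inverse_subsemigroup (S : set (set G)) :=
  [/\ S `<=` bissection,
      forall U V, S U -> S V -> S (bmul U V) &
      forall U, S U -> S (binv U)].

Definition wide (S : set (set G)) :=
  \bigcup_(U in S) U = setT /\
  forall U V g, S U -> S V -> U g -> V g ->
    exists W, [/\ S W, W g & W `<=` U `&` V].

Hypothesis hG : is_groupoid G.

Lemma ginvK (g : G) : ginv (ginv g) = g.
Proof.
rewrite -[LHS](gmul_dom hG) (gdomV hG) (grngV hG) -(gmulVl hG g).
rewrite (gmulA hG) ?(gdomV hG) ?(grngV hG) //.
by rewrite (gmulVl hG) (gdomV hG) (gmul_rng hG).
Qed.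

Lemma bmulA : associative bmul.
Proof.
move=> U V W; apply/seteqP; split => g.
  move=> [g1 [_ [Ug1 [g2 [g3 [Vg2 Wg3 d23 ->]]] + ->]]].
  rewrite (grngM hG) // => d12.
  exists (gmul g1 g2), g3; split => //; last exact: gmulA.
    by exists g1, g2.
  by rewrite (gdomM hG).
move=> [_ [g3 [[g1 [g2 [Ug1 Vg2 d12 ->]]] Wg3 + ->]]].
rewrite (gdomM hG) // => d23.
exists g1, (gmul g2 g3); split => //; last exact/esym/gmulA.
  by exists g2, g3.
by rewrite (grngM hG).
Qed.

Lemma bissection_rngI U g h :
  bissection U -> U g -> U h -> grng g = grng h -> g = h.
Proof. by move=> [_ _ [_ injr _]] Ug Uh; apply: injr; exact: mem_set. Qed.

Lemma bissection_domI U g h :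
  bissection U -> U g -> U h -> gdom g = gdom h -> g = h.
Proof. by move=> [_ [_ injd _] _] Ug Uh; apply: injd; exact: mem_set. Qed.

Lemma binvK U : binv (binv U) = U.
Proof.
apply/seteqP; split => [_ [_ [g Ug <-] <-]|g Ug]; first by rewrite ginvK.
by exists (ginv g); [exists g|exact: ginvK].
Qed.

Lemma bmulVK U : bissection U -> bmul (bmul U (binv U)) U = U.
Proof.
move=> bU; apply/seteqP; split => g.
  move=> [_ [u3 [[u1 [_ [Uu1 [u2 Uu2 <-] + ->]]] Uu3 + ->]]].
  rewrite (grngV hG) => d12.
  rewrite (bissection_domI bU Uu1 Uu2 d12) (gmulV hG) (gdom_rng hG) => r23.
  by rewrite (bissection_rngI bU Uu2 Uu3 r23) (gmul_rng hG).
move=> Ug; exists (gmul g (ginv g)), g; split => //.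
- exists g, (ginv g); split => //; first by exists g.
  by rewrite (grngV hG).
- by rewrite (gmulV hG) (gdom_rng hG).
- by rewrite (gmulV hG) (gmul_rng hG).
Qed.

Lemma binv_subset U V : bissection U ->
  bmul (bmul U V) U = U -> binv U `<=` V.
Proof.
move=> bU UVU _ [g Ug <-]; have := Ug.
rewrite -{1}UVU => -[_ [u2 [[u1 [v [Uu1 Vv d1 ->]]] Uu2 + gE]]].
rewrite (gdomM hG) // => d2.
have u1g : u1 = g.
  apply: (bissection_rngI bU) => //.
  by rewrite gE !(grngM hG) // (gdomM hG).
have u2g : u2 = g.
  by apply: (bissection_domI bU) => //; rewrite gE (gdomM hG) // (gdomM hG).
rewrite u1g u2g in d1 d2 gE.
have gvE : gmul g v = grng g.
  have : gmul (gmul (gmul g v) g) (ginv g) = gmul g v.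
    rewrite -(gmulA hG) ?(gdomM hG) ?(grngV hG) // (gmulV hG) -d2.
    by rewrite -{1}(gdomM hG d1) (gmul_dom hG).
  by rewrite -gE (gmulV hG).
suff -> : ginv g = v by [].
rewrite -(gmul_dom hG (ginv g)) (gdomV hG) -gvE (gmulA hG) ?(gdomV hG) //.
  by rewrite (gmulVl hG) d1 (gmul_rng hG).
Qed.

Section Semigroup.
Variables (S : set (set G)) (hS : inverse_subsemigroup S).

Lemma S_mulP (U V : S) : bmul (val U) (val V) \in S.
Proof.
case: hS => _ hM _; apply: mem_set.
by apply: hM; apply: set_mem; exact: valP.
Qed.

Lemma S_invP (U : S) : binv (val U) \in S.
Proof.
by case: hS => _ _ hV; apply/mem_set/hV/set_mem; exact: valP.
Qed.

Lemma S_bissection (U : S) : bissection (val U).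
Proof. by case: hS => sS _ _; apply/sS/set_mem; exact: valP. Qed.

Definition S_mul (U V : S) : S := SigSub (S_mulP U V).
Definition S_inv (U : S) : S := SigSub (S_invP U).

Definition bissection_isg : inverse_semigroup.
Proof.
refine (@InverseSemigroup S S_mul S_inv _ _ _ _).
- by move=> U V W; apply: val_inj; exact: bmulA.
- by move=> U; apply: val_inj; apply: bmulVK; exact: S_bissection.
- move=> U; apply: val_inj => /=; rewrite -[in X in bmul _ X = _]/(binv _).
  have := bmulVK (S_bissection (S_inv U)).
  by rewrite /= binvK.
- move=> U V /(congr1 val) /= UVU /(congr1 val) /= VUV.
  apply: val_inj; apply/seteqP; split => /=.
    rewrite -{1}(binvK (val V)) => _ [g /(binv_subset (S_bissection V) VUV) Ug <-].
    by exists g.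
  exact: binv_subset (S_bissection U) UVU.
Defined.

End Semigroup.
End Bissections.

(** * The Fell line bundle of a twist and its sections *)

Section LineBundle.
Variables (R : realType) (D : twist_data R).
Hypothesis hD : is_twisted_etale_groupoid D.
Local Notation C := R[i].
Local Notation G := (tw_G D).
Local Notation Sg := (tw_S D).

(* the action of the circle on the twist *)
Definition tw_act (z : C) (s : Sg) : Sg :=
  gmul (tw_iota D z (grng (tw_pi s))) s.

(* [l, z . s] = [z l, s] *)
Definition line_eq (p q : C * Sg) :=
  exists2 z, circle z & q.1 = z * p.1 /\ p.2 = tw_act z q.2.

Definition line := quotient_topology (cquot line_eq).

Definition line_proj (v : line) : G := tw_pi (repr v).2.
Definition line_norm (v : line) : R := complex.Re `|(repr v).1|.
Definition line_scale (l : C) (v : line) : line :=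
  \pi_line (l * (repr v).1, (repr v).2).
(* for v = [l, s] and w = [m, z . s] = [z m, s] in the same fibre *)
Definition line_add (v w : line) : line :=
  let z := xget 1 [set z | circle z /\ (repr w).2 = tw_act z (repr v).2] in
  \pi_line ((repr v).1 + z * (repr w).1, (repr v).2).
Definition line_mul (v w : line) : line :=
  \pi_line ((repr v).1 * (repr w).1, gmul (repr v).2 (repr w).2).
Definition line_star (v : line) : line :=
  \pi_line ((repr v).1^*, ginv (repr v).2).

Definition line_zero (g : G) : line :=
  \pi_line (0, sval (cid (tw_pi_surj hD g))).

(** C_0(L_U), a section over U being extended by zero outside U *)
Definition C0_sections (U : set G) : set (G -> line) := [set xi |
  [/\ forall g, line_proj (xi g) = g,
      forall g, ~ U g -> xi g = line_zero g,
      {within U, continuous xi} &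
      forall eps : R, 0 < eps -> exists K : set G,
        [/\ compact K, K `<=` U &
            forall g, U g -> ~ K g -> line_norm (xi g) < eps]]].

Let hG : is_groupoid G. Proof. by case: (tw_etale hD) => -[]. Qed.
Let hSg : is_groupoid Sg. Proof. by case: (tw_topological hD). Qed.

Lemma tw_pi_dom (s : Sg) : tw_pi (gdom s) = gdom (tw_pi s).
Proof. by case: (tw_pi_hom hD). Qed.
Lemma tw_pi_rng (s : Sg) : tw_pi (grng s) = grng (tw_pi s).
Proof. by case: (tw_pi_hom hD). Qed.
Lemma tw_piM (s t : Sg) : gdom s = grng t ->
  tw_pi (gmul s t) = gmul (tw_pi s) (tw_pi t).
Proof. by case: (tw_pi_hom hD) => _ _ + _; exact. Qed.

Lemma circle1 : circle (1 : C). Proof. exact: normr1. Qed.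

Lemma circleM (z w : C) : circle z -> circle w -> circle (z * w).
Proof. by rewrite /circle /= normrM => -> ->; rewrite mulr1. Qed.

Lemma circleV (z : C) : circle z -> circle z^-1.
Proof. by rewrite /circle /= normfV => ->; rewrite invr1. Qed.

Lemma unit_iota (s : Sg) : gdom s = s -> s = tw_iota D 1 (tw_pi s).
Proof.
move=> su; have us : gunits G (tw_pi s) by rewrite /gunits /= -tw_pi_dom su.
have [z [x [zc xu sE]]] := tw_exact hD us.
have sx : s = tw_iota D 1 x by rewrite -[LHS]su sE (tw_iota_dom hD).
by rewrite [in RHS]sx (tw_pi_iota hD) //; exact: circle1.
Qed.

Lemma rng_iota (s : Sg) : grng s = tw_iota D 1 (grng (tw_pi s)).
Proof. by rewrite -tw_pi_rng; apply: unit_iota; exact: gdom_rng. Qed.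

Lemma dom_iota (s : Sg) : gdom s = tw_iota D 1 (gdom (tw_pi s)).
Proof. by rewrite -tw_pi_dom; apply: unit_iota; exact: gdom_dom. Qed.

Lemma act_composable z (s : Sg) : circle z ->
  gdom (tw_iota D z (grng (tw_pi s))) = grng s.
Proof.
by move=> zc; rewrite (tw_iota_dom hD) ?rng_iota //; exact: gdom_rng.
Qed.

Lemma tw_pi_act z s : circle z -> tw_pi (tw_act z s) = tw_pi s.
Proof.
move=> zc; rewrite tw_piM ?act_composable // (tw_pi_iota hD) //.
  exact: gmul_rng.
exact: gdom_rng.
Qed.

Lemma tw_act1 s : tw_act 1 s = s.
Proof. by rewrite /tw_act -rng_iota gmul_rng. Qed.

Lemma tw_actM z w s : circle z -> circle w ->
  tw_act (z * w) s = tw_act z (tw_act w s).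
Proof.
move=> zc wc; have us : gunits G (grng (tw_pi s)) by exact: gdom_rng.
rewrite {2}/tw_act tw_pi_act // /tw_act (gmulA hSg).
- by rewrite -(tw_iotaM hD).
- by rewrite (tw_iota_dom hD) // (tw_iota_rng hD).
- exact: act_composable.
Qed.

Lemma tw_act_trans (s t : Sg) : tw_pi s = tw_pi t ->
  exists2 z, circle z & t = tw_act z s.
Proof.
move=> st; have dst : gdom t = gdom s by rewrite !dom_iota st.
have cst : gdom t = grng (ginv s) by rewrite dst (grngV hSg).
have piE : tw_pi (gmul t (ginv s)) = grng (tw_pi s).
  rewrite tw_piM // -st -tw_piM ?(grngV hSg) // (gmulV hSg).
  exact: tw_pi_rng.
have us : gunits G (tw_pi (gmul t (ginv s))).
  by rewrite piE; exact: gdom_rng.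
have [z [x [zc xu tsE]]] := tw_exact hD us.
exists z => //; rewrite /tw_act -piE tsE (tw_pi_iota hD) // -tsE.
rewrite -(gmulA hSg) ?(gdomV hSg) // (gmulVl hSg) -dst.
by rewrite (gmul_dom hSg).
Qed.

Lemma line_eq_refl p : line_eq p p.
Proof. by exists 1; [exact: circle1|rewrite mul1r tw_act1]. Qed.

Lemma line_eq_sym p q : line_eq p q -> line_eq q p.
Proof.
move=> [z zc [qE pE]]; have z0 : z != 0 by rewrite -normr_eq0 zc oner_eq0.
exists z^-1; first exact: circleV.
split; first by rewrite qE mulrA mulVf // mul1r.
by rewrite pE -tw_actM ?mulVf ?tw_act1 //; exact: circleV.
Qed.

Lemma line_eq_trans p q r : line_eq p q -> line_eq q r -> line_eq p r.
Proof.
move=> [z zc [qE pE]] [w wc [rE qE']].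
exists (w * z); first exact: circleM.
split; first by rewrite rE qE mulrA.
by rewrite pE qE' -tw_actM // mulrC.
Qed.

Lemma line_eqP p q : \pi_line p = \pi_line q <-> line_eq p q.
Proof.
have piE x : sval (\pi_(cquot line_eq) x) = line_eq x by rewrite unlock.
split => [/(congr1 sval)|pq].
  by move=> /[!piE] /(congr1 (@^~ q)) ->; exact: line_eq_refl.
apply: eq_sig_hprop => [? ? ?|]; first exact: Prop_irrelevance.
rewrite !piE; apply/funext => r; apply/propext; split.
  by apply: line_eq_trans; exact: line_eq_sym.
exact: line_eq_trans.
Qed.

Lemma line_projE p : line_proj (\pi_line p) = tw_pi p.2.
Proof.
rewrite /line_proj; have /line_eqP[z zc [_ ->]] := reprK (\pi_line p).
exact: tw_pi_act.
Qed.

Lemma line_normE p : line_norm (\pi_line p) = complex.Re `|p.1|.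
Proof.
rewrite /line_norm; have /line_eqP[z zc [-> _]] := reprK (\pi_line p).
by rewrite normrM zc mul1r.
Qed.

Lemma line_zero_proj g : line_proj (line_zero g) = g.
Proof. by rewrite line_projE /=; case: (cid _). Qed.

Lemma line_zero_continuous : continuous line_zero.
Proof.
apply/continuousP => W oW.
pose j : Sg -> line := fun s => \pi_line (0, s).
have jc : continuous j.
  move=> s; apply: (@continuous_comp _ _ _ (fun s : Sg => (0 : C, s))).
    exact: pair_continuous.
  exact: pi_continuous.
have jE s : line_zero (tw_pi s) = j s.
  apply/line_eqP; case: (cid _) => t /= ts.
  by have [z zc ->] := tw_act_trans (esym ts); exists z; rewrite ?mulr0.
rewrite (_ : _ @^-1` _ = (@tw_pi R D) @` (j @^-1` W)).
  by apply: (tw_pi_open hD); move/continuousP: jc; exact.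
apply/seteqP; split => [g Wg|_ [s Ws <-]]; last by rewrite /= jE.
by have [s sg] := tw_pi_surj hD g; exists s => //=; rewrite -jE sg.
Qed.

Lemma C0_zero (U : set G) : line_zero \in C0_sections U.
Proof.
apply: mem_set; split => //; first exact: line_zero_proj.
  exact/continuous_subspaceT/line_zero_continuous.
move=> eps eps0; exists set0; split => //; first exact: compact0.
by move=> g _ _; rewrite line_normE [X in `|X|]/= normr0.
Qed.

Section SectionBundle.
Variables (S : set (set G)) (hS : inverse_subsemigroup S).

Definition C0_fib (U : S) := set_type (C0_sections (val U)).
Definition C0_cst0 (U : S) : C0_fib U := SigSub (C0_zero (val U)).
Definition mkC0 (U : S) (xi : G -> line) : C0_fib U := insubd (C0_cst0 U) xi.

(* (xi eta)(g) = xi(g1) eta(g2) for g = g1 g2, g1 in U and g2 in V *)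
Definition sec_mul (U V : set G) (xi eta : G -> line) (g : G) : line :=
  match pselect (exists p : G * G,
    [/\ U p.1, V p.2, gdom p.1 = grng p.2 & g = gmul p.1 p.2]) with
  | left h => line_mul (xi (sval (cid h)).1) (eta (sval (cid h)).2)
  | right _ => line_zero g
  end.

(** The Fell bundle of the spaces C_0(L_U), for U in S. All the functions below
    do lie in the expected C_0(L_W), so that [mkC0] has no effect on them. *)
Definition section_bundle : fell_data R (bissection_isg hG hS) :=
  @FellData R (bissection_isg hG hS) C0_fib
    C0_cst0
    (fun U xi eta => mkC0 U (fun g => line_add (val xi g) (val eta g)))
    (fun U l xi => mkC0 U (fun g => line_scale l (val xi g)))
    (fun U xi => sup [set line_norm (val xi g) | g in val U])
    (fun U V xi eta => mkC0 (S_mul hS U V)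
      (sec_mul (val U) (val V) (val xi) (val eta)))
    (fun U xi => mkC0 (S_inv hS U) (fun g => line_star (val xi (ginv g))))
    (fun U V _ xi => mkC0 V (val xi)).

End SectionBundle.
End LineBundle.

(* Main.v *)
Require Import Defs.
From mathcomp Require Import all_boot all_order all_algebra.
From mathcomp Require Import all_classical all_reals all_analysis.
From mathcomp Require Import generic_quotient complex ring lra.

(** Every object that the construction attaches to the Fell bundle A of the sections is
    identified, point by point, with an object of the given twist.

    The unit space. A formal sum over the idempotents has a function on the unit space
    ([evE]), and multiplying formal sums is multiplying by their functions
    ([fs_mul_smul]). Every C*-seminorm is at most the sup norm of this function
    ([csnE_le]); hence C*(E) is a completion for the sup norm, and evaluation at a unit
    is a character. Conversely a character of C*(E) is the evaluation at a unit
    ([character_point]), by a compactness argument. The resulting bijection [spectrum_pt] of the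
    spectrum with the unit space is a homeomorphism, because there are sections with
    prescribed value at a point and small support ([C0_through]). The latter rely on
    continuous local sections of the twist ([local_section]), whose existence is not part
    of the definition of a twist; they are built from a Urysohn function by means of a
    supremum over the orbits of the circle.

    The action. Conjugation by a section a over U sends the function b to
    |a|^2 (b o r o d^-1), where d and r are restricted to U. As C*(E) embeds in C*(A),
    which is seen on the regular representations of the groupoid ([evE_le_incl]), the
    homeomorphism attached to U sends the source of an arrow of U to its range
    ([thetaE]).

    The germs. To the germ [U, x] corresponds the arrow of U with source x. Since the
    family of bissections is wide, this is a bijection onto the groupoid, and it is an
    isomorphism of topological groupoids ([germ_arrow_iso]).

    The line bundle. To [a, U, x] corresponds the value of a at the arrow of U with
    source x. This is a bijection [line_vec] onto the line bundle of the twist, compatible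
    with all the operations. The topology that it transports satisfies the axioms
    ([pull_L_topology]), and the axioms determine the topology ([L_topology_finer]):
    a vector is the sum of the value of a fixed section and of a vector of small norm.

    The twist. The unit vectors of the line bundle are the classes [1, s], for s in the
    twist, so that the twist of A is the given one, with its projection and its
    embedding of the circle bundle ([sigma_tw_iso], [sigma_tw_pi], [sigma_tw_iotaP]). *)

Set Implicit Arguments.
Unset Strict Implicit.
Unset Printing Implicit Defensive.
Import Order.TTheory GRing.Theory Num.Theory.
Import numFieldNormedType.Exports.
Local Open Scope classical_set_scope.
Local Open Scope ring_scope.
Local Open Scope complex_scope.
Local Open Scope quotient_scope.
Local Notation "z ^*" := (conjc z) : ring_scope.

(** * Complex numbers and the circle *)

Section ComplexNorm.
Variable R : realType.
Local Notation C := R[i].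
Local Notation nc := (@Normc.normc R).

Lemma normE (z : C) : `|z| = (nc z)%:C. Proof. by []. Qed.

Lemma nc_ge0 (z : C) : 0 <= nc z.
Proof. by rewrite -lecR -normE; exact: normr_ge0. Qed.

Lemma nc0 : nc 0 = 0. Proof. by apply: complexI; rewrite -normE normr0. Qed.
Lemma nc1 : nc 1 = 1. Proof. by apply: complexI; rewrite -normE normr1. Qed.
Lemma nc_eq0 (z : C) : (nc z == 0) = (z == 0).
Proof.
by apply/eqP/eqP => [/Normc.eq0_normc//|->]; exact: nc0.
Qed.
Lemma ncM (z w : C) : nc (z * w) = nc z * nc w.
Proof. exact: Normc.normcM. Qed.
Lemma ncD (z w : C) : nc (z + w) <= nc z + nc w.
Proof. exact: le_normcD. Qed.
Lemma ncN (z : C) : nc (- z) = nc z. Proof. exact: normcN. Qed.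
Lemma ncB (z w : C) : nc (z - w) = nc (w - z).
Proof. by rewrite -ncN opprB. Qed.
Lemma ncV (z : C) : nc z^-1 = (nc z)^-1.
Proof. exact: Normc.normcV. Qed.
Lemma ncJ (z : C) : nc z^* = nc z.
Proof. by apply: complexI; rewrite -!normE normcJ. Qed.
Lemma ncC (x : R) : nc x%:C = `|x|.
Proof. by rewrite /Normc.normc /= expr0n addr0 sqrtr_sqr. Qed.
Lemma nc_circle (z : C) : circle z -> nc z = 1.
Proof. by move=> zc; apply: complexI; rewrite -normE zc. Qed.
Lemma circle_nc (z : C) : nc z = 1 -> circle z.
Proof. by move=> zc; rewrite /circle /= normE zc. Qed.
Lemma mulJ_nc (z : C) : z^* * z = ((nc z) ^+ 2)%:C.
Proof. by rewrite rmorphXn/= -normE sqr_normc mulrC. Qed.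
Lemma nc_mulJ (z : C) : nc (z^* * z) = nc z ^+ 2.
Proof. by rewrite ncM ncJ expr2. Qed.
Lemma nc_dist (z w : C) : `|nc z - nc w| <= nc (z - w).
Proof.
have := ncD (z - w) w; have := ncD (w - z) z.
rewrite !subrK (ncB w); set a := nc z; set b := nc w; set c := nc _.
by move=> h1 h2; rewrite ler_norml; apply/andP; split; lra.
Qed.
Lemma Re_nc (z : C) : `|complex.Re z| <= nc z.
Proof. by rewrite -lecR -normE; exact: normc_ge_Re. Qed.
Lemma nci : nc 'i = 1.
Proof. by rewrite /Normc.normc /= expr0n expr1n add0r sqrtr1. Qed.
Lemma Im_nc (z : C) : `|complex.Im z| <= nc z.
Proof.
have := Re_nc (z * 'i); by rewrite ReiNIm normrN ncM nci mulr1.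
Qed.
Lemma nc_ReIm (z : C) : nc z <= `|complex.Re z| + `|complex.Im z|.
Proof.
by rewrite {1}(complexE z) (le_trans (ncD _ _))// ncM !ncC nci mul1r.
Qed.

Lemma nbhs_C (z : C) (W : set C) :
  nbhs z W <-> exists2 e : R, 0 < e & forall w, nc (w - z) < e -> W w.
Proof.
split=> [/nbhs_ballP[e /= e0 eW]|[e e0 eW]].
  have er : e = (complex.Re e)%:C by rewrite RRe_real // gtr0_real.
  exists (complex.Re e); first by rewrite -ltcR -er.
  by move=> w wz; apply: eW; rewrite /ball /= -normrN opprB normE er ltcR.
apply/nbhs_ballP; exists e%:C; first by rewrite /= ltcR.
move=> w; rewrite /ball /= -normrN opprB normE ltcR; exact: eW.
Qed.

Lemma nbhs_C_ball (z : C) (e : R) : 0 < e -> nbhs z [set w | nc (w - z) < e].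
Proof. by move=> e0; apply/nbhs_C; exists e. Qed.

Lemma nbhs_Rdist (x : R) (W : set R) :
  nbhs x W <-> exists2 e : R, 0 < e & forall w, `|w - x| < e -> W w.
Proof.
split=> [/nbhs_ballP[e /= e0 eW]|[e e0 eW]].
  by exists e => // w wz; apply: eW; rewrite /ball /= distrC.
apply/nbhs_ballP; exists e => //= w; rewrite /ball /= distrC; exact: eW.
Qed.

Lemma nc_continuous : continuous (nc : C -> R).
Proof.
move=> z W /nbhs_Rdist[e e0 eW]; apply/nbhs_C; exists e => // w wz.
by apply: eW; exact: le_lt_trans (nc_dist _ _) wz.
Qed.

Lemma cvg_CP (T : Type) (F : set_system T) (f : T -> C) (l : C) : Filter F ->
  (f @ F --> l) <-> (forall e : R, 0 < e -> \forall x \near F, nc (f x - l) < e).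
Proof.
move=> FF; split=> [fl e e0|h W /nbhs_C[e e0 eW]].
  exact: (fl [set w | nc (w - l) < e] (nbhs_C_ball l e0)).
by apply: filterS (h e e0) => x; exact: eW.
Qed.

Lemma cvg_RP (T : Type) (F : set_system T) (f : T -> R) (l : R) : Filter F ->
  (f @ F --> l) <-> (forall e : R, 0 < e -> \forall x \near F, `|f x - l| < e).
Proof.
move=> FF; split=> [fl e e0|h W /nbhs_Rdist[e e0 eW]].
  by apply: (fl [set w | `|w - l| < e]); apply/nbhs_Rdist; exists e.
by apply: filterS (h e e0) => x; exact: eW.
Qed.

End ComplexNorm.

Section Angles.
Variable R : realType.
Local Notation C := R[i].
Local Notation nc := (@Normc.normc R).

Definition cis (t : R) : C := cos t +i* sin t.

Lemma cis0 : cis 0 = 1. Proof. by rewrite /cis cos0 sin0. Qed.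

Lemma cisD s t : cis (s + t) = cis s * cis t.
Proof.
rewrite /cis cosD sinD; apply/eqP; rewrite eq_complex /=.
by rewrite eqxx [sin s * _]mulrC addrC eqxx.
Qed.

Lemma cis_circle t : circle (cis t).
Proof. by apply: circle_nc; rewrite /Normc.normc /= cos2Dsin2 sqrtr1. Qed.

Lemma cis_continuous : continuous cis.
Proof.
move=> t; apply/cvg_CP => e e0.
have h1 : \forall x \near t, `|cos x - cos t| < e / 2.
  by move/cvg_RP: (@continuous_cos R t); apply; rewrite divr_gt0.
have h2 : \forall x \near t, `|sin x - sin t| < e / 2.
  by move/cvg_RP: (@continuous_sin R t); apply; rewrite divr_gt0.
apply: filterS2 h1 h2 => x h1 h2.
by apply: (le_lt_trans (nc_ReIm _)); rewrite /=; lra.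
Qed.

Lemma cis_onto (z : C) : circle z -> exists2 t : R, t \in `[- trigo.pi, trigo.pi] & z = cis t.
Proof.
move=> /nc_circle; case: z => a b; rewrite /Normc.normc /= => ab.
have ab1 : a ^+ 2 + b ^+ 2 = 1.
  by have := congr1 (fun x => x ^+ 2) ab; rewrite sqr_sqrtr ?addr_ge0 ?sqr_ge0 // expr1n.
have a1 : -1 <= a <= 1.
  by rewrite -ler_norml -(@expr_le1 _ 2) // -normrX ger0_norm ?sqr_ge0 //; have := sqr_ge0 b; lra.
have sE : Num.sqrt (1 - a ^+ 2) = `|b|.
  by rewrite -sqrtr_sqr; congr Num.sqrt; lra.
have [t0 tpi] := (acos_ge0 a1, acos_lepi a1).
have [b0|b0] := leP 0 b.
  exists (acos a); first by rewrite in_itv /= tpi (le_trans _ t0) // oppr_le0 pi_ge0.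
  by rewrite /cis acosK // sin_acos // sE ger0_norm.
exists (- acos a); first by rewrite in_itv /= lerN2 tpi /= (le_trans _ (pi_ge0 R)) // oppr_le0.
by rewrite /cis cosN sinN acosK // sin_acos // sE ltr0_norm // opprK.
Qed.

Definition small_angle : R := sin (1 / 4).

Lemma small_angle_gt0 : 0 < small_angle.
Proof.
rewrite -sin0 ltr_sin ?in_itv /= ?divr_gt0 //; have := pihalf_ge1 R; lra.
Qed.

(** The sine increases on the interval of radius 1, so that the distance to 1
    controls the angle there. *)
Lemma cis_small (t : R) : `|t| <= 1 -> nc (cis t - 1) < small_angle ->
  `|t| < 1 / 4.
Proof.
move=> t1 /(le_lt_trans (Im_nc _)) /=; rewrite subr0 /small_angle.
have := pihalf_ge1 R; move: t1; rewrite ler_norml ltr_norml => /andP[t1 t2] p1.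
rewrite -sinN !ltr_sin ?in_itv /=; last 4 first.
- by apply/andP; split; lra.
- by apply/andP; split; lra.
- by apply/andP; split; lra.
- by apply/andP; split; lra.
by rewrite ltr_norml.
Qed.

Lemma circle_small (z : C) : circle z -> nc (z - 1) < small_angle ->
  exists2 t : R, `|t| < 1 / 4 & z = cis t.
Proof.
move=> /nc_circle + z1; have := le_lt_trans (Im_nc _) z1.
have := le_lt_trans (Re_nc _) z1; case: z {z1} => a b /=.
rewrite /Normc.normc subr0 => hR hI ab.
have ab1 : a ^+ 2 + b ^+ 2 = 1.
  by have := congr1 (fun x => x ^+ 2) ab; rewrite sqr_sqrtr ?addr_ge0 ?sqr_ge0 // expr1n.
have b1 : -1 <= b <= 1.
  by rewrite -ler_norml -(@expr_le1 _ 2) // -normrX ger0_norm ?sqr_ge0 //; have := sqr_ge0 a; lra.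
have p1 := pihalf_ge1 R.
have s1 : small_angle <= 1 by have := sin_le1 (1 / 4 : R).
have a0 : 0 <= a.
  by move: hR; rewrite ltr_norml => /andP[+ _]; lra.
have zE : a +i* b = cis (asin b).
  rewrite /cis asinK // cos_asin //; congr (_ +i* _).
  by rewrite -[LHS]ger0_norm // -sqrtr_sqr; congr Num.sqrt; lra.
exists (asin b) => //; rewrite ltr_norml.
move: hI; rewrite -{1}[b]asinK //.
have := asin_geNpi2 b1; have := asin_lepi2 b1.
move: (asin b) => t t1 t2; rewrite /small_angle ltr_norml -sinN !ltr_sin ?in_itv //=.
- by apply/andP; split; lra.
- by apply/andP; split; lra.
- by apply/andP; split; lra.
- by apply/andP; split; lra.
Qed.

End Angles.

(** * Etale groupoids and their bissections *)

Section GroupoidTopology.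

Lemma within_near (T U : topologicalType) (A : set T) (f : T -> U) x (W : set U) :
  {within A, continuous f} -> A x -> nbhs (f x) W ->
  \forall y \near x, A y -> W (f y).
Proof. by move=> /subspace_continuousP fc Ax fW; exact: fc. Qed.

Lemma local_homeo_continuous (T U : topologicalType) (B : set U) (f : T -> U) :
  local_homeo B f -> continuous f.
Proof.
move=> [_ fU] x W fW; have [V [oV Vx _ [fc _ _]]] := fU x.
have := within_near fc Vx fW; apply: filterS2 => [y /[swap]|]; first exact.
exact: open_nbhs_nbhs.
Qed.

Variable G : groupoid_data.

Lemma gmul_near (x y : G) (W : set G) : is_topological_groupoid G ->
  gdom x = grng y -> nbhs (gmul x y) W ->
  exists A B : set G, [/\ nbhs x A, nbhs y B &
    forall a b, A a -> B b -> gdom a = grng b -> W (gmul a b)].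
Proof.
move=> [_ mc _] xy nW.
have [[A B] /= [nA nB] AB] := @within_near _ _ _ _ (x, y) W mc xy nW.
by exists A, B; split => // a b Aa Bb; exact: (AB (a, b)).
Qed.

Hypothesis eG : is_etale_groupoid G.

Lemma etale_groupoid : is_groupoid G. Proof. by case: eG => -[]. Qed.
Local Notation hG := etale_groupoid.

Lemma gdom_continuous : continuous (@gdom G).
Proof. by case: eG => _ _ _ + _; exact: local_homeo_continuous. Qed.

Lemma grng_continuous : continuous (@grng G).
Proof. by case: eG => _ _ _ _; exact: local_homeo_continuous. Qed.

Lemma gunits_dom (g : G) : gunits G (gdom g).
Proof. exact: (gdom_dom hG). Qed.

Lemma gunits_rng (g : G) : gunits G (grng g).
Proof. exact: (gdom_rng hG). Qed.

Lemma gunits_grng (x : G) : gunits G x -> grng x = x.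
Proof. by move=> xu; rewrite -{1}xu (grng_dom hG). Qed.

Lemma gunits_ginv (x : G) : gunits G x -> ginv x = x.
Proof.
move=> xu; have := gmulV hG x; rewrite (gunits_grng xu) => xV.
have := gmul_rng hG (ginv x); rewrite (grngV hG).
by rewrite (xu : gdom x = x) xV.
Qed.

(** Near a unit the source map is injective and takes its values near it, so
    that an arrow near a unit is equal to its source. *)
Lemma gunits_open : open (gunits G).
Proof.
rewrite openE => x xu; case: eG => _ _ _ [_ /(_ x)[U [oU Ux _ [_ inj _]]]] _.
have nU : nbhs x U by exact: open_nbhs_nbhs.
have : nbhs x (@gdom G @^-1` U) by apply: gdom_continuous; rewrite xu.
apply: filterS2 nU => y Uy Udy /=.
by apply: inj; rewrite ?inE // (gdom_dom hG).
Qed.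

Lemma gunits_hausdorff (x y : G) : gunits G x -> gunits G y -> x <> y ->
  exists A B : set G, [/\ open A, open B, A x, B y &
    forall g, gunits G g -> A g -> B g -> False].
Proof.
move=> xu yu xy; case: eG => _ hs _ _ _.
move: hs; rewrite open_hausdorff.
pose X : gunits G := SigSub (mem_set xu); pose Y : gunits G := SigSub (mem_set yu).
have XY : X != Y by apply/eqP => /(congr1 val).
move=> /(_ X Y XY) [[A B]] /=; rewrite !inE => -[AX BY] [[A' oA' AE] [B' oB' BE] AB0].
exists A', B'; split => //.
- by rewrite -AE in AX.
- by rewrite -BE in BY.
move=> g gu Ag Bg; have : (A `&` B) (SigSub (mem_set gu)).
  by split; [rewrite -AE|rewrite -BE].
by rewrite AB0.
Qed.

(** The unit space is locally compact and Hausdorff, hence completely regular. As it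
    is open in the groupoid, the extension by zero stays continuous at the units. *)
Lemma gunits_urysohn (R : realType) (x : G) (O : set G) :
  gunits G x -> nbhs x O ->
  exists (f : G -> R) (K : set G),
    [/\ forall y, 0 <= f y <= 1, f x = 1, compact K, K `<=` gunits G `&` O &
        (forall y, ~ K y -> f y = 0) /\
        forall y, gunits G y -> {for y, continuous f}].
Proof.
move=> xu nO; case: eG => _ hs lc _ _.
pose X : gunits G := SigSub (mem_set xu).
have vc : continuous (val : gunits G -> G) by exact: initial_continuous.
have [Kc nKc [Kcc Kcl]] := lc X I.
have nKc' : nbhs X Kc by move: nKc; rewrite /within /=; apply: filterS => y; exact.
pose B := ~` (((val : gunits G -> G) @^-1` O) `&` Kc)°.
have Bcl : closed B by apply: open_closedC; exact: open_interior.
have nBX : ~ B X.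
  by move=> nI; apply: nI; apply: filterI => //; exact: vc.
have /(@uniform_separatorP _ R)[f [fc f01 f0 f1]] :=
  @locally_compact_completely_regular _ R lc hs _ _ Bcl nBX.
have f01' y : 0 <= f y <= 1 by have := f01 (f y) (imageP _ I); rewrite /= in_itv.
(* The factor 2 makes the support compact: h vanishes where f > 1 / 2, and f is 1
   outside the compact neighbourhood of x. *)
pose h (y : gunits G) : R := Num.max 0 (1 - 2 * f y).
pose K := Kc `&` [set y | f y <= 1 / 2].
have Kclosed : closed [set y | f y <= 1 / 2].
  exact: (@preimage_closed _ _ f [set t | t <= 1 / 2] (fun y _ => fc y) (@closed_le R (1 / 2))).
have hK y : ~ K y -> h y = 0.
  move=> nK; rewrite /h; apply/max_idPl.
  have [fy|fy] := leP (f y) (1 / 2); last by lra.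
  have : B y by apply/not_notP => nBy; apply: nK; split => //; move: nBy => /contrapT/interior_subset[].
  by move=> By; move: fy; rewrite (f1 _ (imageP f By)); lra.
have hc : continuous h.
  move=> y; apply: (@continuous_max _ _ (fun=> 0) (fun y => 1 - 2 * f y)).
    exact: cst_continuous.
  apply: (@continuousB _ R^o _ (fun=> 1) (fun y => 2 * f y) y).
    exact: cst_continuous.
  by apply: (@continuousM _ _ (fun=> 2) f); [exact: cst_continuous|exact: fc].
pose F g : R := match pselect (gunits G g) with
  | left gu => h (SigSub (mem_set gu)) | right _ => 0 end.
have FE (y : gunits G) : F (val y) = h y.
  rewrite /F; case: pselect => [gu|]; last by case; exact/set_mem/valP.
  by congr h; exact: val_inj.
exists F, (val @` K); split.
- move=> y; rewrite /F; case: pselect => [gu|_]; last by rewrite lexx ler01.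
  rewrite /h; have /andP[h0 h1] := f01' (SigSub (mem_set gu)).
  by rewrite le_max lexx /= ge_max ler01 /=; lra.
- rewrite -[x]/(val X) FE /h (f0 (f X)) /=; last by exists X.
  by rewrite mulr0 subr0; apply/max_idPr.
- apply: continuous_compact; first exact: continuous_subspaceT.
  exact: compact_closedI.
- move=> _ [y [Ky fy] <-]; split; first exact/set_mem/valP.
  have : ~ B y by move=> By; move: fy; rewrite /= (f1 _ (imageP f By)); lra.
  by move=> /contrapT/interior_subset[].
split=> y; last first.
  move=> yu; pose Y : gunits G := SigSub (mem_set yu); move=> W.
  rewrite -[y]/(val Y) FE => /hc [P [[V oV VO] PY] PW].
  rewrite -VO in PY.
  have : nbhs (val Y) (V `&` gunits G).
    by apply: filterI; apply: open_nbhs_nbhs; split => //; exact: gunits_open.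
  apply: filterS => z [Vz zu]; have := FE (SigSub (mem_set zu)); rewrite /preimage /= => ->.
  by apply: PW; rewrite -VO.
move=> nK; rewrite /F; case: pselect => // gu; apply: hK => Ky.
by apply: nK; exists (SigSub (mem_set gu)).
Qed.

End GroupoidTopology.

Section Bissections.
Variable G : groupoid_data.
Hypothesis eG : is_etale_groupoid G.
Let hG : is_groupoid G := etale_groupoid eG.

Lemma gdom_nbhs (g : G) (W : set G) : nbhs g W -> nbhs (gdom g) (@gdom G @` W).
Proof.
rewrite nbhsE => -[V [oV Vg] VW].
case: eG => _ _ _ [_ /(_ g)[U [oU Ug [V1 oV1 UE] [_ _ hU]]]] _.
have [V2 oV2 VE] := hU V oV.
have : nbhs (gdom g) (V1 `&` gunits G `&` V2).
  apply: open_nbhs_nbhs; split.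
    by apply: openI => //; apply: openI => //; exact: gunits_open.
  by rewrite -UE -VE; exists g.
apply: filterS => x; rewrite -UE -VE => -[h [Uh Vh] <-].
by exists h => //; exact: VW.
Qed.

Variable U : set G.
Hypothesis bU : bissection U.

Lemma bissection_open : open U. Proof. by case: bU. Qed.

Lemma bissection_nbhs (g : G) : U g -> nbhs g U.
Proof. by move=> Ug; apply: open_nbhs_nbhs; split => //; exact: bissection_open. Qed.

(** The source map is open, and injective on a bissection. *)
Lemma bissection_lift (g : G) (W : set G) : U g -> nbhs g W ->
  exists2 A, nbhs (gdom g) A & forall h, U h -> A (gdom h) -> W h.
Proof.
move=> Ug nW; exists (@gdom G @` (U `&` W)).
  by apply: gdom_nbhs; apply: filterI => //; exact: bissection_nbhs.
move=> h Uh [k [Uk Wk] kh].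
by rewrite -(bissection_domI bU Uk Uh kh).
Qed.

Lemma bissection_separated (g h : G) : U g -> U h -> g <> h ->
  exists A B, [/\ nbhs g A, nbhs h B & forall k, U k -> A k -> B k -> False].
Proof.
move=> Ug Uh gh.
have dgh : gdom g <> gdom h by move/(bissection_domI bU Ug Uh).
have [A [B [oA oB Ag Bh AB]]] := gunits_hausdorff eG (gunits_dom eG g) (gunits_dom eG h) dgh.
exists (@gdom G @^-1` A), (@gdom G @^-1` B); split.
- by apply: (gdom_continuous eG); exact: open_nbhs_nbhs.
- by apply: (gdom_continuous eG); exact: open_nbhs_nbhs.
by move=> k Uk Ak Bk; apply: (AB (gdom k)) => //; exact: gunits_dom.
Qed.

Lemma bissection_compact_lift (K : set G) : compact K ->
  K `<=` @gdom G @` U -> compact (U `&` (@gdom G @^-1` K)).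
Proof.
move=> /compact_near_coveringP Kc KU; apply/compact_near_coveringP => I F P FF FP.
have := Kc I F (fun i x => forall g, U g -> gdom g = x -> P i g) FF.
have h : forall x, K x -> \forall x' \near x & i \near F,
    forall g, U g -> gdom g = x' -> P i g.
  move=> x Kx; have [g Ug gx] := KU _ Kx.
  have UKg : (U `&` (@gdom G @^-1` K)) g by split => //=; rewrite gx.
  have [[A J] /= [nA FJ] AJ] := FP g UKg.
  have [B nB BA] := bissection_lift Ug nA; rewrite gx in nB.
  exists (B, J) => // -[x' i] /= [Bx' Ji] h Uh hx'.
  by apply: (AJ (h, i)); split => //=; apply: BA => //; rewrite hx'.
by move=> /(_ h); apply: filterS => i Ki g [Ug Kg]; exact: (Ki _ Kg).
Qed.

(** A bissection is homeomorphic to an open set of units, even if the groupoid is not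
    Hausdorff. *)
Lemma bissection_urysohn (R : realType) (g : G) (W : set G) :
  U g -> nbhs g W ->
  exists (f : G -> R) (K : set G),
    [/\ forall h, 0 <= f h <= 1, f g = 1, compact K, K `<=` U `&` W &
        (forall h, ~ K h -> f h = 0) /\ forall h, U h -> {for h, continuous f}].
Proof.
move=> Ug nW.
have nUW : nbhs (gdom g) (@gdom G @` (U `&` W)).
  by apply: gdom_nbhs; apply: filterI => //; exact: bissection_nbhs.
have [f [K [f01 f1 Kc KUW [f0 fc]]]] := gunits_urysohn eG R (gunits_dom eG g) nUW.
exists (fun h => if `[< U h >] then f (gdom h) else 0).
exists (U `&` (@gdom G @^-1` K)); split.
- by move=> h; case: asboolP => // _; rewrite lexx ler01.
- by case: asboolP.
- by apply: bissection_compact_lift => // x /KUW[_ [h [Uh _] <-]]; exists h.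
- move=> h [Uh /KUW[_ [k [Uk Wk] kh]]]; split => //.
  by rewrite -(bissection_domI bU Uk Uh kh).
split=> h.
  by move=> nK; case: asboolP => // Uh; apply: f0 => Kh; exact: nK.
move=> Uh V; case: asboolP => // _ nV.
have : nbhs h (@gdom G @^-1` (f @^-1` V)).
  by apply: (gdom_continuous eG); apply: fc => //; exact: gunits_dom.
apply: filterS2 (bissection_nbhs Uh) => k Uk; rewrite /preimage /=.
by case: asboolP.
Qed.

End Bissections.

(** * Quotients and limits of sequences *)

Lemma cquotP (T : Type) (r : T -> T -> Prop) (x y : T) : (forall x, r x x) ->
  (forall x y, r x y -> r y x) -> (forall x y z, r x y -> r y z -> r x z) ->
  \pi_(cquot r) x = \pi_(cquot r) y <-> r x y.
Proof.
move=> rr rs rt; have piE z : sval (\pi_(cquot r) z) = r z by rewrite unlock.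
split => [/(congr1 sval)|xy].
  by move=> /[!piE] /(congr1 (@^~ y)) ->.
apply: eq_sig_hprop => [? ? ?|]; first exact: Prop_irrelevance.
rewrite !piE; apply/funext => z; apply/propext; split; apply: rt => //.
exact: rs.
Qed.

Section Limits.
Variable R : realType.
Local Notation C := R[i].
Local Notation nc := (@Normc.normc R).

Definition tendsto (z : nat -> C) (l : C) :=
  forall e : R, 0 < e -> exists N, forall n, (N <= n)%N -> nc (z n - l) < e.

Lemma tendsto_unique z l m : tendsto z l -> tendsto z m -> l = m.
Proof.
move=> zl zm; apply: contrapT => lm.
have e0 : 0 < nc (l - m) / 2.
  rewrite divr_gt0 // lt_neqAle nc_ge0 andbT eq_sym nc_eq0 subr_eq0.
  exact/eqP.
have [N Nl] := zl _ e0; have [N' Nm] := zm _ e0.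
have := Nl (maxn N N') (leq_maxl _ _); have := Nm (maxn N N') (leq_maxr _ _).
have := ncD (l - z (maxn N N')) (z (maxn N N') - m).
rewrite addrA subrK (ncB l (z _)).
by move: (nc (l - m)) (nc _) (nc _) => a b c; lra.
Qed.

Lemma real_cauchy (x : nat -> R) :
  (forall e, 0 < e -> exists N, forall m n, (N <= m)%N -> (N <= n)%N -> `|x m - x n| < e) ->
  cvg (x @ \oo).
Proof.
move=> xc; apply: cauchy_cvg; apply/cauchy_ballP => e e0.
have [N xN] := xc e e0.
exists ([set x n | n in [set n | (N <= n)%N]], [set x n | n in [set n | (N <= n)%N]]).
  by split; exists N => // n /= Nn; exists n.
by move=> [_ _] /= [[m Nm <-] [n Nn <-]]; exact: xN.
Qed.

Lemma real_cvgP (x : nat -> R) (l : R) : x @ \oo --> l <->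
  forall e : R, 0 < e -> exists N, forall n, (N <= n)%N -> `|x n - l| < e.
Proof.
split=> [/cvg_RP xl e /xl [N _ xN]|xl]; first by exists N => n Nn; exact: xN.
by apply/cvg_RP => e /xl[N xN]; exists N => // n /= Nn; exact: xN.
Qed.

Lemma tendsto_cauchy (z : nat -> C) :
  (forall e : R, 0 < e -> exists N, forall m n, (N <= m)%N -> (N <= n)%N -> nc (z m - z n) < e) ->
  exists l, tendsto z l.
Proof.
move=> zc.
have re : cvg ((fun n => complex.Re (z n)) @ \oo).
  apply: real_cauchy => e /zc[N zN]; exists N => m n Nm Nn.
  apply: le_lt_trans (zN m n Nm Nn); apply: le_trans (Re_nc _).
  by case: (z m) (z n) => a b [c d].
have im : cvg ((fun n => complex.Im (z n)) @ \oo).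
  apply: real_cauchy => e /zc[N zN]; exists N => m n Nm Nn.
  apply: le_lt_trans (zN m n Nm Nn); apply: le_trans (Im_nc _).
  by case: (z m) (z n) => a b [c d].
exists (lim ((fun n => complex.Re (z n)) @ \oo) +i* lim ((fun n => complex.Im (z n)) @ \oo)).
move=> e e0; have e2 : 0 < e / 2 by rewrite divr_gt0.
have [N1 h1] := (real_cvgP _ _).1 re _ e2; have [N2 h2] := (real_cvgP _ _).1 im _ e2.
exists (maxn N1 N2) => n; rewrite geq_max => /andP[/h1 + /h2].
move: (lim _) (lim _) => a b ca db; apply: le_lt_trans (nc_ReIm _) _.
by move: ca db; case: (z n) => c d /=; lra.
Qed.

End Limits.

(** * The enveloping algebra of a Fell bundle *)

Section Enveloping.
Variables (R : realType) (S : inverse_semigroup) (A : fell_data R S).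
Local Notation C := R[i].
Local Notation nc := (@Normc.normc R).
Local Open Scope isg_scope.

(** The laws of a Fell bundle on which the construction of its enveloping
    algebra relies, the last one being the finiteness of the largest seminorm. *)
Record star_laws : Prop := StarLaws {
  law_sub : forall s (a : A s), fadd a (fscale (-1) a) = fzero A s;
  law_scaleA : forall s l m (a : A s), fscale l (fscale m a) = fscale (l * m) a;
  law_scale1 : forall s (a : A s), fscale 1 a = a;
  law_mulZl : forall s t l (a : A s) (b : A t),
    fmul (fscale l a) b = fscale l (fmul a b);
  law_mulZr : forall s t l (a : A s) (b : A t),
    fmul a (fscale l b) = fscale l (fmul a b);
  law_starK : forall s (a : A s), dlt (fstar (fstar a)) = dlt a;
  law_starZ : forall s l (a : A s), fstar (fscale l a) = fscale l^* (fstar a);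
  law_bounded : forall u : fsum A, exists M, forall p,
    cstar_seminorm p -> p u <= M }.

Hypothesis sl : star_laws.
Implicit Types u v w : fsum A.

Lemma fs_scale_cat l u v : fs_scale l (u ++ v) = fs_scale l u ++ fs_scale l v.
Proof. exact: map_cat. Qed.

Lemma fs_scaleA l m u : fs_scale l (fs_scale m u) = fs_scale (l * m) u.
Proof.
by rewrite /fs_scale -map_comp; apply: eq_map => -[s a] /=; rewrite (law_scaleA sl).
Qed.

Lemma fs_scale1 u : fs_scale 1 u = u.
Proof.
by rewrite /fs_scale -[RHS]map_id; apply: eq_map => -[s a] /=; rewrite (law_scale1 sl).
Qed.

Lemma fs_mul_catl u v w : fs_mul (u ++ v) w = fs_mul u w ++ fs_mul v w.
Proof. by rewrite /fs_mul; elim: u => //= p u ->; rewrite catA. Qed.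

Lemma fs_mulZl l u v : fs_mul (fs_scale l u) v = fs_scale l (fs_mul u v).
Proof.
elim: u => //= p u; rewrite /fs_mul /= => ->; rewrite fs_scale_cat; congr (_ ++ _).
by rewrite /fs_scale -map_comp; apply: eq_map => -[s a] /=; rewrite (law_mulZl sl).
Qed.

Lemma fs_mulZr l u v : fs_mul u (fs_scale l v) = fs_scale l (fs_mul u v).
Proof.
elim: u => //= p u; rewrite /fs_mul /= => ->; rewrite fs_scale_cat; congr (_ ++ _).
by rewrite /fs_scale -!map_comp; apply: eq_map => -[s a] /=; rewrite (law_mulZr sl).
Qed.

Lemma fs_star_cat u v : fs_star (u ++ v) = fs_star u ++ fs_star v.
Proof. exact: map_cat. Qed.

Lemma fs_starK u : fs_star (fs_star u) = u.
Proof.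
by rewrite /fs_star -map_comp -[RHS]map_id; apply: eq_map => -[s a] /=; exact: (law_starK sl).
Qed.

Lemma fs_starZ l u : fs_star (fs_scale l u) = fs_scale l^* (fs_star u).
Proof.
by rewrite /fs_star /fs_scale -!map_comp; apply: eq_map => -[s a] /=; rewrite (law_starZ sl).
Qed.

Lemma fs_eq_catl u v w : fs_eq v w -> fs_eq (u ++ v) (u ++ w).
Proof. by apply: fs_eq_cat; exact: fs_eq_refl. Qed.

Lemma fs_eq_catr u v w : fs_eq v w -> fs_eq (v ++ u) (w ++ u).
Proof. by move=> vw; apply: fs_eq_cat => //; exact: fs_eq_refl. Qed.

Lemma fs_eq_ACA u v u' v' : fs_eq ((u ++ v) ++ (u' ++ v')) ((u ++ u') ++ (v ++ v')).
Proof.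
rewrite -!catA; apply: fs_eq_catl; rewrite !catA; apply: fs_eq_catr.
exact: fs_eq_catC.
Qed.

Lemma fs_sub_self u : fs_eq (fs_sub u u) [::].
Proof.
rewrite /fs_sub; elim: u => [|[s a] u IH]; first exact: fs_eq_refl.
apply: (@fs_eq_trans _ _ _ _ ([:: dlt a; dlt (fscale (-1) a)] ++ (u ++ fs_scale (-1) u))).
  exact: (fs_eq_ACA [:: dlt a] u [:: dlt (fscale (-1) a)] (fs_scale (-1) u)).
apply: (fs_eq_trans (fs_eq_cat (fs_eq_add a (fscale (-1) a)) IH)).
by rewrite (law_sub sl) cats0; exact: fs_eq_zero.
Qed.

Lemma fs_mul_catr u v w : fs_eq (fs_mul u (v ++ w)) (fs_mul u v ++ fs_mul u w).
Proof.
elim: u => [|p u IH]; first exact: fs_eq_refl.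
have cons x : fs_mul (p :: u) x = fs_mul [:: p] x ++ fs_mul u x.
  exact: (fs_mul_catl [:: p] u x).
have one : fs_mul [:: p] (v ++ w) = fs_mul [:: p] v ++ fs_mul [:: p] w.
  by rewrite /fs_mul /= !cats0 map_cat.
rewrite !cons one; apply: fs_eq_trans (fs_eq_ACA _ _ _ _).
exact: fs_eq_catl.
Qed.

Section Seminorm.
Variable p : fsum A -> R.
Hypothesis pP : cstar_seminorm p.

Lemma csn_nil : p [::] = 0.
Proof. by have := csn_scale pP 0 [::]; rewrite normr0 mul0r. Qed.

Lemma csnZ l u : p (fs_scale l u) = nc l * p u.
Proof. exact: csn_scale. Qed.

Lemma csnN u : p (fs_scale (-1) u) = p u.
Proof. by rewrite csnZ ncN nc1 mul1r. Qed.

Lemma csn_sub_self u : p (fs_sub u u) = 0.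
Proof. by rewrite (csn_eq pP (fs_sub_self u)) csn_nil. Qed.

Lemma csn_ge0 u : 0 <= p u.
Proof.
by have := csn_add pP u (fs_scale (-1) u); rewrite csnN csn_sub_self; lra.
Qed.

Lemma csn_subC u v : p (fs_sub u v) = p (fs_sub v u).
Proof.
rewrite -csnN /fs_sub fs_scale_cat fs_scaleA mulrNN mulr1 fs_scale1.
exact: (csn_eq pP (fs_eq_catC _ _)).
Qed.

Lemma fs_sub_trans u v w : fs_eq (fs_sub u v ++ fs_sub v w) (fs_sub u w).
Proof.
rewrite /fs_sub -catA; apply: fs_eq_catl; rewrite catA -[X in fs_eq _ X]cat0s.
apply: fs_eq_catr; apply: fs_eq_trans (fs_eq_catC _ _) _; exact: fs_sub_self.
Qed.

Lemma csn_sub_trans u v w : p (fs_sub u w) <= p (fs_sub u v) + p (fs_sub v w).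
Proof. by rewrite -(csn_eq pP (fs_sub_trans u v w)) (csn_add pP). Qed.

Lemma csn_sub_le u v : p u <= p v + p (fs_sub u v).
Proof.
have E : fs_eq (v ++ fs_sub u v) u.
  rewrite /fs_sub catA; apply: fs_eq_trans (fs_eq_catr _ (fs_eq_catC _ _)) _.
  rewrite -catA -[X in fs_eq _ X]cats0; apply: fs_eq_catl; exact: fs_sub_self.
by rewrite -{1}(csn_eq pP E) (csn_add pP).
Qed.

Lemma csn_dist u v : `|p u - p v| <= p (fs_sub u v).
Proof.
have := csn_sub_le u v; have := csn_sub_le v u; rewrite csn_subC => h1 h2.
by rewrite ler_norml; apply/andP; split; lra.
Qed.

(** The C*-identity and the submultiplicativity give p(v)^2 <= p(star v) p(v). *)
Lemma csn_star u : p (fs_star u) = p u.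
Proof.
have le v : p v <= p (fs_star v).
  have := csn_mul pP (fs_star v) v; rewrite (csn_cstar pP) expr2.
  have := csn_ge0 v; rewrite le_eqVlt => /orP[/eqP <- _|v0]; first exact: csn_ge0.
  by rewrite ler_pM2r.
apply/eqP; rewrite eq_le; apply/andP; split; last exact: le.
by have := le (fs_star u); rewrite fs_starK.
Qed.

Lemma csn_mul_sub u v u' v' : p (fs_sub (fs_mul u v) (fs_mul u' v')) <=
  p (fs_sub u u') * p v + p u' * p (fs_sub v v').
Proof.
have E : fs_eq (fs_mul (fs_sub u u') v ++ fs_mul u' (fs_sub v v'))
               (fs_sub (fs_mul u v) (fs_mul u' v')).
  rewrite /fs_sub fs_mul_catl fs_mulZl.
  apply: fs_eq_trans (fs_eq_catl _ (fs_mul_catr _ _ _)) _; rewrite fs_mulZr.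
  exact: fs_sub_trans.
rewrite -(csn_eq pP E); apply: le_trans (csn_add pP _ _) _.
by apply: lerD; exact: (csn_mul pP).
Qed.

End Seminorm.

Local Notation q := (env_norm (A := A)).

Lemma csn0 : cstar_seminorm (fun _ : fsum A => 0 : R).
Proof. by split => // *; rewrite ?addr0 ?mulr0 ?expr0n. Qed.

Lemma env_norm_sup p u : cstar_seminorm p -> p u <= q u.
Proof.
move=> pP; apply: ub_le_sup; last by exists p.
by have [M pM] := law_bounded sl u; exists M => _ [p' p'P ->]; exact: pM.
Qed.

Lemma env_norm_le u M : (forall p, cstar_seminorm p -> p u <= M) -> q u <= M.
Proof.
move=> pM; apply: ge_sup; first by exists 0, (fun=> 0) => //; exact: csn0.
by move=> _ [p pP ->]; exact: pM.
Qed.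

Lemma env_norm_ge0 u : 0 <= q u.
Proof. exact: (env_norm_sup u csn0). Qed.

Lemma env_norm_cstar : cstar_seminorm q.
Proof.
split=> [u v uv|u v|l u|u v|u].
- apply/eqP; rewrite eq_le; apply/andP; split; apply: env_norm_le => p pP.
    by rewrite (csn_eq pP uv); exact: env_norm_sup.
  by rewrite -(csn_eq pP uv); exact: env_norm_sup.
- apply: env_norm_le => p pP; apply: le_trans (csn_add pP u v) _.
  by apply: lerD; exact: env_norm_sup.
- rewrite -[complex.Re _]/(nc l); apply/eqP; rewrite eq_le; apply/andP; split.
    apply: env_norm_le => p pP; rewrite (csnZ pP) ler_wpM2l ?nc_ge0 //.
    exact: env_norm_sup.
  have [->|ln0] := eqVneq (nc l) 0; first by rewrite mul0r env_norm_ge0.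
  have l0 : 0 < nc l by rewrite lt_neqAle eq_sym ln0 nc_ge0.
  rewrite mulrC -ler_pdivlMr //; apply: env_norm_le => p pP.
  by rewrite ler_pdivlMr // mulrC -(csnZ pP); exact: env_norm_sup.
- apply: env_norm_le => p pP; apply: le_trans (csn_mul pP u v) _.
  by apply: ler_pM; rewrite ?(csn_ge0 pP) //; exact: env_norm_sup.
apply/eqP; rewrite eq_le; apply/andP; split.
  apply: env_norm_le => p pP; rewrite (csn_cstar pP) ler_sqr ?nnegrE ?(csn_ge0 pP) ?env_norm_ge0 //.
  exact: env_norm_sup.
rewrite -[leRHS]sqr_sqrtr ?env_norm_ge0 // ler_sqr ?nnegrE ?env_norm_ge0 ?sqrtr_ge0 //.
apply: env_norm_le => p pP; rewrite -[leLHS]ger0_norm ?(csn_ge0 pP) // -sqrtr_sqr.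
by apply: ler_wsqrtr; rewrite -(csn_cstar pP); exact: env_norm_sup.
Qed.

Local Notation qP := env_norm_cstar.

End Enveloping.

Section Completion.
Variables (R : realType) (S : inverse_semigroup) (A : fell_data R S).
Local Notation C := R[i].
Local Notation nc := (@Normc.normc R).
Local Open Scope isg_scope.
Hypothesis sl : star_laws A.
Implicit Types u v w : nat -> fsum A.
Local Notation q := (env_norm (A := A)).
Let qP : cstar_seminorm q := env_norm_cstar sl.

Lemma env_eq_val (x y : cauchy_fsum A) : env_eq x y <->
  forall e : R, 0 < e -> exists N, forall n, (N <= n)%N -> q (fs_sub (val x n) (val y n)) < e.
Proof.
rewrite /env_eq real_cvgP /=.
by split=> h e /h[N hN]; exists N => n /hN; rewrite subr0 ger0_norm ?(csn_ge0 sl qP).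
Qed.

Lemma env_eq_pi (x y : cauchy_fsum A) : \pi_(Cstar A) x = \pi_(Cstar A) y <-> env_eq x y.
Proof.
apply: cquotP => [{}x|{}x {}y|{}x {}y z].
- by apply/env_eq_val => e e0; exists 0%N => n _; rewrite (csn_sub_self sl qP).
- move=> /env_eq_val xy; apply/env_eq_val => e /xy[N xyN]; exists N => n /xyN.
  by rewrite (csn_subC sl qP).
move=> /env_eq_val xy /env_eq_val yz; apply/env_eq_val => e e0.
have e2 : 0 < e / 2 by rewrite divr_gt0.
have [N1 h1] := xy _ e2; have [N2 h2] := yz _ e2.
exists (maxn N1 N2) => n; rewrite geq_max => /andP[/h1 + /h2].
by have := csn_sub_trans sl qP (val x n) (val y n) (val z n); lra.
Qed.

Lemma mkC_eq u v : env_cauchy u -> env_cauchy v -> mkC u = mkC v <->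
  forall e : R, 0 < e -> exists N, forall n, (N <= n)%N -> q (fs_sub (u n) (v n)) < e.
Proof.
by move=> uC vC; rewrite /mkC env_eq_pi env_eq_val !insubdK //; apply: mem_set.
Qed.

Lemma repC_cauchy (x : Cstar A) : env_cauchy (repC x).
Proof. exact: set_mem (valP (repr x : cauchy_fsum A)). Qed.

Lemma mkC_rep (x : Cstar A) : mkC (repC x) = x.
Proof. by rewrite /mkC /repC valKd reprK. Qed.

Lemma rep_mkC u : env_cauchy u ->
  forall e : R, 0 < e -> exists N, forall n, (N <= n)%N -> q (fs_sub (repC (mkC u) n) (u n)) < e.
Proof. by move=> uC; apply/mkC_eq => //; [exact: repC_cauchy|exact: mkC_rep]. Qed.

Lemma mkC_ext u v : env_cauchy u -> env_cauchy v ->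
  (forall n, q (fs_sub (u n) (v n)) = 0) -> mkC u = mkC v.
Proof. by move=> uC vC uv; apply/mkC_eq => // e e0; exists 0%N => n _; rewrite uv. Qed.

Lemma cauchy_cst (a : fsum A) : env_cauchy (fun=> a).
Proof. by move=> e e0; exists 0%N => m n _ _; rewrite (csn_sub_self sl qP). Qed.

Lemma cauchy_bounded u : env_cauchy u -> exists2 M : R, 0 < M & exists N, forall n, (N <= n)%N -> q (u n) <= M.
Proof.
move=> /(_ 1 ltr01)[N uN]; exists (q (u N) + 1); first by have := csn_ge0 sl qP (u N); lra.
exists N => n Nn; have := csn_sub_le sl qP (u n) (u N).
by have := uN n N Nn (leqnn _); lra.
Qed.

Lemma cauchy_map (f : fsum A -> fsum A) (K : R) u : 0 <= K ->
  (forall a b, q (fs_sub (f a) (f b)) <= K * q (fs_sub a b)) ->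
  env_cauchy u -> env_cauchy (fun n => f (u n)).
Proof.
move=> K0 fK uC e e0; have K1 : 0 < K + 1 by lra.
have [|N uN] := uC (e / (K + 1)); first by rewrite divr_gt0.
exists N => m n Nm Nn; apply: le_lt_trans (fK _ _) _.
have := uN m n Nm Nn; rewrite ltr_pdivlMr // mulrC => /(le_lt_trans _); apply.
by rewrite ler_wpM2r ?(csn_ge0 sl qP) // lerDl.
Qed.

Lemma mkC_map (f : fsum A -> fsum A) (K : R) u v : 0 <= K ->
  (forall a b, q (fs_sub (f a) (f b)) <= K * q (fs_sub a b)) ->
  env_cauchy u -> env_cauchy v -> mkC u = mkC v ->
  mkC (fun n => f (u n)) = mkC (fun n => f (v n)).
Proof.
move=> K0 fK uC vC /(mkC_eq uC vC) uv; apply/mkC_eq; try exact: cauchy_map K0 fK _.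
move=> e e0; have K1 : 0 < K + 1 by lra.
have [|N uvN] := uv (e / (K + 1)); first by rewrite divr_gt0.
exists N => n Nn; apply: le_lt_trans (fK _ _) _.
have := uvN n Nn; rewrite ltr_pdivlMr // mulrC => /(le_lt_trans _); apply.
by rewrite ler_wpM2r ?(csn_ge0 sl qP) // lerDl.
Qed.

Lemma fs_sub_cat (a b c d : fsum A) :
  fs_eq (fs_sub (a ++ b) (c ++ d)) (fs_sub a c ++ fs_sub b d).
Proof. by rewrite /fs_sub fs_scale_cat; exact: fs_eq_ACA. Qed.

Lemma cauchy_cat u v : env_cauchy u -> env_cauchy v -> env_cauchy (fun n => u n ++ v n).
Proof.
move=> uC vC e e0; have e2 : 0 < e / 2 by rewrite divr_gt0.
have [N1 h1] := uC _ e2; have [N2 h2] := vC _ e2.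
exists (maxn N1 N2) => m n; rewrite !geq_max => /andP[m1 m2] /andP[n1 n2].
rewrite (csn_eq qP (fs_sub_cat _ _ _ _)); apply: le_lt_trans (csn_add qP _ _) _.
by have := h1 m n m1 n1; have := h2 m n m2 n2; lra.
Qed.

Lemma CaddE u v : env_cauchy u -> env_cauchy v ->
  Cadd (mkC u) (mkC v) = mkC (fun n => u n ++ v n).
Proof.
move=> uC vC; apply/mkC_eq; try by apply: cauchy_cat => //; exact: repC_cauchy.
move=> e e0; have e2 : 0 < e / 2 by rewrite divr_gt0.
have [N1 h1] := rep_mkC uC e2; have [N2 h2] := rep_mkC vC e2.
exists (maxn N1 N2) => n; rewrite !geq_max => /andP[n1 n2].
rewrite (csn_eq qP (fs_sub_cat _ _ _ _)); apply: le_lt_trans (csn_add qP _ _) _.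
by have := h1 n n1; have := h2 n n2; lra.
Qed.

Lemma fs_sub_scale l (a b : fsum A) :
  q (fs_sub (fs_scale l a) (fs_scale l b)) <= nc l * q (fs_sub a b).
Proof.
rewrite -(csnZ qP) /fs_sub fs_scale_cat !(fs_scaleA sl).
by rewrite mulrC lexx.
Qed.

Lemma cauchy_scale l u : env_cauchy u -> env_cauchy (fun n => fs_scale l (u n)).
Proof. exact: cauchy_map (nc_ge0 l) (fs_sub_scale l). Qed.

Lemma CscaleE l u : env_cauchy u -> Cscale l (mkC u) = mkC (fun n => fs_scale l (u n)).
Proof.
move=> uC; apply: (mkC_map (nc_ge0 l) (fs_sub_scale l)) => //; first exact: repC_cauchy.
exact: mkC_rep.
Qed.

Lemma fs_sub_star (a b : fsum A) :
  q (fs_sub (fs_star a) (fs_star b)) <= 1 * q (fs_sub a b).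
Proof.
rewrite mul1r -[leRHS](csn_star sl qP) /fs_sub fs_star_cat (fs_starZ sl).
by rewrite rmorphN rmorph1 lexx.
Qed.

Lemma cauchy_star u : env_cauchy u -> env_cauchy (fun n => fs_star (u n)).
Proof. exact: cauchy_map ler01 fs_sub_star. Qed.

Lemma mul_small u v u' v' : env_cauchy v -> env_cauchy u' ->
  (forall e : R, 0 < e -> exists N, forall m n, (N <= m)%N -> (N <= n)%N ->
    q (fs_sub (u m) (u' n)) < e /\ q (fs_sub (v m) (v' n)) < e) ->
  forall e : R, 0 < e -> exists N, forall m n, (N <= m)%N -> (N <= n)%N ->
    q (fs_sub (fs_mul (u m) (v m)) (fs_mul (u' n) (v' n))) < e.
Proof.
move=> /cauchy_bounded[M1 M10 [N1 h1]] /cauchy_bounded[M2 M20 [N2 h2]] uv e e0.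
have K0 : 0 < M1 + M2 + 1 by lra.
have d0 : 0 < e / (M1 + M2 + 1) by rewrite divr_gt0.
have [N hN] := uv _ d0.
exists (maxn N (maxn N1 N2)) => m n; rewrite !geq_max => /and3P[m0 m1 m2] /and3P[n0 n1 n2].
apply: le_lt_trans (csn_mul_sub sl qP _ _ _ _) _.
have [/ltW a /ltW b] := hN m n m0 n0.
have h3 := ler_pM (csn_ge0 sl qP _) (csn_ge0 sl qP _) a (h1 m m1).
have h4 := ler_pM (csn_ge0 sl qP _) (csn_ge0 sl qP _) (h2 n n2) b.
have E : e / (M1 + M2 + 1) * M1 + M2 * (e / (M1 + M2 + 1)) + e / (M1 + M2 + 1) = e.
  by field; rewrite gt_eqF.
by move: h3 h4 d0 E; move: (e / _) => x; lra.
Qed.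

Lemma cauchy_mul u v : env_cauchy u -> env_cauchy v -> env_cauchy (fun n => fs_mul (u n) (v n)).
Proof.
move=> uC vC; apply: mul_small => // e e0.
have [N1 h1] := uC _ e0; have [N2 h2] := vC _ e0.
exists (maxn N1 N2) => m n; rewrite !geq_max => /andP[m1 m2] /andP[n1 n2].
by split; [exact: h1|exact: h2].
Qed.

Lemma CmulE u v : env_cauchy u -> env_cauchy v ->
  Cmul (mkC u) (mkC v) = mkC (fun n => fs_mul (u n) (v n)).
Proof.
move=> uC vC; apply/mkC_eq; try by apply: cauchy_mul => //; exact: repC_cauchy.
move=> e e0.
have mix w : env_cauchy w -> forall e : R, 0 < e -> exists N, forall m n, (N <= m)%N -> (N <= n)%N ->
    q (fs_sub (repC (mkC w) m) (w n)) < e.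
  move=> wC {}e {}e0; have e2 : 0 < e / 2 by rewrite divr_gt0.
  have [N1 h1] := rep_mkC wC e2; have [N2 h2] := wC _ e2.
  exists (maxn N1 N2) => m n; rewrite !geq_max => /andP[m1 m2] /andP[n1 n2].
  apply: le_lt_trans (csn_sub_trans sl qP _ (w m) _) _.
  by have := h1 m m1; have := h2 m n m2 n2; lra.
have [|N hN] := @mul_small (repC (mkC u)) (repC (mkC v)) u v (repC_cauchy _) uC _ e e0.
  move=> {}e {}e0; have [N1 h1] := mix u uC e e0; have [N2 h2] := mix v vC e e0.
  exists (maxn N1 N2) => m n; rewrite !geq_max => /andP[m1 m2] /andP[n1 n2].
  by split; [exact: h1|exact: h2].
by exists N => n Nn; exact: hN.
Qed.

Lemma Cnorm_le u (e : R) N : env_cauchy u -> (forall n, (N <= n)%N -> q (u n) <= e) ->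
  Cnorm (mkC u) <= e.
Proof.
move=> uC uN; rewrite /Cnorm.
have cv : cvg ((fun n => q (repC (mkC u) n)) @ \oo).
  apply: real_cauchy => d /(repC_cauchy (mkC u))[M hM]; exists M => m n Mm Mn.
  by apply: le_lt_trans (csn_dist sl qP _ _) _; exact: hM.
apply/ler_addgt0Pr => d d0; apply: limr_le; first exact: cv.
have [M hM] := rep_mkC uC d0.
exists (maxn N M) => // n /=; rewrite geq_max => /andP[/uN h1 /hM h2].
have := csn_sub_le sl qP (repC (mkC u) n) (u n); lra.
Qed.

Lemma Cstar_dense (x : Cstar A) (e : R) : 0 < e ->
  exists (a : fsum A) (y : Cstar A), x = Cadd (mkC (fun=> a)) y /\ Cnorm y <= e.
Proof.
move=> e0; have xC := repC_cauchy x; have [N hN] := xC e e0.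
have yC : env_cauchy (fun n => fs_sub (repC x n) (repC x N)).
  by apply: cauchy_cat => //; exact: cauchy_cst.
exists (repC x N), (mkC (fun n => fs_sub (repC x n) (repC x N))); split.
  rewrite CaddE //; last exact: cauchy_cst.
  rewrite -[LHS]mkC_rep; apply: mkC_ext => //.
    by apply: cauchy_cat => //; exact: cauchy_cst.
  move=> n; rewrite (csn_subC sl qP).
  have E : fs_eq (repC x N ++ fs_sub (repC x n) (repC x N)) (repC x n).
    rewrite /fs_sub catA; apply: fs_eq_trans (fs_eq_catr _ (fs_eq_catC _ _)) _.
    rewrite -catA -[X in fs_eq _ X]cats0; apply: fs_eq_catl; exact: fs_sub_self.
  rewrite (csn_eq qP (fs_eq_catr _ E)); exact: (csn_sub_self sl qP).
by apply: (@Cnorm_le _ _ N yC) => n Nn; apply/ltW/hN.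
Qed.

Lemma chr_sum (chi : Cstar A -> C) (u : fsum A) : is_character chi ->
  chi (mkC (fun=> u)) = \sum_(p <- u) chi (Cdelta (projT2 p)).
Proof.
move=> chiP; elim: u => [|[s a] u IH]; last first.
  rewrite big_cons -IH -(chr_add chiP) CaddE //; exact: cauchy_cst.
rewrite big_nil; have -> : mkC (fun=> [::]) = Cscale 0 (mkC (fun=> [::] : fsum A)).
  by rewrite CscaleE //; exact: cauchy_cst.
by rewrite (chr_scale chiP) mul0r.
Qed.

Lemma chr_le (chi : Cstar A -> C) : is_character chi -> exists2 M : R, 0 < M & forall x, nc (chi x) <= M * Cnorm x.
Proof.
move=> chiP; have [M chiM] := chr_bounded chiP; exists (`|M| + 1); first by have := normr_ge0 M; lra.
move=> x; apply: le_trans (chiM x) _; apply: ler_wpM2r; last by have := ler_norm M; lra.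
rewrite -[x]mkC_rep /Cnorm; have xC := repC_cauchy (mkC (repC x)).
have cv : cvg ((fun n => q (repC (mkC (repC x)) n)) @ \oo).
  apply: real_cauchy => d /xC[N hN]; exists N => m n Nm Nn.
  by apply: le_lt_trans (csn_dist sl qP _ _) _; exact: hN.
by apply: limr_ge; [exact: cv|apply: nearW => n; exact: (csn_ge0 sl qP)].
Qed.

Lemma chr_cst_le (chi : Cstar A -> C) : is_character chi -> exists2 M : R, 0 < M & forall u : fsum A, nc (chi (mkC (fun=> u))) <= M * q u.
Proof.
move=> chiP; have [M M0 chiM] := chr_le chiP; exists M => // u; apply: le_trans (chiM _) _.
rewrite ler_wpM2l ?(ltW M0) //; apply: (@Cnorm_le _ _ 0); first exact: cauchy_cst.
by move=> n _.
Qed.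

(** A character is bounded and formal sums are dense. *)
Lemma chr_ext (chi chi' : Cstar A -> C) : is_character chi -> is_character chi' ->
  (forall u : fsum A, chi (mkC (fun=> u)) = chi' (mkC (fun=> u))) -> chi =1 chi'.
Proof.
move=> chiP chi'P E x; apply: contrapT => /eqP; rewrite -subr_eq0 -nc_eq0 => xn.
have d0 : 0 < nc (chi x - chi' x) by rewrite lt_neqAle eq_sym xn nc_ge0.
have [M M0 chiM] := chr_le chiP; have [M' M'0 chi'M] := chr_le chi'P.
have K0 : 0 < M + M' by lra.
have [|a [y [xE yn]]] := @Cstar_dense x (nc (chi x - chi' x) / 2 / (M + M')).
  by rewrite divr_gt0 // divr_gt0.
have : nc (chi x - chi' x) <= nc (chi x - chi' x) / 2; last lra.
rewrite {1 2}xE (chr_add chiP) (chr_add chi'P) E opprD addrACA subrr add0r.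
apply: le_trans (ncD _ _) _; rewrite ncN.
apply: le_trans (lerD (chiM y) (chi'M y)) _.
by rewrite -mulrDl mulrC -ler_pdivlMr.
Qed.

End Completion.

Section Extension.
Variables (R : realType) (S : inverse_semigroup) (A : fell_data R S).
Local Notation C := R[i].
Local Notation nc := (@Normc.normc R).
Hypothesis sl : star_laws A.
Local Notation q := (env_norm (A := A)).
Let qP : cstar_seminorm q := env_norm_cstar sl.

Variable psi : fsum A -> C.
Hypothesis psi_cat : forall u v, psi (u ++ v) = psi u + psi v.
Hypothesis psi_scale : forall l u, psi (fs_scale l u) = l * psi u.
Hypothesis psi_le : forall u, nc (psi u) <= q u.

(** The extension by continuity of a contractive functional on formal sums *)
Definition ext_fun (x : Cstar A) : C :=
  xget 0 [set l | tendsto (fun n => psi (repC x n)) l].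

Lemma psi_sub u v : psi (fs_sub u v) = psi u - psi v.
Proof. by rewrite psi_cat psi_scale mulN1r. Qed.

Lemma psi_cauchy (u : nat -> fsum A) : env_cauchy u -> exists l, tendsto (fun n => psi (u n)) l.
Proof.
move=> uC; apply: tendsto_cauchy => e /uC[N hN]; exists N => m n Nm Nn.
by rewrite -psi_sub; apply: le_lt_trans (psi_le _) _; exact: hN.
Qed.

Lemma ext_rep (x : Cstar A) : tendsto (fun n => psi (repC x n)) (ext_fun x).
Proof.
rewrite /ext_fun; case: xgetP => [l _ //|h]; exfalso.
by have [l /h] := psi_cauchy (repC_cauchy x).
Qed.

Lemma ext_mkC (u : nat -> fsum A) : env_cauchy u -> tendsto (fun n => psi (u n)) (ext_fun (mkC u)).
Proof.
move=> uC e e0; have e2 : 0 < e / 2 by rewrite divr_gt0.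
have [N1 h1] := ext_rep (mkC u) e2; have [N2 h2] := rep_mkC sl uC e2.
exists (maxn N1 N2) => n; rewrite geq_max => /andP[/h1 n1 /h2 n2].
rewrite (_ : _ - _ = (psi (u n) - psi (repC (mkC u) n)) + (psi (repC (mkC u) n) - ext_fun (mkC u))); last by ring.
apply: le_lt_trans (ncD _ _) _; have := psi_le (fs_sub (u n) (repC (mkC u) n)).
rewrite psi_sub (csn_subC sl qP); lra.
Qed.

Lemma ext_eq (u : nat -> fsum A) l : env_cauchy u -> tendsto (fun n => psi (u n)) l ->
  ext_fun (mkC u) = l.
Proof. by move=> uC; apply: tendsto_unique; exact: ext_mkC. Qed.

Lemma ext_cst (u : fsum A) : ext_fun (mkC (fun=> u)) = psi u.
Proof.
apply: ext_eq; first exact: cauchy_cst.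
by move=> e e0; exists 0%N => n _; rewrite subrr nc0.
Qed.

Lemma ext_character : (forall u v, psi (fs_mul u v) = psi u * psi v) ->
  (forall u, psi (fs_star u) = (psi u)^*) -> (exists u, psi u != 0) ->
  is_character ext_fun.
Proof.
move=> psiM psiS [u0 u00].
have bdd (z : nat -> C) l : tendsto z l -> exists N, forall n, (N <= n)%N -> nc (z n) <= nc l + 1.
  move=> zl; have [N hN] := zl 1 ltr01; exists N => n /hN h.
  by have := ncD (z n - l) l; rewrite subrK; lra.
split.
- move=> x y; rewrite /Cadd; apply: ext_eq.
    by apply: cauchy_cat => //; exact: repC_cauchy.
  move=> e e0; have e2 : 0 < e / 2 by rewrite divr_gt0.
  have [N1 h1] := ext_rep x e2; have [N2 h2] := ext_rep y e2.
  exists (maxn N1 N2) => n; rewrite geq_max => /andP[/h1 n1 /h2 n2].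
  rewrite psi_cat opprD addrACA; apply: le_lt_trans (ncD _ _) _; lra.
- move=> l x; rewrite /Cscale; apply: ext_eq.
    by apply: cauchy_scale => //; exact: repC_cauchy.
  move=> e e0; have l1 : 0 < nc l + 1 by have := nc_ge0 l; lra.
  have [|N hN] := ext_rep x (e := e / (nc l + 1)); first by rewrite divr_gt0.
  exists N => n /hN; rewrite psi_scale -mulrBr ncM ltr_pdivlMr // mulrC.
  move=> /(le_lt_trans _); apply; rewrite ler_wpM2r ?nc_ge0 //.
  by have := nc_ge0 l; lra.
- move=> x y; rewrite /Cmul; apply: ext_eq.
    by apply: cauchy_mul => //; exact: repC_cauchy.
  move=> e e0; set a := ext_fun x; set b := ext_fun y.
  have [N0 h0] := bdd _ _ (ext_rep x).
  have K0 : 0 < nc a + 1 + nc b + 1 by have := nc_ge0 a; have := nc_ge0 b; lra.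
  have d0 : 0 < e / (nc a + 1 + nc b + 1) by rewrite divr_gt0.
  have [N1 h1] := ext_rep x d0; have [N2 h2] := ext_rep y d0.
  exists (maxn N0 (maxn N1 N2)) => n; rewrite !geq_max => /and3P[/h0 n0 /h1/ltW n1 /h2/ltW n2].
  rewrite psiM (_ : _ - _ = psi (repC x n) * (psi (repC y n) - b) + (psi (repC x n) - a) * b); last by ring.
  apply: le_lt_trans (ncD _ _) _; rewrite !ncM.
  have h3 := ler_pM (nc_ge0 _) (nc_ge0 _) n0 n2.
  have h4 := ler_wpM2r (nc_ge0 b) n1.
  have E : e / (nc a + 1 + nc b + 1) * (nc a + 1 + nc b + 1) = e by rewrite divfK // gt_eqF.
  by move: h3 h4 d0 E; move: (e / _) => t; lra.
- move=> x; rewrite /Cinvol; apply: ext_eq.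
    by apply: cauchy_star => //; exact: repC_cauchy.
  move=> e /(ext_rep x)[N hN]; exists N => n /hN.
  by rewrite psiS -rmorphB ncJ.
- exists 1 => x; rewrite mul1r; apply/ler_addgt0Pr => d d0.
  have d2 : 0 < d / 2 by rewrite divr_gt0.
  have cv : cvg ((fun n => q (repC x n)) @ \oo).
    apply: real_cauchy => c /(repC_cauchy x)[N hN]; exists N => m n Nm Nn.
    by apply: le_lt_trans (csn_dist sl qP _ _) _; exact: hN.
  have [N1 h1] := (real_cvgP _ _).1 cv _ d2; have [N2 h2] := ext_rep x d2.
  have := h1 _ (leq_maxl N1 N2); rewrite -/(Cnorm x) ltr_norml => /andP[_ n1].
  have n2 := h2 _ (leq_maxr N1 N2).
  have := psi_le (repC x (maxn N1 N2)).
  have := ncD (psi (repC x (maxn N1 N2))) (ext_fun x - psi (repC x (maxn N1 N2))).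
  rewrite addrCA subrr addr0 (ncB (ext_fun x)); rewrite -[complex.Re _]/(nc _).
  move: n1 n2; rewrite -/(Cnorm x); lra.
exists (mkC (fun=> u0)); rewrite ext_cst; exact/eqP.
Qed.

End Extension.

(** * Suprema, finite sums and topologies *)
(** The continuity is uniform in the parameter, which runs over a compact interval. *)
Lemma sup_near (R : realType) (T : topologicalType) (k : R -> T -> R) (x : T)
    (M : R) :
  (forall t y, t \in `[-1, 1] -> k t y <= M) ->
  (forall t e : R, t \in `[-1, 1] -> 0 < e ->
    \forall t' \near t & y \near x, `|k t' y - k t x| < e) ->
  forall e : R, 0 < e -> \forall y \near x,
    `|sup [set k t y | t in `[-1, 1]%classic] -
      sup [set k t x | t in `[-1, 1]%classic]| < e.
Proof.
move=> kM kc e e0; have e2 : 0 < e / 2 by rewrite divr_gt0.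
have hs y : has_sup [set k t y | t in `[-1, 1]%classic].
  split; first by exists (k 0 y), 0 => //=; rewrite in_itv /=; lra.
  by exists M => _ [t tI <-]; exact: kM.
have /compact_near_coveringP := @segment_compact R (-1) 1.
move=> /(_ _ (nbhs x) (fun y t => `|k t y - k t x| < e / 2) _).
have h (t : R) : `[-1, 1]%classic t -> \forall t' \near t & y \near x, `|k t' y - k t' x| < e / 2.
  move=> tI; have e4 : 0 < e / 4 by rewrite divr_gt0.
  have [[A B] /= [nA nB] AB] := kc t _ tI e4.
  exists (A, B) => // -[t' y] /= [At By].
  have /= h1 := AB (t', y) (conj At By).
  have /= h2 := AB (t', x) (conj At (nbhs_singleton nB)).
  rewrite (_ : _ - _ = (k t' y - k t x) - (k t' x - k t x)); last by ring.
  by apply: le_lt_trans (ler_normB _ _) _; lra.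
move=> /(_ h); apply: filterS => y ky.
have le a b : (forall t, t \in `[-1, 1] -> k t a <= k t b + e / 2) ->
    sup [set k t a | t in `[-1, 1]%classic] <= sup [set k t b | t in `[-1, 1]%classic] + e / 2.
  move=> ab; apply: ge_sup; first by case: (hs a).
  move=> _ [t tI <-]; apply: le_trans (ab t tI) _; rewrite lerD2r.
  by apply: ub_le_sup; [case: (hs b)|exists t].
have h1 : forall t, t \in `[-1, 1] -> k t y <= k t x + e / 2.
  by move=> t tI; have := ky t tI; rewrite ltr_norml => /andP[]; lra.
have h2 : forall t, t \in `[-1, 1] -> k t x <= k t y + e / 2.
  by move=> t tI; have := ky t tI; rewrite ltr_norml => /andP[]; lra.
have := le _ _ h1; have := le _ _ h2.
move: (sup _) (sup _) => a b hab hba.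
by rewrite ltr_norml; apply/andP; split; lra.
Qed.

Lemma sum_CauchySchwarz (R : realType) (T : Type) (s : seq T) (x y : T -> R) :
  (forall t, 0 <= x t) -> (forall t, 0 <= y t) ->
  (\sum_(t <- s) x t * y t) ^+ 2 <= (\sum_(t <- s) x t ^+ 2) * (\sum_(t <- s) y t ^+ 2).
Proof.
move=> x0 y0; elim: s => [|t s IH]; first by rewrite !big_nil expr0n mul0r.
rewrite !big_cons; set X := \sum_(j <- s) x j * y j in IH *.
set a := \sum_(j <- s) x j ^+ 2 in IH *; set b := \sum_(j <- s) y j ^+ 2 in IH *.
have X0 : 0 <= X by apply: sumr_ge0 => j _; rewrite mulr_ge0.
have a0 : 0 <= a by apply: sumr_ge0 => j _; rewrite sqr_ge0.
have b0 : 0 <= b by apply: sumr_ge0 => j _; rewrite sqr_ge0.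
have h : 2 * (X * (x t * y t)) <= a * y t ^+ 2 + b * x t ^+ 2.
  rewrite -ler_sqr ?nnegrE ?addr_ge0 ?mulr_ge0 ?sqr_ge0 //.
  have h1 : (2 * (X * (x t * y t))) ^+ 2 <= 4 * (a * b) * (x t ^+ 2 * y t ^+ 2).
    rewrite (_ : _ ^+ 2 = 4 * X ^+ 2 * (x t ^+ 2 * y t ^+ 2)); last by ring.
    by rewrite ler_wpM2r ?mulr_ge0 ?sqr_ge0 // ler_wpM2l.
  apply: le_trans h1 _; rewrite -subr_ge0.
  rewrite (_ : _ - _ = (a * y t ^+ 2 - b * x t ^+ 2) ^+ 2); last by ring.
  exact: sqr_ge0.
have -> : (x t * y t + X) ^+ 2 = X ^+ 2 + 2 * (X * (x t * y t)) + x t ^+ 2 * y t ^+ 2 by ring.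
have -> : (x t ^+ 2 + a) * (y t ^+ 2 + b) =
  a * b + (a * y t ^+ 2 + b * x t ^+ 2) + x t ^+ 2 * y t ^+ 2 by ring.
by rewrite lerD2r; exact: lerD.
Qed.

Lemma ptws_cvg (T : Type) (V : topologicalType) (F : set_system (T -> V)) (f : T -> V) :
  Filter F -> (forall t, (fun g => g t) @ F --> f t) -> {ptws, F --> f}.
Proof.
move=> FF Ff; apply/cvg_sup => t P [_ [[W oW <-]] Wf WP].
by apply: (filterS WP); apply: Ff; exact: open_nbhs_nbhs.
Qed.

Definition pull_topology (T : choiceType) (Z : topologicalType) (f : T -> Z) : topology_on T :=
  @TopologyOn T (@open (initial_topology f)) openT (@openI (initial_topology f))
    (fun I F oF => @bigcup_open (initial_topology f) I setT F (fun i _ => oF i)).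

Lemma pull_nbhsP (T : choiceType) (Z : topologicalType) (f : T -> Z) (v : T) (P : set T) :
  nbhs (v : retop (pull_topology f)) P <-> exists2 W, nbhs (f v) W & f @^-1` W `<=` P.
Proof.
split=> [|[W]].
  move=> [_ [[W oW <-] Wv WP]]; exists W => //; exact: open_nbhs_nbhs.
rewrite nbhsE => -[V [oV Vv] VW] WP; exists (f @^-1` V); split => //; first by exists V.
by move=> t /VW/WP.
Qed.

(** * The topology of a twist *)

Section Twist.
Variables (R : realType) (D : twist_data R).
Hypothesis hD : is_twisted_etale_groupoid D.
Local Notation C := R[i].
Local Notation nc := (@Normc.normc R).
Local Notation act := (@tw_act R D).
Local Notation G := (tw_G D).
Local Notation Sg := (tw_S D).
Local Notation L := (line D).
Local Notation "[ 'ln' l , s ]" := (\pi_(line D) (l : C, s : Sg)).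
Local Notation lz := (line_zero hD).
Local Notation C0 := (C0_sections hD).
Let eG : is_etale_groupoid G := tw_etale hD.
Let hG : is_groupoid G := etale_groupoid eG.
Let tS : is_topological_groupoid Sg := tw_topological hD.
Let hSg : is_groupoid Sg. Proof. by case: tS. Qed.

Lemma iota_near (z : C) (x : G) (W : set Sg) : circle z -> gunits G x ->
  nbhs (tw_iota D z x) W ->
  exists2 e : R, 0 < e & exists2 A : set G, nbhs x A &
    forall w y, circle w -> gunits G y -> nc (w - z) < e -> A y ->
      W (tw_iota D w y).
Proof.
move=> zc xu nW; case: (tw_iota_homeo hD) => ic _ _.
have [[A B] /= [nA nB] AB] :=
  @within_near _ _ _ _ (z, x) W ic (conj zc xu) nW.
have /nbhs_C[e e0 eA] := nA.
exists e => //; exists B => // w y wc yu wz By.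
by apply: (AB (w, y)) => //; split => //; exact: eA.
Qed.

Lemma iota_inv_near (z : C) (x : G) (e : R) (A : set G) :
  circle z -> gunits G x -> 0 < e -> nbhs x A ->
  exists2 B : set Sg, nbhs (tw_iota D z x) B &
    forall w y, circle w -> gunits G y -> B (tw_iota D w y) ->
      nc (w - z) < e /\ A y.
Proof.
move=> zc xu e0 nA; case: (tw_iota_homeo hD) => _ inj iop.
pose O := [set p : C * G | nc (p.1 - z) < e] `&` [set p | A p.2].
have nO : nbhs (z, x) O.
  exists ([set w | nc (w - z) < e], A) => //=.
  by split => //; exact: nbhs_C_ball.
have [B oB BE] := iop _ (open_interior O).
exists B.
  apply: open_nbhs_nbhs; split => //.
  have : ((fun p => tw_iota D p.1 p.2) @` (@circle R `*` gunits G `&` O°))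
    (tw_iota D z x) by exists (z, x).
  by rewrite BE => -[].
move=> w y wc yu Bwy.
have : ((fun p => tw_iota D p.1 p.2) @` (@circle R `*` gunits G) `&` B)
  (tw_iota D w y) by split => //; exists (w, y).
rewrite -BE => -[[w' y'] [[/= w'c y'u] O'] /= E].
have [-> ->] : (w, y) = (w', y') by apply: inj; rewrite ?inE.
by have := interior_subset O'.
Qed.

Lemma act_near (z : C) (s : Sg) (W : set Sg) : circle z ->
  nbhs (tw_act z s) W ->
  exists2 e : R, 0 < e & exists2 B : set Sg, nbhs s B &
    forall w t, circle w -> nc (w - z) < e -> B t -> W (tw_act w t).
Proof.
move=> zc nW.
have us : gunits G (grng (tw_pi s)) by exact: gunits_rng.
have [A [B [nA nB AB]]] := gmul_near tS (act_composable hD s zc) nW.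
have [e e0 [A' nA' eA']] := iota_near zc us nA.
exists e => //; exists (B `&` [set t | A' (grng (tw_pi t))]).
  apply: filterI => //.
  have /= := @grng_continuous _ eG (tw_pi s) A' nA'.
  exact: (tw_pi_continuous hD).
move=> w t wc wz [Bt At]; apply: AB => //; last exact: act_composable.
by apply: eA' => //; exact: gunits_rng.
Qed.

Lemma act_continuous (z : C) : circle z -> continuous (@tw_act R D z).
Proof.
move=> zc s W /(act_near zc)[e e0 [B nB eB]].
by apply: filterS nB => t; apply: eB => //; rewrite subrr nc0.
Qed.

(** The circle acts freely, and two nearby points of a fibre differ by an
    element of the circle that is near 1: their quotient in the groupoid is near
    a unit, and the image of iota carries the topology of the product. *)
Lemma translation_near (s : Sg) (e : R) : 0 < e ->
  exists2 N : set Sg, nbhs s N &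
    forall z t, circle z -> N t -> N (tw_act z t) -> nc (z - 1) < e.
Proof.
move=> e0.
have us : gunits G (grng (tw_pi s)) by exact: gunits_rng.
have [B nB Be] := iota_inv_near (circle1 _) us e0 (filterT : nbhs _ setT).
have sV : gdom s = grng (ginv s) by rewrite (grngV hSg).
have nB' : nbhs (gmul s (ginv s)) B by rewrite (gmulV hSg) (rng_iota hD).
have [A1 [A2 [nA1 nA2 AB]]] := gmul_near tS sV nB'.
exists (A1 `&` (@ginv Sg @^-1` A2)).
  by apply: filterI => //; case: tS => _ _; exact.
move=> z t zc [A1t A2t] [A1zt _].
have ut : gunits G (grng (tw_pi t)) by exact: gunits_rng.
have dzt : gdom (tw_act z t) = gdom t.
  by rewrite (gdomM hSg) // (act_composable hD).
have := AB _ _ A1zt A2t; rewrite dzt (grngV hSg) => /(_ erefl).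
rewrite /tw_act -(gmulA hSg) ?(grngV hSg) ?(act_composable hD) //.
rewrite (gmulV hSg) -(act_composable hD t zc) (gmul_dom hSg) => BB.
by have [] := Be z _ zc ut BB.
Qed.

Lemma act_inj (s : Sg) (z w : C) : circle z -> circle w ->
  tw_act z s = tw_act w s -> z = w.
Proof.
move=> zc wc /(congr1 (fun t => gmul t (ginv s))).
rewrite /tw_act -!(gmulA hSg) ?(grngV hSg) ?(act_composable hD) // (gmulV hSg).
rewrite -{1}(act_composable hD s zc) -(act_composable hD s wc) !(gmul_dom hSg).
have us : gunits G (grng (tw_pi s)) by exact: gunits_rng.
case: (tw_iota_homeo hD) => _ inj _ E.
have := inj (z, grng (tw_pi s)) (w, grng (tw_pi s)); rewrite !inE.
by move=> /(_ (conj zc us) (conj wc us) E) [].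
Qed.

(** * The line bundle *)

Lemma lineP (v : L) : exists l s, v = [ln l, s].
Proof. by exists (repr v).1, (repr v).2; rewrite -surjective_pairing reprK. Qed.

Lemma line_atP (v : L) (s : Sg) : line_proj v = tw_pi s ->
  exists l, v = [ln l, s].
Proof.
have [l [t ->]] := lineP v; rewrite (line_projE hD) /= => ts.
have [z zc ->] := tw_act_trans hD ts.
have z0 : z != 0 by rewrite -normr_eq0 zc oner_eq0.
exists (z^-1 * l); apply/(line_eqP hD); exists z^-1; first exact: circleV.
by split => //=; rewrite -(tw_actM hD) ?mulVf ?(tw_act1 hD) //; exact: circleV.
Qed.

Lemma line_act (l z : C) (s : Sg) : circle z ->
  [ln l, tw_act z s] = [ln z * l, s].
Proof. by move=> zc; apply/(line_eqP hD); exists z. Qed.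

Lemma line_inj (s : Sg) (l m : C) : [ln l, s] = [ln m, s] -> l = m.
Proof.
move=> /(line_eqP hD)[z zc [/= -> E]].
have -> : z = 1; last by rewrite mul1r.
by apply: (@act_inj s) => //; [exact: circle1|rewrite (tw_act1 hD)].
Qed.

Lemma line_addE (l m : C) (s : Sg) :
  line_add [ln l, s] [ln m, s] = [ln l + m, s].
Proof.
have /(line_eqP hD)[z zc [/=]] := reprK [ln l, s].
have /(line_eqP hD)[w wc [/=]] := reprK [ln m, s].
set v := repr [ln m, s]; set u := repr [ln l, s] => mE vE lE uE.
rewrite /line_add -/u -/v.
have z0 : z != 0 by rewrite -normr_eq0 zc oner_eq0.
have sE : s = tw_act z^-1 u.2.
  by rewrite uE -(tw_actM hD) ?mulVf ?(tw_act1 hD) //; exact: circleV.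
have vu : v.2 = tw_act (w * z^-1) u.2.
  by rewrite (tw_actM hD) -?sE //; exact: circleV.
case: xgetP => [y _ [yc yE]|/(_ (w * z^-1))[]]; last first.
  by split => //; apply: circleM => //; exact: circleV.
have -> : y = w * z^-1.
  apply: (@act_inj u.2) => //; last by rewrite -yE.
  by apply: circleM => //; exact: circleV.
apply/(line_eqP hD); exists z => //=; split => //.
by rewrite lE mE mulrDr; congr (_ + _); field.
Qed.

Lemma line_scaleE (a l : C) (s : Sg) : line_scale a [ln l, s] = [ln a * l, s].
Proof.
have /(line_eqP hD)[z zc [/= lE sE]] := reprK [ln l, s].
rewrite /line_scale; apply/(line_eqP hD); exists z => //=; split => //.
by rewrite [in LHS]lE mulrCA.
Qed.

Lemma act_grng z s : circle z -> grng (act z s) = grng s.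
Proof.
move=> zc; rewrite (grngM hSg) ?(act_composable hD) //.
by rewrite (tw_iota_rng hD) -?(rng_iota hD) //; exact: gunits_rng.
Qed.

Lemma composable_pi (s t : Sg) :
  (gdom s = grng t) <-> (gdom (tw_pi s) = grng (tw_pi t)).
Proof.
rewrite -(tw_pi_dom hD) -(tw_pi_rng hD); split => [->//|E].
by rewrite (dom_iota hD) (rng_iota hD) -(tw_pi_dom hD) -(tw_pi_rng hD) E.
Qed.

Lemma act_mull z s t : circle z -> gdom s = grng t ->
  gmul (act z s) t = act z (gmul s t).
Proof.
move=> zc st; have pst := (composable_pi s t).1 st.
rewrite /tw_act (tw_piM hD) // (grngM hG) // (gmulA hSg) //.
exact: act_composable.
Qed.

Lemma act_central z s : circle z ->
  tw_act z s = gmul s (tw_iota D z (gdom (tw_pi s))).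
Proof. by move=> zc; rewrite /tw_act (tw_central hD). Qed.

Lemma act_mulr z s t : circle z -> gdom s = grng t ->
  gmul s (act z t) = act z (gmul s t).
Proof.
move=> zc st; rewrite !act_central // (gmulA hSg) //; last first.
  by rewrite (tw_iota_rng hD) -?(dom_iota hD) //; exact: gunits_dom.
by rewrite (tw_piM hD) // (gdomM hG) //; apply/composable_pi.
Qed.

Lemma line_mulE (l m : C) (s t : Sg) : gdom s = grng t ->
  line_mul [ln l, s] [ln m, t] = [ln l * m, gmul s t].
Proof.
move=> st.
have /(line_eqP hD)[z zc [/=]] := reprK [ln l, s].
have /(line_eqP hD)[w wc [/=]] := reprK [ln m, t].
rewrite /line_mul; move: (repr [ln m, t]) (repr [ln l, s]) => v u -> -> -> ->.
rewrite act_mull ?act_grng // act_mulr // -(tw_actM hD) // line_act; last exact: circleM.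
by rewrite mulrACA.
Qed.

Lemma ginv_mul (s t : Sg) : gdom s = grng t ->
  ginv (gmul s t) = gmul (ginv t) (ginv s).
Proof.
move=> st.
have tsV : gdom (ginv t) = grng (ginv s) by rewrite (gdomV hSg) (grngV hSg).
have c1 : gdom (gmul s t) = grng (gmul (ginv t) (ginv s)).
  by rewrite (gdomM hSg) // (grngM hSg) // (grngV hSg).
have E : gmul (gmul s t) (gmul (ginv t) (ginv s)) = grng s.
  rewrite -(gmulA hSg) //; last by rewrite (grngM hSg) // (grngV hSg).
  rewrite [gmul t _](gmulA hSg _ tsV) ?(grngV hSg) // (gmulV hSg) -st.
  by rewrite -[gdom s](grngV hSg) (gmul_rng hSg) (gmulV hSg).
rewrite -[LHS](gmul_dom hSg) (gdomV hSg) (grngM hSg) // -E (gmulA hSg) //.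
  rewrite (gmulVl hSg) (gdomM hSg) //.
  by rewrite -(grngV hSg t) -(grngM hSg tsV) (gmul_rng hSg).
by rewrite (gdomV hSg).
Qed.

Lemma circle_inv (z : C) : circle z -> z^-1 = z^*.
Proof. by move=> zc; rewrite invc_norm zc expr1n invr1 mul1r. Qed.

Lemma act_ginv z s : circle z -> ginv (act z s) = act z^-1 (ginv s).
Proof.
move=> zc; have zVc := circleV zc.
have z0 : z != 0 by rewrite -normr_eq0 zc oner_eq0.
have us : gunits G (grng (tw_pi s)) by exact: gunits_rng.
rewrite ginv_mul ?(act_composable hD) // act_central //; congr gmul.
have sE : gdom (tw_pi (ginv s)) = grng (tw_pi s).
  by rewrite -(tw_pi_dom hD) (gdomV hSg) (tw_pi_rng hD).
rewrite sE; set x := grng _.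
have xd w : circle w -> gdom (tw_iota D w x) = tw_iota D 1 x by move=> wc; rewrite (tw_iota_dom hD).
have xr w : circle w -> grng (tw_iota D w x) = tw_iota D 1 x by move=> wc; rewrite (tw_iota_rng hD).
rewrite -[LHS](gmul_dom hSg) (gdomV hSg) xr // -(mulfV z0) (tw_iotaM hD) //.
rewrite (gmulA hSg) ?(gdomV hSg) ?xd ?xr // (gmulVl hSg) xd //.
by rewrite -(xr z^-1) // (gmul_rng hSg).
Qed.

Lemma line_starE (l : C) (s : Sg) : line_star [ln l, s] = [ln l^*, ginv s].
Proof.
have /(line_eqP hD)[z zc [/=]] := reprK [ln l, s].
rewrite /line_star; move: (repr [ln l, s]) => u -> ->.
rewrite act_ginv // line_act; last exact: circleV.
by rewrite rmorphM /= circle_inv.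
Qed.

Lemma pi_line_open (P : set (C * Sg)) : open P ->
  open ((fun p => \pi_(line D) p) @` P : set L).
Proof.
move=> oP.
change (open (\pi_(line D) @^-1` ((fun p : C * Sg => \pi_(line D) p) @` P))).
rewrite (_ : _ @^-1` _ = \bigcup_(z in @circle R)
    ((fun p : C * Sg => (z^-1 * p.1, act z p.2)) @^-1` P)); last first.
  apply/seteqP; split.
    move=> -[m t] /= [[l s] Pls /(line_eqP hD)[z zc [/= mE sE]]].
    have z0 : z != 0 by rewrite -normr_eq0 zc oner_eq0.
    by exists z => //=; rewrite mE mulrA mulVf // mul1r -sE.
  move=> -[m t] [z zc /= Pmt].
  have z0 : z != 0 by rewrite -normr_eq0 zc oner_eq0.
  by exists (z^-1 * m, act z t) => //; rewrite line_act // mulrA mulfV // mul1r.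
apply: bigcup_open => z zc; apply: open_comp => // -[m t] _.
move=> W [[A B] /= [nA nB] AB].
exists ((fun m => z^-1 * m) @^-1` A, act z @^-1` B) => /=.
  split; last exact: act_continuous.
  exact: (@mulrl_continuous C z^-1 m).
by move=> [m' t'] [? ?]; apply: AB.
Qed.

(** The quotient map is open, since the saturation of an open set is the union of its
    translates by the circle. *)
Lemma line_nbhsP (l : C) (s : Sg) (W : set L) : nbhs [ln l, s] W <->
  exists2 e : R, 0 < e & exists2 N : set Sg, nbhs s N &
    forall m t, nc (m - l) < e -> N t -> W [ln m, t].
Proof.
split=> [nW|[e e0 [N nN NW]]].
  have [[A B] /= [/nbhs_C[e e0 eA] nB] AB] := @pi_continuous _ _ (l, s) W nW.
  exists e => //; exists B => // m t ml Bt.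
  by apply: (AB (m, t)); split => //; exact: eA.
pose P : set (C * Sg) := [set p | nc (p.1 - l) < e /\ N p.2]°.
have nP : nbhs (l, s) [set p : C * Sg | nc (p.1 - l) < e /\ N p.2].
  exists ([set w | nc (w - l) < e], N) => //=.
  by split => //; exact: nbhs_C_ball.
have : nbhs [ln l, s] ((fun p => \pi_(line D) p) @` P).
  apply: open_nbhs_nbhs; split; first exact/pi_line_open/open_interior.
  by exists (l, s).
by apply: filterS => _ [[m t] /interior_subset[/= ml Nt] <-]; exact: NW.
Qed.

Lemma line_proj_continuous : continuous (@line_proj R D).
Proof.
move=> v W; have [l [s ->]] := lineP v; rewrite (line_projE hD) /= => nW.
apply/line_nbhsP; exists 1 => //; exists (@tw_pi R D @^-1` W).
  exact: (tw_pi_continuous hD).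
by move=> m t _ Wt; rewrite /preimage /= (line_projE hD).
Qed.

Lemma tw_pi_nbhs (s : Sg) (N : set Sg) : nbhs s N -> nbhs (tw_pi s) (@tw_pi R D @` N).
Proof.
rewrite nbhsE => -[V [oV Vs] VN].
have : nbhs (tw_pi s) (@tw_pi R D @` V).
  by apply: open_nbhs_nbhs; split; [exact: (tw_pi_open hD)|exists s].
by apply: filterS => _ [t Vt <-]; exists t => //; exact: VN.
Qed.

Lemma line_proj_open : open_map (@line_proj R D).
Proof.
move=> O oO; rewrite openE => _ [v Ov <-].
have [l [s vE]] := lineP v; rewrite vE (line_projE hD) /=.
have : nbhs [ln l, s] O by rewrite -vE; exact: open_nbhs_nbhs.
move=> /line_nbhsP[e e0 [N nN NO]].
apply: filterS (tw_pi_nbhs nN) => _ [t Nt <-].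
exists [ln l, t]; last by rewrite (line_projE hD).
by apply: NO => //; rewrite subrr nc0.
Qed.

Lemma line_norm_continuous : continuous (@line_norm R D).
Proof.
move=> v W; have [l [s ->]] := lineP v; rewrite (line_normE hD) /= => nW.
have /nbhs_C[e e0 eW] := @nc_continuous R l W nW.
apply/line_nbhsP; exists e => //; exists setT; first exact: filterT.
by move=> m t /eW Wm _; rewrite /preimage /= (line_normE hD).
Qed.

(** Nearby vectors of a fibre are represented over points of the twist that differ by
    an element of the circle near 1, by [translation_near]. *)
Lemma line_add_near (v w : L) (W : set L) : line_proj v = line_proj w ->
  nbhs (line_add v w) W -> exists A B, [/\ nbhs v A, nbhs w B &
    forall v' w', A v' -> B w' -> line_proj v' = line_proj w' ->
      W (line_add v' w')].
Proof.
have [l [s ->]] := lineP v; rewrite (line_projE hD) /= => /esym ws.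
have [m ->] := line_atP ws; rewrite line_addE.
move=> /line_nbhsP[e e0 [N nN NW]].
pose d := Num.min 1 (e / 4 / (1 + nc m)).
have m0 : 0 < 1 + nc m by rewrite (lt_le_trans ltr01)// lerDl nc_ge0.
have d0 : 0 < d by rewrite lt_min ltr01 /= divr_gt0 // divr_gt0.
have [N' nN' tN] := translation_near s d0.
pose k := Num.min 1 (e / 4); have k0 : 0 < k by rewrite lt_min ltr01 divr_gt0.
exists [set v | exists l' s', [/\ nc (l' - l) < k, (N `&` N') s' & v = [ln l', s']]].
exists [set v | exists l' s', [/\ nc (l' - m) < k, (N `&` N') s' & v = [ln l', s']]].
split.
- apply/line_nbhsP; exists k => //; exists (N `&` N'); first exact: filterI.
  by move=> l' s' ? ?; exists l', s'.
- apply/line_nbhsP; exists k => //; exists (N `&` N'); first exact: filterI.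
  by move=> l' s' ? ?; exists l', s'.
move=> _ _ [l' [s' [l'l [Ns' N's'] ->]]] [m' [t' [m'm [Nt' N't'] ->]]].
rewrite !(line_projE hD) /= => /(tw_act_trans hD)[z zc tE].
rewrite tE in N't' *; have z1 := tN _ _ zc N's' N't'.
rewrite line_act // line_addE; apply: NW => //.
have -> : l' + z * m' - (l + m) = (l' - l) + (z * (m' - m) + (z - 1) * m) by ring.
move: l'l m'm z1; rewrite !lt_min => /andP[_ h1] /andP[_ h2] /andP[_ h3].
apply: le_lt_trans (ncD _ _) _; have := ncD (z * (m' - m)) ((z - 1) * m).
rewrite !ncM (nc_circle zc) mul1r.
have h4 : nc (z - 1) * nc m <= e / 4.
  move: h3; rewrite ltr_pdivlMr // => h3; apply: le_trans (ltW h3).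
  by rewrite ler_wpM2l ?nc_ge0 // lerDr.
move: h1 h2 h4; set a := nc _; set b := nc _; set c := _ * nc m; set f := nc (_ + _).
lra.
Qed.

Lemma line_scale_near (a : C) (v : L) (W : set L) :
  nbhs (line_scale a v) W -> exists2 e : R, 0 < e & exists2 A, nbhs v A &
    forall b w, nc (b - a) < e -> A w -> W (line_scale b w).
Proof.
have [l [s ->]] := lineP v; rewrite line_scaleE.
move=> /line_nbhsP[e e0 [N nN NW]].
have : nbhs (a * l) [set w | nc (w - a * l) < e] by exact: nbhs_C_ball.
move=> /(@mul_continuous _ (a, l))[[P Q] /= [/nbhs_C[d d0 dP] /nbhs_C[k k0 kQ]] PQ].
exists d => //; exists [set v | exists l' s', [/\ nc (l' - l) < k, N s' & v = [ln l', s']]].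
  by apply/line_nbhsP; exists k => //; exists N => // l' s' ? ?; exists l', s'.
move=> b _ bd [l' [s' [l'l Ns' ->]]]; rewrite line_scaleE; apply: NW => //.
by apply: (PQ (b, l')); split; [exact: dP|exact: kQ].
Qed.

Lemma line_mul_near (v w : L) (W : set L) :
  gdom (line_proj v) = grng (line_proj w) ->
  nbhs (line_mul v w) W -> exists A B, [/\ nbhs v A, nbhs w B &
    forall v' w', A v' -> B w' -> gdom (line_proj v') = grng (line_proj w') ->
      W (line_mul v' w')].
Proof.
have [l [s ->]] := lineP v; have [m [t ->]] := lineP w.
rewrite !(line_projE hD) /= => /composable_pi st; rewrite line_mulE //.
move=> /line_nbhsP[e e0 [N nN NW]].
have : nbhs (l * m) [set w | nc (w - l * m) < e] by exact: nbhs_C_ball.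
move=> /(@mul_continuous _ (l, m))[[P Q] /= [/nbhs_C[d d0 dP] /nbhs_C[k k0 kQ]] PQ].
have [A [B [nA nB AB]]] := gmul_near tS st nN.
exists [set v | exists l' s', [/\ nc (l' - l) < d, A s' & v = [ln l', s']]].
exists [set v | exists l' s', [/\ nc (l' - m) < k, B s' & v = [ln l', s']]].
split.
- by apply/line_nbhsP; exists d => //; exists A => // l' s' ? ?; exists l', s'.
- by apply/line_nbhsP; exists k => //; exists B => // l' s' ? ?; exists l', s'.
move=> _ _ [l' [s' [l'l As' ->]]] [m' [t' [m'm Bt' ->]]].
rewrite !(line_projE hD) /= => /composable_pi st'; rewrite line_mulE //.
apply: NW; last exact: AB.
by apply: (PQ (l', m')); split; [exact: dP|exact: kQ].
Qed.

Lemma line_star_continuous : continuous (@line_star R D).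
Proof.
move=> v W; have [l [s ->]] := lineP v; rewrite line_starE.
move=> /line_nbhsP[e e0 [N nN NW]]; apply/line_nbhsP; exists e => //.
exists (@ginv Sg @^-1` N); first by case: tS => _ _; exact.
move=> m t ml Nt; rewrite /preimage /= line_starE; apply: NW => //.
by rewrite -rmorphB ncJ.
Qed.

Lemma line_norm0 (v : L) : line_norm v = 0 -> forall s,
  line_proj v = tw_pi s -> v = [ln 0, s].
Proof.
move=> v0 s /line_atP[l vE]; rewrite vE in v0 *; congr (\pi_(line D) (_, s)).
by move: v0; rewrite (line_normE hD) /= => /eqP; rewrite nc_eq0 => /eqP.
Qed.

(** The axiom of a Banach bundle on the neighbourhoods of the zero section *)
Lemma line_zero_cvg (T : Type) (F : set_system T) (f : T -> L) (v : L) : Filter F ->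
  line_norm v = 0 ->
  line_proj (f x) @[x --> F] --> line_proj v ->
  line_norm (f x) @[x --> F] --> (0 : R) -> f @ F --> v.
Proof.
move=> FF; have [l [s vE]] := lineP v.
move=> /line_norm0/(_ s); rewrite {1}vE (line_projE hD) => /(_ erefl) ->.
rewrite (line_projE hD) /= => pF nF W /line_nbhsP[e e0 [N nN NW]].
have h1 : \forall x \near F, (@tw_pi R D @` N) (line_proj (f x)).
  by apply: pF; exact: tw_pi_nbhs.
have h2 : \forall x \near F, `|line_norm (f x) - 0| < e.
  by move/cvg_RP: nF; exact.
have : \forall x \near F, W (f x); last by [].
apply: filterS2 h1 h2 => x [t Nt tE]; rewrite subr0.
have [m ->] := line_atP (esym tE); rewrite (line_normE hD) /= => me.
by apply: NW => //; rewrite subr0; apply: le_lt_trans me; exact: ler_norm.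
Qed.

(** * The algebra of the line bundle *)

Lemma line_proj_scale (a : C) (v : L) : line_proj (line_scale a v) = line_proj v.
Proof. by have [l [s ->]] := lineP v; rewrite line_scaleE !(line_projE hD). Qed.

Lemma line_proj_add (v w : L) : line_proj v = line_proj w ->
  line_proj (line_add v w) = line_proj v.
Proof.
have [l [s ->]] := lineP v; rewrite (line_projE hD) /= => /esym/line_atP[m ->].
by rewrite line_addE (line_projE hD).
Qed.

Lemma line_proj_mul (v w : L) : gdom (line_proj v) = grng (line_proj w) ->
  line_proj (line_mul v w) = gmul (line_proj v) (line_proj w).
Proof.
have [l [s ->]] := lineP v; have [m [t ->]] := lineP w.
move=> h; have st : gdom s = grng t.
  by apply/composable_pi; move: h; rewrite !(line_projE hD).
by rewrite line_mulE // !(line_projE hD) /= (tw_piM hD).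
Qed.

Lemma line_proj_star (v : L) : line_proj (line_star v) = ginv (line_proj v).
Proof.
have [l [s ->]] := lineP v; rewrite line_starE !(line_projE hD) /=.
by case: (tw_pi_hom hD).
Qed.

Lemma line_norm_ge0 (v : L) : 0 <= line_norm v.
Proof. exact: nc_ge0. Qed.

Lemma line_norm_scale (a : C) (v : L) : line_norm (line_scale a v) = nc a * line_norm v.
Proof. by have [l [s ->]] := lineP v; rewrite line_scaleE !(line_normE hD) /= -ncM. Qed.

Lemma line_norm_add (v w : L) : line_proj v = line_proj w ->
  line_norm (line_add v w) <= line_norm v + line_norm w.
Proof.
have [l [s ->]] := lineP v; rewrite (line_projE hD) /= => /esym/line_atP[m ->].
by rewrite line_addE !(line_normE hD); exact: ncD.
Qed.

Lemma line_norm_mul (v w : L) : gdom (line_proj v) = grng (line_proj w) ->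
  line_norm (line_mul v w) = line_norm v * line_norm w.
Proof.
have [l [s ->]] := lineP v; have [m [t ->]] := lineP w.
move=> h; have st : gdom s = grng t.
  by apply/composable_pi; move: h; rewrite !(line_projE hD).
by rewrite line_mulE // !(line_normE hD) /=; exact: ncM.
Qed.

Lemma line_norm_star (v : L) : line_norm (line_star v) = line_norm v.
Proof. by have [l [s ->]] := lineP v; rewrite line_starE !(line_normE hD); exact: ncJ. Qed.

Lemma line_norm_zero (g : G) : line_norm (line_zero hD g) = 0.
Proof. by rewrite (line_normE hD) /=; exact: nc0. Qed.

Lemma line_zeroP (v : L) (g : G) : line_norm v = 0 -> line_proj v = g ->
  v = line_zero hD g.
Proof.
move=> v0 vg; rewrite /line_zero; case: cid => s /= sg.
by apply: line_norm0 => //; rewrite vg.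
Qed.

Lemma line_scale_zero (a : C) (g : G) : line_scale a (line_zero hD g) = line_zero hD g.
Proof.
by apply: line_zeroP; rewrite ?line_norm_scale ?line_norm_zero ?mulr0 // line_proj_scale line_zero_proj.
Qed.

Lemma line_add_zero (g : G) (v : L) : line_proj v = g ->
  line_add v (line_zero hD g) = v.
Proof.
have [l [s ->]] := lineP v; rewrite (line_projE hD) /= => sg.
have -> : line_zero hD g = [ln 0, s].
  by apply/esym/line_zeroP; [rewrite (line_normE hD); exact: nc0|rewrite (line_projE hD)].
by rewrite line_addE addr0.
Qed.

Lemma line_star_zero (g : G) : line_star (line_zero hD g) = line_zero hD (ginv g).
Proof.
by apply: line_zeroP; rewrite ?line_norm_star ?line_norm_zero // line_proj_star line_zero_proj.
Qed.

Lemma line_mulA (u v w : L) : gdom (line_proj u) = grng (line_proj v) ->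
  gdom (line_proj v) = grng (line_proj w) ->
  line_mul u (line_mul v w) = line_mul (line_mul u v) w.
Proof.
have [l [s ->]] := lineP u; have [m [t ->]] := lineP v; have [n [r ->]] := lineP w.
move=> h1 h2; have st : gdom s = grng t.
  by apply/composable_pi; move: h1; rewrite !(line_projE hD).
have tr : gdom t = grng r.
  by apply/composable_pi; move: h2; rewrite !(line_projE hD).
rewrite !line_mulE // ?(grngM hSg) ?(gdomM hSg) //.
by rewrite mulrA (gmulA hSg).
Qed.

Lemma line_starK (v : L) : line_star (line_star v) = v.
Proof.
have [l [s ->]] := lineP v; rewrite !line_starE /= (ginvK hSg).
by rewrite conjcK.
Qed.

Lemma line_subv (v : L) : line_add v (line_scale (-1) v) = line_zero hD (line_proj v).
Proof.
have [l [s ->]] := lineP v; rewrite line_scaleE line_addE mulN1r subrr.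
apply: line_zeroP; rewrite ?(line_normE hD) ?(line_projE hD) //; exact: nc0.
Qed.

Lemma line_starZ (a : C) (v : L) : line_star (line_scale a v) = line_scale a^* (line_star v).
Proof.
have [l [s ->]] := lineP v; rewrite line_scaleE !line_starE line_scaleE.
by rewrite rmorphM.
Qed.

(** * Compactness and separation in a twist *)

(** The fibres of the twist are orbits of the compact circle: a property that
    holds near every point of a fibre holds on all the nearby fibres. *)
Lemma fibre_near (I : Type) (F : set_system I) (P : I -> Sg -> Prop) (g : G) :
  Filter F ->
  (forall s, tw_pi s = g -> \forall s' \near s & i \near F, P i s') ->
  \forall g' \near g & i \near F, forall s, tw_pi s = g' -> P i s.
Proof.
move=> FF FP; have [s sg] := tw_pi_surj hD g.
have /compact_near_coveringP := @segment_compact R (- trigo.pi) trigo.pi.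
move=> /(_ _ (filter_prod (nbhs s) F) (fun p t => P p.2 (act (cis t) p.1)) _).
have h (t : R) : \forall t' \near t & p \near filter_prod (nbhs s) F,
    P p.2 (act (cis t') p.1).
  have [|[A J] /= [nA FJ] AJ] := FP (act (cis t) s).
    by rewrite (tw_pi_act hD) //; exact: cis_circle.
  have [e e0 [B nB eB]] := act_near (cis_circle t) nA.
  exists ([set t' | nc (cis t' - cis t) < e], (B `*` J)).
    split => /=; last by exists (B, J).
    by move/cvg_CP: (@cis_continuous R t); exact.
  move=> [t' [s' i]] /= [tt' [Bs' Ji]]; apply: (AJ (_, i)); split => //=.
  by apply: eB => //; exact: cis_circle.
move=> /(_ (fun t _ => h t)) [[A J] /= [nA FJ] AJ].
exists (@tw_pi R D @` A, J); first by split => //=; rewrite -sg; exact: tw_pi_nbhs.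
move=> [_ i] /= [[s' As' <-] Ji] t ts'.
have [z /cis_onto[x xpi ->] ->] := tw_act_trans hD (esym ts').
by apply: (AJ (s', i)).
Qed.

Lemma preimage_pi_compact (K : set G) : compact K -> compact (@tw_pi R D @^-1` K).
Proof.
move=> /compact_near_coveringP Kc; apply/compact_near_coveringP => I F P FF FP.
have := Kc I F (fun i g => forall s, tw_pi s = g -> P i s) FF.
have h g : K g -> \forall g' \near g & i \near F, forall s, tw_pi s = g' -> P i s.
  by move=> Kg; apply: fibre_near => s sg; apply: FP; rewrite /preimage /= sg.
by move=> /(_ h); apply: filterS => i Ki s Ks; exact: (Ki _ Ks).
Qed.

Lemma act_nbhs (z : C) (s : Sg) (W : set Sg) : circle z -> nbhs s W ->
  nbhs (act z s) [set t | W (act z^-1 t)].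
Proof.
move=> zc nW; apply: (act_continuous (circleV zc)).
by rewrite -(tw_actM hD) ?mulVf ?(tw_act1 hD) //; [rewrite -normr_eq0 zc oner_eq0|exact: circleV].
Qed.

Lemma twist_separated (U : set G) (s t : Sg) : bissection U ->
  U (tw_pi s) -> U (tw_pi t) -> s <> t ->
  exists A B, [/\ nbhs s A, nbhs t B & forall k, U (tw_pi k) -> A k -> B k -> False].
Proof.
move=> bU Us Ut st; have [pst|pst] := pselect (tw_pi s = tw_pi t); last first.
  have [A [B [nA nB AB]]] := bissection_separated eG bU Us Ut pst.
  exists (@tw_pi R D @^-1` A), (@tw_pi R D @^-1` B); split.
  - exact: (tw_pi_continuous hD).
  - exact: (tw_pi_continuous hD).
  - by move=> k Uk Ak Bk; exact: (AB (tw_pi k)).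
have [z zc tE] := tw_act_trans hD pst.
have z1 : 0 < nc (z^-1 - 1).
  rewrite lt_neqAle nc_ge0 andbT eq_sym nc_eq0 subr_eq0; apply/eqP => zV1.
  by apply: st; rewrite tE -[z]invrK zV1 invr1 (tw_act1 hD).
have [N nN Nz] := translation_near s z1.
exists N, [set k | N (act z^-1 k)]; split => //.
  by rewrite tE; exact: act_nbhs.
move=> k _ Nk Nzk; have := Nz _ _ (circleV zc) Nk Nzk.
by rewrite ltxx.
Qed.

(** The preimage of a compact subset of a bissection is compact, since the circle is,
    and Hausdorff, since the circle acts freely and properly; it is thus normal,
    whether or not the twist is Hausdorff. *)
Lemma twist_urysohn (U : set G) (s : Sg) (N : set Sg) : bissection U ->
  U (tw_pi s) -> nbhs s N ->
  exists (V : set G) (f : Sg -> R), [/\ nbhs (tw_pi s) V /\ open V, V `<=` U,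
    forall t, 0 <= f t <= 1, f s = 1 &
    (forall t, ~ N t -> f t = 0) /\
    forall t, V (tw_pi t) -> {for t, continuous f}].
Proof.
move=> bU Us nN.
have [fK [K [_ fK1 Kc KU [fK0 fKc]]]] := bissection_urysohn eG bU R Us (filterT : nbhs _ setT).
have nK : nbhs (tw_pi s) K.
  have : \forall g \near tw_pi s, `|fK g - 1| < 1.
    by have := fKc _ Us => /cvg_RP; rewrite fK1; apply.
  apply: filterS => g /= fg; apply/not_notP => /fK0 fg0; move: fg.
  by rewrite fg0 sub0r normrN normr1 ltxx.
pose Z := set_type (@tw_pi R D @^-1` K).
have vc : continuous (val : Z -> Sg) by exact: initial_continuous.
have Zh : hausdorff_space Z.
  move=> x y cxy; apply: val_inj; apply: contrapT => xy.
  have Ux : U (tw_pi (val x)) by have /KU[] := set_mem (valP x).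
  have Uy : U (tw_pi (val y)) by have /KU[] := set_mem (valP y).
  have [A [B [nA nB AB]]] := twist_separated bU Ux Uy xy.
  have [z [Az Bz]] := cxy _ _ (vc x _ nA) (vc y _ nB).
  by apply: (AB (val z)) => //; have /KU[] := set_mem (valP z).
have Zc : compact [set: Z].
  have /compact_near_coveringP Pc := preimage_pi_compact Kc.
  apply/compact_near_coveringP => I F P FF FP.
  have := Pc I F (fun i t => forall h : (@tw_pi R D @^-1` K) t, P i (SigSub (mem_set h))) FF.
  have h t : (@tw_pi R D @^-1` K) t -> \forall t' \near t & i \near F,
      forall h : (@tw_pi R D @^-1` K) t', P i (SigSub (mem_set h)).
    move=> Kt; have [[A J] /= [[_ [[B oB <-] /= Bt BA]] FJ] AJ] := FP (SigSub (mem_set Kt)) Logic.I.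
    exists (B, J); first by split => //=; exact: open_nbhs_nbhs.
    move=> [t' i] /= [Bt' Ji] Kt'; apply: (AJ (_, i)); split => //=.
    exact: BA.
  move=> /(_ h); apply: filterS => i Pi z _.
  have Kz := set_mem (valP z); have zE : (SigSub (mem_set Kz) : Z) = z by apply: val_inj.
  by rewrite -zE; exact: Pi.
have Ks : (@tw_pi R D @^-1` K) s := nbhs_singleton nK.
pose X : Z := SigSub (mem_set Ks).
pose B := ~` ((val : Z -> Sg) @^-1` N)°.
have Bcl : closed B by apply: open_closedC; exact: open_interior.
have nBX : ~ B X by move=> nI; apply: nI; exact: vc.
have Zcr := @normal_completely_regular R _ (compact_normal Zh Zc) (hausdorff_accessible Zh).
have /(@uniform_separatorP _ R)[f [fc f01 f0 f1]] := Zcr _ _ Bcl nBX.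
have f01' y : 0 <= f y <= 1 by have := f01 (f y) (imageP _ Logic.I); rewrite /= in_itv.
pose F t : R := match pselect ((@tw_pi R D @^-1` K) t) with
  | left h => 1 - f (SigSub (mem_set h)) | right _ => 0 end.
have FE (z : Z) : F (val z) = 1 - f z.
  rewrite /F; case: pselect => [h|]; last by case; exact/set_mem/valP.
  by congr (1 - f _); exact: val_inj.
exists K°, F; split.
- split; last exact: open_interior.
  by apply: open_nbhs_nbhs; split; first exact: open_interior.
- by move=> g /interior_subset/KU[].
- move=> t; rewrite /F; case: pselect => [h|_]; last by rewrite lexx ler01.
  by have := f01' (SigSub (mem_set h)) => /andP[]; lra.
- by rewrite -[s]/(val X) FE (f0 (f X)) ?subr0 //; exists X.
split=> t.
  move=> Nt; rewrite /F; case: pselect => // h.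
  have Bt : B (SigSub (mem_set h)) by move=> /interior_subset.
  by rewrite (f1 _ (imageP f Bt)) subrr.
move=> Kt; have Kt' : (@tw_pi R D @^-1` K) t := interior_subset Kt.
move=> W; have := FE (SigSub (mem_set Kt')); rewrite /= => -> nW.
have : nbhs (SigSub (mem_set Kt') : Z) ((fun z => 1 - f z) @^-1` W).
  apply: (@continuousB _ R^o _ (fun=> 1) f _ _ _ W) => //; last exact: fc.
  exact: cst_continuous.
move=> [_ [[V oV <-] /= Vt VW]].
have nV : nbhs t V by exact: open_nbhs_nbhs.
have nK' : nbhs t (@tw_pi R D @^-1` K) by exact: (tw_pi_continuous hD).
apply: filterS2 nV nK' => k Vk Kk.
have := FE (SigSub (mem_set Kk)); rewrite /preimage /= => ->.
exact: VW.
Qed.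

(** * Local sections of a twist *)

(** Let f be a bump function at a point s of the twist, with a support N in which the
    translations of the circle are small. The function A(x) = sup_t (t + 6 f(cis t x)),
    for t in [-1, 1], is continuous and satisfies A(cis r x) = A(x) - r when x and
    cis r x are close to s, so that cis (A x) x only depends on the image of x in the
    groupoid. The factor 6 forces the supremum to be reached where f is nonzero, hence
    for |t| < 1/4: it exceeds 3 when f(x) > 1/2, while t <= 1. This keeps t + r in
    the interval. *)
Lemma local_section (U : set G) (g : G) : bissection U -> U g ->
  exists (V : set G) (sec : G -> Sg),
    [/\ open V, V g, V `<=` U &
        (forall h, V h -> tw_pi (sec h) = h) /\
        (forall h, V h -> {for h, continuous sec})].
Proof.
move=> bU; have [s <-] := tw_pi_surj hD g => Us {g}.
have [N nN Nz] := translation_near s (small_angle_gt0 R).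
have [V [f [[nV oV] VU f01 fs [f0 fc]]]] := twist_urysohn bU Us nN.
have cc t : circle (cis t : C) by exact: cis_circle.
pose k (t : R) x := t + 6 * f (act (cis t) x).
pose A x : R := sup [set k t x | t in `[-1, 1]%classic].
have kM t x : t \in `[-1, 1] -> k t x <= 7.
  by rewrite in_itv /= /k; have /andP[] := f01 (act (cis t) x); lra.
have kA t x : t \in `[-1, 1] -> k t x <= A x.
  move=> tI; apply: ub_le_sup; last by exists t.
  by exists 7 => _ [r rI <-]; exact: kM.
have kc x : V (tw_pi x) -> forall t e : R, t \in `[-1, 1] -> 0 < e ->
    \forall t' \near t & y \near x, `|k t' y - k t x| < e.
  move=> Vx t e _ e0; have Vtx : V (tw_pi (act (cis t) x)) by rewrite (tw_pi_act hD).
  have : nbhs (act (cis t) x) [set y | `|f y - f (act (cis t) x)| < e / 12].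
    by have /cvg_RP := fc _ Vtx; apply; rewrite divr_gt0.
  move=> /(act_near (cc t))[d d0 [B nB dB]].
  have n1 : nbhs t [set t' | nc (cis t' - cis t) < d].
    by move/cvg_CP: (@cis_continuous R t); exact.
  have n2 : nbhs t [set t' | `|t' - t| < e / 2].
    by apply/nbhs_Rdist; exists (e / 2); rewrite ?divr_gt0.
  exists ([set t' | nc (cis t' - cis t) < d] `&` [set t' | `|t' - t| < e / 2], B).
    by split => //=; exact: filterI.
  move=> [t' y] /= [[h1 h2] By]; have /= h3 := dB _ _ (cc t') h1 By.
  rewrite /k (_ : _ - _ = (t' - t) + 6 * (f (act (cis t') y) - f (act (cis t) x))); last by ring.
  apply: le_lt_trans (ler_normD _ _) _; rewrite normrM ger0_norm //; lra.
pose W := [set x | V (tw_pi x) /\ 1 / 2 < f x].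
have WN x : W x -> N x.
  by move=> [_ fx]; apply/not_notP => /f0 fx0; move: fx; rewrite fx0; lra.
have nW x : W x -> nbhs x W.
  move=> [Vx fx]; apply: filterI.
    by apply: (tw_pi_continuous hD); exact: open_nbhs_nbhs.
  have : \forall y \near x, `|f y - f x| < f x - 1 / 2.
    by have /cvg_RP := fc _ Vx; apply; rewrite subr_gt0.
  by apply: filterS => y /=; rewrite ltr_norml => /andP[]; lra.
have AS x r : W x -> W (act (cis r) x) -> `|r| < 1 / 4 -> A (act (cis r) x) + r <= A x.
  move=> Wx Wrx r4; rewrite -lerBrDr; apply: ge_sup.
    by exists (k 0 (act (cis r) x)), 0 => //=; rewrite in_itv /=; lra.
  move=> _ [t tI <-].
  have tI' : -1 <= t <= 1 by move: tI; rewrite /= in_itv.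
  have A3 : 3 < A x.
    have /kA : (0 : R) \in `[-1, 1] by rewrite in_itv /=; lra.
    by move=> /(_ x); rewrite /k cis0 (tw_act1 hD) => h; case: Wx => _; lra.
  have actE : act (cis t) (act (cis r) x) = act (cis (t + r)) x.
    by rewrite cisD (tw_actM hD).
  have [fz|fz] := pselect (N (act (cis t) (act (cis r) x))); last first.
    by rewrite /k (f0 _ fz); move: r4; rewrite ltr_norml => /andP[]; lra.
  have t4 : `|t| < 1 / 4.
    apply: cis_small; first by rewrite ler_norml.
    exact: Nz (cc t) (WN _ Wrx) fz.
  have /kA : t + r \in `[-1, 1].
    by move: r4 t4; rewrite in_itv /= !ltr_norml => /andP[? ?] /andP[? ?]; lra.
  by move=> /(_ x); rewrite /k actE; lra.
have AE x y : W x -> W y -> tw_pi x = tw_pi y -> act (cis (A x)) x = act (cis (A y)) y.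
  move=> Wx Wy /(tw_act_trans hD)[z zc yE].
  have z1 : nc (z - 1) < small_angle R.
    by apply: Nz zc (WN _ Wx) _; rewrite -yE; exact: WN.
  have [r r4 zE] := circle_small zc z1; rewrite zE in yE.
  have h1 : A y + r <= A x by rewrite yE; apply: AS => //; rewrite -yE.
  have h2 : A x - r <= A y.
    have xE : x = act (cis (- r)) y.
      by rewrite yE -(tw_actM hD) // -cisD addNr cis0 (tw_act1 hD).
    by rewrite {1}xE; apply: AS; rewrite -?xE // normrN.
  have -> : A x = A y + r by apply/eqP; rewrite eq_le; apply/andP; split; lra.
  by rewrite yE cisD (tw_actM hD) // -yE.
pose sec h := xget s [set t | exists x, [/\ W x, tw_pi x = h & t = act (cis (A x)) x]].
have secE x : W x -> sec (tw_pi x) = act (cis (A x)) x.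
  move=> Wx; rewrite /sec; case: xgetP => [_ _ [y [Wy yx ->]]|/(_ (act (cis (A x)) x))[]].
    exact: AE.
  by exists x.
exists (@tw_pi R D @` W), sec; split.
- rewrite openE => _ [x Wx <-]; exact: tw_pi_nbhs (nW _ Wx).
- by exists s => //; split; [exact: nbhs_singleton|rewrite fs; lra].
- by move=> _ [x [Vx _] <-]; exact: VU.
split; first by move=> _ [x Wx <-]; rewrite secE // (tw_pi_act hD).
move=> _ [x Wx <-] P; rewrite secE // => /(act_near (cc _))[e e0 [B nB eB]].
have [d d0 dA] : exists2 d : R, 0 < d & forall t, `|t - A x| < d -> nc (cis t - cis (A x)) < e.
  have : \forall t \near A x, nc (cis t - cis (A x)) < e.
    by move/cvg_CP: (@cis_continuous R (A x)); exact.
  by move=> /nbhs_Rdist.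
have nA : \forall y \near x, `|A y - A x| < d.
  by apply: (@sup_near _ _ k x 7) => //; apply: kc; case: Wx.
have : nbhs x [set y | W y /\ P (act (cis (A y)) y)].
  apply: filterS3 (nW _ Wx) nB nA => y Wy By Ay; split => //.
  by apply: eB => //; exact: dA.
move=> /tw_pi_nbhs; apply: filterS => _ [y [Wy Py] <-].
by rewrite /preimage /= secE.
Qed.

(** * Sections vanishing at infinity *)

Lemma grng_nbhs (g : G) (W : set G) : nbhs g W -> nbhs (grng g) (@grng G @` W).
Proof.
have invc : continuous (@ginv G) by case: eG => -[].
have gVV (h : G) : ginv (ginv h) = h by exact: ginvK.
move=> nW; have : nbhs (ginv g) (@ginv G @^-1` W) by apply: invc; rewrite gVV.
move=> /(gdom_nbhs eG); rewrite (gdomV hG); apply: filterS => _ [h Wh <-].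
by exists (ginv h) => //; rewrite (grngV hG).
Qed.

Lemma bissection_lift_rng (U : set G) (g : G) (W : set G) : bissection U ->
  U g -> nbhs g W ->
  exists2 A, nbhs (grng g) A & forall h, U h -> A (grng h) -> W h.
Proof.
move=> bU Ug nW; exists (@grng G @` (U `&` W)).
  by apply: grng_nbhs; apply: filterI => //; exact: bissection_nbhs.
move=> h Uh [k [Uk Wk] kh].
by rewrite -(bissection_rngI bU Uk Uh kh).
Qed.

(** The composable pairs of a product of compact sets are a closed part of it, because
    the unit space is Hausdorff. *)
Lemma compact_bmul (K1 K2 : set G) : compact K1 -> compact K2 -> compact (bmul K1 K2).
Proof.
move=> K1c K2c; have /compact_near_coveringP Kc := compact_setX K1c K2c.
apply/compact_near_coveringP => I F P FF FP.
have := Kc I F (fun i p => gdom p.1 = grng p.2 -> P i (gmul p.1 p.2)) FF.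
have h p : (K1 `*` K2) p -> \forall p' \near p & i \near F,
    gdom p'.1 = grng p'.2 -> P i (gmul p'.1 p'.2).
  case: p => k1 k2 [/= Kk1 Kk2].
  have [kk|kk] := pselect (gdom k1 = grng k2).
    have [|[A J] /= [nA FJ] AJ] := FP (gmul k1 k2); first by exists k1, k2.
    have [A1 [A2 [nA1 nA2 A12]]] := gmul_near (let: And5 t _ _ _ _ := eG in t) kk nA.
    exists (A1 `*` A2, J); first by split => //=; exists (A1, A2).
    move=> [[a b] i] /= [[Aa Ab] Ji] ab.
    by apply: (AJ (_, i)); split => //=; exact: A12.
  have [A [B [oA oB Ak Bk AB]]] := gunits_hausdorff eG (gunits_dom eG k1) (gunits_rng eG k2) kk.
  exists ((@gdom G @^-1` A) `*` (@grng G @^-1` B), setT).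
    split => /=; last exact: filterT.
    exists (@gdom G @^-1` A, @grng G @^-1` B) => //; split.
      by apply: (gdom_continuous eG); exact: open_nbhs_nbhs.
    by apply: (grng_continuous eG); exact: open_nbhs_nbhs.
  move=> [[a b] i] /= [[Aa Bb] _] ab; exfalso.
  by apply: (AB (gdom a)); rewrite ?[in X in B X]ab //; exact: gunits_dom.
move=> /(_ h); apply: filterS => i Pi _ [k1 [k2 [Kk1 Kk2 kk ->]]].
exact: (Pi (k1, k2) (conj Kk1 Kk2)).
Qed.

Lemma C0P (U : set G) (xi : G -> L) : bissection U ->
  C0 U xi <->
  [/\ forall g, line_proj (xi g) = g, forall g, ~ U g -> xi g = lz g,
      forall g, U g -> {for g, continuous xi} &
      forall eps : R, 0 < eps -> exists K : set G,
        [/\ compact K, K `<=` U & forall g, U g -> ~ K g -> line_norm (xi g) < eps]].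
Proof.
move=> bU; split=> -[h1 h2 h3 h4]; split => //.
  move=> g Ug W nW; have := within_near h3 Ug nW; have := bissection_nbhs bU Ug.
  by apply: filterS2 => h Uh; exact.
apply/subspace_continuousP => g Ug W nW.
have n1 : nbhs g (xi @^-1` W) := h3 g Ug W nW; change (nbhs g [set x | U x -> W (xi x)]).
by apply: filterS n1 => h Wh _; exact: Wh.
Qed.

Section OneBissection.
Variable U : set G.
Hypothesis bU : bissection U.

Lemma C0_proj xi g : C0 U xi -> line_proj (xi g) = g.
Proof. by case. Qed.
Lemma C0_out xi g : C0 U xi -> ~ U g -> xi g = lz g.
Proof. by case=> _ + _ _; exact. Qed.
Lemma C0_continuous xi g : C0 U xi -> U g -> {for g, continuous xi}.
Proof. by move=> /(C0P _ bU)[_ _ + _]; exact. Qed.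

Lemma C0_bounded xi : C0 U xi -> exists2 M : R, 0 <= M & forall g, line_norm (xi g) <= M.
Proof.
move=> xiC; have [_ _ _ /(_ 1 ltr01)[K [Kc KU K1]]] := (C0P _ bU).1 xiC.
have /compact_near_coveringP := Kc.
move=> /(_ R (pinfty_nbhs R) (fun M g => line_norm (xi g) <= M) _).
have h g : K g -> \forall g' \near g & M \near +oo, line_norm (xi g') <= M.
  move=> Kg; have n1 : \forall g' \near g, `|line_norm (xi g') - line_norm (xi g)| < 1.
    have : {for g, continuous (@line_norm R D \o xi)}.
      apply: continuous_comp; first by apply: C0_continuous => //; exact: KU.
      exact: line_norm_continuous.
    by move=> /cvg_RP; apply.
  exists ([set g' | `|line_norm (xi g') - line_norm (xi g)| < 1],
          [set M | line_norm (xi g) + 1 < M]).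
    by split => //=; exists (line_norm (xi g) + 1); split; first exact: num_real.
  by move=> [g' M] /= []; rewrite ltr_norml => /andP[]; lra.
move=> /(_ h) KM; have [M MK] := filter_ex KM.
exists (Num.max M 1) => [|g]; first by rewrite le_max ler01 orbT.
rewrite le_max; have [Kg|nKg] := pselect (K g); first by rewrite MK.
have [Ug|nUg] := pselect (U g); first by rewrite (ltW (K1 _ Ug nKg)) orbT.
by rewrite (C0_out xiC) // line_norm_zero ler01 orbT.
Qed.

Lemma C0_scal (phi : G -> C) (M : R) xi : C0 U xi ->
  (forall g, U g -> {for g, continuous phi}) -> (forall g, U g -> nc (phi g) <= M) ->
  C0 U (fun g => line_scale (phi g) (xi g)).
Proof.
move=> xiC phic phiM; apply/(C0P _ bU); split.
- by move=> g; rewrite line_proj_scale (C0_proj _ xiC).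
- by move=> g nU; rewrite (C0_out xiC) // line_scale_zero.
- move=> g Ug W nW; have [e e0 [A nA eA]] := line_scale_near nW.
  have n1 : \forall h \near g, nc (phi h - phi g) < e by move/cvg_CP: (phic g Ug); exact.
  have n2 : nbhs g (xi @^-1` A) := C0_continuous xiC Ug nA.
  by apply: filterS2 n1 n2 => h h1 h2; apply: eA.
move=> eps eps0; have [_ _ _] := (C0P _ bU).1 xiC.
have M1 : 0 < `|M| + 1 by rewrite ltr_wpDl.
move=> /(_ (eps / (`|M| + 1)))[|K [Kc KU Ke]]; first by rewrite divr_gt0.
exists K; split => // g Ug nK; rewrite line_norm_scale.
have := Ke g Ug nK; rewrite ltr_pdivlMr // mulrC => /(le_lt_trans _); apply.
rewrite ler_wpM2r ?line_norm_ge0 //; apply: le_trans (phiM g Ug) _.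
by have := ler_norm M; lra.
Qed.

Lemma C0_scale (a : C) xi : C0 U xi -> C0 U (fun g => line_scale a (xi g)).
Proof. by move=> xiC; apply: (@C0_scal (fun=> a) (nc a)) => // g _; exact: cst_continuous. Qed.

Lemma C0_add xi eta : C0 U xi -> C0 U eta -> C0 U (fun g => line_add (xi g) (eta g)).
Proof.
move=> xiC etaC; have pE g : line_proj (xi g) = line_proj (eta g).
  by rewrite (C0_proj _ xiC) (C0_proj _ etaC).
apply/(C0P _ bU); split.
- by move=> g; rewrite (line_proj_add (pE g)) (C0_proj _ xiC).
- by move=> g nU; rewrite (C0_out xiC) // (C0_out etaC) // line_add_zero // line_zero_proj.
- move=> g Ug W nW; have [A [B [nA nB AB]]] := line_add_near (pE g) nW.
  have n1 : nbhs g (xi @^-1` A) := C0_continuous xiC Ug nA.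
  have n2 : nbhs g (eta @^-1` B) := C0_continuous etaC Ug nB.
  by apply: filterS2 n1 n2 => h Ah Bh; apply: AB.
move=> eps eps0; have e2 : 0 < eps / 2 by rewrite divr_gt0.
have [_ _ _ /(_ _ e2)[K1 [K1c K1U K1e]]] := (C0P _ bU).1 xiC.
have [_ _ _ /(_ _ e2)[K2 [K2c K2U K2e]]] := (C0P _ bU).1 etaC.
exists (K1 `|` K2); split; first exact: compactU.
  by move=> g [/K1U|/K2U].
move=> g Ug /not_orP[nK1 nK2]; apply: le_lt_trans (line_norm_add (pE g)) _.
by have := K1e g Ug nK1; have := K2e g Ug nK2; lra.
Qed.

Lemma C0_star xi : C0 U xi -> bissection (binv U) ->
  C0 (binv U) (fun g => line_star (xi (ginv g))).
Proof.
have gVV (h : G) : ginv (ginv h) = h by exact: ginvK.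
have UV g : binv U g <-> U (ginv g).
  by split => [[h Uh <-]|Ug]; [rewrite gVV|exists (ginv g)].
have invc : continuous (@ginv G) by case: eG => -[].
move=> xiC bV; apply/(C0P _ bV); split.
- by move=> g; rewrite line_proj_star (C0_proj _ xiC) gVV.
- move=> g nV; rewrite (C0_out xiC) ?line_star_zero ?gVV //.
  by move=> /UV.
- move=> g /UV Ug W /line_star_continuous/(C0_continuous xiC Ug)/invc.
  exact.
move=> eps eps0; have [_ _ _ /(_ _ eps0)[K [Kc KU Ke]]] := (C0P _ bU).1 xiC.
exists (@ginv G @` K); split.
- by apply: continuous_compact => //; exact: continuous_subspaceT.
- by move=> _ [g /KU Ug <-]; exists g.
move=> g /UV Ug nK; rewrite line_norm_star; apply: Ke => // Kg.
by apply: nK; exists (ginv g).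
Qed.

(** A section vanishing at infinity extends by zero to any larger bissection: the
    latter is Hausdorff, so that compact subsets are closed in it. *)
Lemma C0_incl (V : set G) xi : bissection V -> U `<=` V -> C0 U xi -> C0 V xi.
Proof.
move=> bV UV xiC; apply/(C0P _ bV); split.
- by move=> g; rewrite (C0_proj _ xiC).
- by move=> g nV; apply: (C0_out xiC) => /UV.
- move=> g Vg; have [Ug|nUg] := pselect (U g); first exact: C0_continuous.
  apply: line_zero_cvg; first by rewrite (C0_out xiC) // line_norm_zero.
    rewrite (C0_proj _ xiC); under eq_fun do rewrite (C0_proj _ xiC); exact: cvg_id.
  apply/cvg_RP => e e0; have [_ _ _ /(_ _ e0)[K [Kc KU Ke]]] := (C0P _ bU).1 xiC.
  have /compact_near_coveringP := Kc.
  move=> /(_ _ (nbhs g) (fun h k => V h -> h <> k) _).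
  have hK k : K k -> \forall k' \near k & h \near g, V h -> h <> k'.
    move=> Kk; have Vk : V k by exact/UV/KU.
    have kg : k <> g by move=> kg; apply: nUg; rewrite -kg; exact: KU.
    have [A [B [nA nB AB]]] := bissection_separated eG bV Vk Vg kg.
    exists (A, B) => // -[k' h] /= [Ak' Bh] Vh hk; apply: (AB h) => //.
    by rewrite hk.
  move=> /(_ hK); apply: filterS2 (bissection_nbhs bV Vg) => h Vh nKh.
  rewrite subr0 ger0_norm ?line_norm_ge0 //.
  have [Uh|nUh] := pselect (U h); last by rewrite (C0_out xiC) // line_norm_zero.
  by apply: Ke => // Kh; exact: (nKh _ Kh Vh).
move=> eps eps0; have [_ _ _ /(_ _ eps0)[K [Kc KU Ke]]] := (C0P _ bU).1 xiC.
exists K; split => //; first by move=> g /KU/UV.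
move=> g Vg nK; have [Ug|nUg] := pselect (U g); first exact: Ke.
by rewrite (C0_out xiC) // line_norm_zero.
Qed.

(** A local section of the twist is a nowhere zero local section of the line bundle,
    which is multiplied by a constant and cut off by a Urysohn function. *)
Lemma C0_through (v : L) (W : set G) : U (line_proj v) -> nbhs (line_proj v) W ->
  exists xi, [/\ C0 U xi, xi (line_proj v) = v & forall g, ~ W g -> xi g = lz g].
Proof.
move=> Ug nW; have [V [sec [oV Vg VU [secp secc]]]] := local_section bU Ug.
have nV : nbhs (line_proj v) V by exact: open_nbhs_nbhs.
have nVW : nbhs (line_proj v) (W `&` V) by exact: filterI.
have [f [K [f01 f1 Kc KUVW [f0 fc]]]] := bissection_urysohn eG bU R Ug nVW.
have [l vE] : exists l, v = \pi_(line D) (l, sec (line_proj v)).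
  by apply: line_atP; rewrite secp.
have KU : K `<=` U by move=> g /KUVW[].
have KV : K `<=` V by move=> g /KUVW[_ []].
have KW : K `<=` W by move=> g /KUVW[_ []].
pose eta g := if `[< V g >] then \pi_(line D) (l, sec g) else lz g.
have etap g : line_proj (eta g) = g.
  by rewrite /eta; case: asboolP => [?|_]; [rewrite (line_projE hD) /= secp|rewrite line_zero_proj].
have etaM g : line_norm (eta g) <= nc l.
  rewrite /eta; case: asboolP => [?|_]; first by rewrite (line_normE hD) lexx.
  by rewrite line_norm_zero nc_ge0.
pose xi g := line_scale (f g)%:C (eta g).
have xip g : line_proj (xi g) = g by rewrite line_proj_scale etap.
have xiV g : V g -> xi g = \pi_(line D) ((f g)%:C * l, sec g).
  by move=> ?; rewrite /xi /eta; case: asboolP => // _; rewrite line_scaleE.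
have xiK g : ~ K g -> xi g = lz g.
  move=> nK; apply: line_zeroP; last by rewrite line_proj_scale etap.
  by rewrite line_norm_scale f0 // ncC normr0 mul0r.
exists xi; split; last first.
- by move=> g nWg; apply: xiK => /KW.
- by rewrite xiV // f1 mul1r -vE.
apply/(C0P _ bU); split.
- exact: xip.
- by move=> g nU; apply: xiK => /KU.
- move=> g Ug'; have [Kg|nKg] := pselect (K g).
    have Vg' := KV _ Kg; move=> P; rewrite xiV // => /line_nbhsP[e e0 [N nN NP]].
    have l1 : 0 < nc l + 1 by have := nc_ge0 l; lra.
    have n1 : \forall h \near g, `|f h - f g| < e / (nc l + 1).
      by have /cvg_RP := fc g Ug'; apply; rewrite divr_gt0.
    have n2 : nbhs g (sec @^-1` N) := secc g Vg' _ nN.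
    have n3 : nbhs g V by exact: open_nbhs_nbhs.
    apply: filterS3 n1 n2 n3 => h h1 h2 h3; rewrite /preimage /= xiV //.
    apply: NP => //; rewrite -mulrBl -rmorphB ncM ncC.
    move: h1; rewrite ltr_pdivlMr // => /(le_lt_trans _); apply.
    by rewrite ler_wpM2l // lerDl.
  apply: line_zero_cvg; first by rewrite xiK // line_norm_zero.
    rewrite xip; under eq_fun do rewrite xip; exact: cvg_id.
  apply/cvg_RP => e e0.
  have l1 : 0 < nc l + 1 by have := nc_ge0 l; lra.
  have n1 : \forall h \near g, `|f h - f g| < e / (nc l + 1).
    by have /cvg_RP := fc g Ug'; apply; rewrite divr_gt0.
  apply: filterS n1 => h; rewrite (f0 g nKg) !subr0 line_norm_scale ncC.
  rewrite ltr_pdivlMr // normrM normr_id => /(le_lt_trans _); apply.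
  rewrite ler_wpM2l // ger0_norm ?line_norm_ge0 //.
  by apply: le_trans (etaM h) _; rewrite lerDl.
move=> eps eps0; exists K; split => // g _ nK.
by rewrite xiK // line_norm_zero.
Qed.

End OneBissection.

(** * Coordinates of the line bundle *)

Lemma lift_exists (g : G) : exists s : Sg, tw_pi s = g /\ (gunits G g -> s = tw_iota D 1 g).
Proof.
have [gu|gu] := pselect (gunits G g).
  by exists (tw_iota D 1 g); split => //; rewrite (tw_pi_iota hD) //; exact: circle1.
by have [s sg] := tw_pi_surj hD g; exists s.
Qed.

(** A set-theoretic section of the twist, which is the canonical one over the
    units. It identifies the line bundle with a product, fibre by fibre. *)
Definition lift (g : G) : Sg := sval (cid (lift_exists g)).

Lemma lift_pi g : tw_pi (lift g) = g.
Proof. by rewrite /lift; case: cid => s []. Qed.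

Lemma lift_unit x : gunits G x -> lift x = tw_iota D 1 x.
Proof. by move=> xu; rewrite /lift; case: (cid (lift_exists x)) => s [_ h] /=; exact: h. Qed.

Definition coord (v : L) : C := xget 0 [set l | v = [ln l, lift (line_proj v)]].

Lemma coordP v : v = [ln coord v, lift (line_proj v)].
Proof.
rewrite {1}/coord; case: xgetP => [l _ //|h]; exfalso.
by have [|l vE] := @line_atP v (lift (line_proj v)); [rewrite lift_pi|exact: h vE].
Qed.

Lemma coordE l g : coord [ln l, lift g] = l.
Proof.
apply: (@line_inj (lift g)).
by have := coordP [ln l, lift g]; rewrite (line_projE hD) /= lift_pi => <-.
Qed.

Lemma coord_inj v w : line_proj v = line_proj w -> coord v = coord w -> v = w.
Proof. by move=> p c; rewrite [LHS](coordP v) [RHS](coordP w) p c. Qed.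

Lemma line_norm_coord v : line_norm v = nc (coord v).
Proof. by rewrite {1}(coordP v) (line_normE hD). Qed.

Lemma coord_add v w : line_proj v = line_proj w ->
  coord (line_add v w) = coord v + coord w.
Proof.
by move=> p; rewrite {1}(coordP v) {1}(coordP w) -p line_addE coordE.
Qed.

Lemma coord_scale a v : coord (line_scale a v) = a * coord v.
Proof. by rewrite {1}(coordP v) line_scaleE coordE. Qed.

Lemma coord_zero g : coord (lz g) = 0.
Proof. by apply/eqP; rewrite -nc_eq0 -line_norm_coord line_norm_zero. Qed.

Lemma lift_composable g h : gdom g = grng h -> gdom (lift g) = grng (lift h).
Proof. by move=> gh; apply/composable_pi; rewrite !lift_pi. Qed.

(** The 2-cocycle that measures the failure of [lift] to be multiplicative *)
Definition cocycle (g h : G) : C := coord [ln 1, gmul (lift g) (lift h)].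

Lemma coord_mul v w : gdom (line_proj v) = grng (line_proj w) ->
  coord (line_mul v w) = cocycle (line_proj v) (line_proj w) * (coord v * coord w).
Proof.
move=> vw; have lc := lift_composable vw.
rewrite {1}(coordP v) {1}(coordP w) line_mulE // /cocycle.
rewrite -[coord v * coord w]mulr1 -line_scaleE coord_scale.
by rewrite mulr1 mulrC.
Qed.

Lemma coord_mul_unitr v w : gunits G (line_proj w) -> gdom (line_proj v) = line_proj w ->
  coord (line_mul v w) = coord v * coord w.
Proof.
move=> wu vw; have lc : gdom (lift (line_proj v)) = grng (lift (line_proj w)).
  by apply: lift_composable; rewrite vw (gunits_grng eG).
rewrite {1}(coordP v) {1}(coordP w) line_mulE //.
have -> : lift (line_proj w) = gdom (lift (line_proj v)).
  by rewrite (dom_iota hD) lift_pi vw lift_unit.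
by rewrite (gmul_dom hSg) coordE.
Qed.

Lemma coord_mul_unitl v w : gunits G (line_proj v) -> line_proj v = grng (line_proj w) ->
  coord (line_mul v w) = coord v * coord w.
Proof.
move=> vu vw; have lc : gdom (lift (line_proj v)) = grng (lift (line_proj w)).
  by apply: lift_composable; rewrite vu vw.
rewrite {1}(coordP v) {1}(coordP w) line_mulE //.
have -> : lift (line_proj v) = grng (lift (line_proj w)).
  by rewrite (rng_iota hD) lift_pi -vw lift_unit.
by rewrite (gmul_rng hSg) coordE.
Qed.

Lemma coord_star_mul v w : line_proj v = line_proj w ->
  coord (line_mul (line_star v) w) = (coord v)^* * coord w.
Proof.
move=> p; rewrite {1}(coordP v) {1}(coordP w) -p line_starE.
rewrite line_mulE ?(gdomV hSg) // (gmulVl hSg) (dom_iota hD) lift_pi.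
by rewrite -lift_unit ?coordE //; exact: gunits_dom.
Qed.

Lemma coord_conj v b w : line_proj v = line_proj w -> line_proj b = grng (line_proj v) ->
  coord (line_mul (line_mul (line_star v) b) w) = (coord v)^* * coord b * coord w.
Proof.
move=> p bv; rewrite {1}(coordP v) {1}(coordP w) {1}(coordP b) -p bv line_starE.
have -> : lift (grng (line_proj v)) = grng (lift (line_proj v)).
  by rewrite (rng_iota hD) lift_pi lift_unit //; exact: gunits_rng.
rewrite line_mulE ?(gdomV hSg) ?(grng_rng hSg) //.
have -> : gmul (ginv (lift (line_proj v))) (grng (lift (line_proj v))) = ginv (lift (line_proj v)).
  by rewrite -(gdomV hSg) (gmul_dom hSg).
rewrite line_mulE ?(gdomV hSg) // (gmulVl hSg) (dom_iota hD) lift_pi.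
by rewrite -lift_unit ?coordE //; exact: gunits_dom.
Qed.

Lemma coord_star_unit v : gunits G (line_proj v) -> coord (line_star v) = (coord v)^*.
Proof.
move=> vu; rewrite {1}(coordP v) line_starE.
rewrite (_ : ginv _ = lift (line_proj v)) ?coordE //.
have lu : gdom (lift (line_proj v)) = lift (line_proj v).
  by rewrite (dom_iota hD) lift_pi (vu : gdom _ = _) lift_unit.
move: (gmul_rng hSg (ginv (lift (line_proj v)))) (gmulV hSg (lift (line_proj v))).
have := grng_dom hSg (lift (line_proj v)).
by rewrite (grngV hSg) lu => rE h1 h2; rewrite -h1 h2.
Qed.

(** Over the unit space the coordinate is continuous: the canonical section is. *)
Lemma coord_continuous (xi : G -> L) x : gunits G x ->
  (forall g, line_proj (xi g) = g) -> {for x, continuous xi} ->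
  {for x, continuous (coord \o xi)}.
Proof.
move=> xu xip xic; apply/cvg_CP => e e0; rewrite /=.
set l := coord (xi x).
have xE : xi x = [ln l, tw_iota D 1 x] by rewrite {1}(coordP (xi x)) xip lift_unit.
have l1 : 0 < nc l + 1 by have := nc_ge0 l; lra.
have d0 : 0 < e / 2 / (nc l + 1) by rewrite divr_gt0 // divr_gt0.
have [N nN Nd] := iota_inv_near (circle1 _) xu d0 (filterT : nbhs _ setT).
have n1 : nbhs x (xi @^-1` [set v | exists m t, [/\ nc (m - l) < e / 2, N t & v = [ln m, t]]]).
  apply: xic; rewrite xE; apply/line_nbhsP; exists (e / 2); first by rewrite divr_gt0.
  by exists N => // m t ml Nt; exists m, t.
have n2 : nbhs x (gunits G) by apply: open_nbhs_nbhs; split => //; exact: gunits_open.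
apply: filterS2 n1 n2 => g [m [t [ml Nt xgE]]] gu.
have tg : tw_pi t = g by rewrite -(xip g) xgE (line_projE hD).
have [|w [y [wc yu tE]]] := tw_exact hD (s := t); first by rewrite tg.
have yg : y = g by rewrite -tg tE (tw_pi_iota hD).
have [w1 _] : nc (w - 1) < e / 2 / (nc l + 1) /\ setT y by apply: Nd => //; rewrite -tE.
have -> : coord (xi g) = m * w.
  have tE' : t = tw_act w (lift g).
    have us : gunits G (tw_pi (lift g)) by rewrite lift_pi.
    rewrite lift_unit // /tw_act (tw_pi_iota hD) //; last exact: circle1.
    by rewrite (gunits_grng eG) // -(tw_iotaM hD) ?mulr1 ?tE ?yg //; exact: circle1.
  by rewrite xgE tE' line_act // coordE mulrC.
rewrite (_ : m * w - l = (m - l) * w + l * (w - 1)); last by ring.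
apply: le_lt_trans (ncD _ _) _; rewrite !ncM (nc_circle wc) mulr1.
have : nc l * nc (w - 1) <= e / 2.
  move: w1; rewrite ltr_pdivlMr // => w1; apply: le_trans (ltW w1).
  by rewrite mulrC ler_wpM2l ?nc_ge0 // lerDl.
lra.
Qed.

(** * Products of sections *)

Section Two.
Variables U V : set G.
Hypotheses (bU : bissection U) (bV : bissection V).

Lemma bmul_factor (g1 g2 h1 h2 : G) : U g1 -> V g2 -> U h1 -> V h2 ->
  gdom g1 = grng g2 -> gdom h1 = grng h2 -> gmul g1 g2 = gmul h1 h2 ->
  g1 = h1 /\ g2 = h2.
Proof.
move=> Ug Vg Uh Vh g12 h12 E; split.
  by apply: (bissection_rngI bU) => //; rewrite -(grngM hG g12) E (grngM hG).
by apply: (bissection_domI bV) => //; rewrite -(gdomM hG g12) E (gdomM hG).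
Qed.

Lemma sec_mulE xi eta g1 g2 : U g1 -> V g2 -> gdom g1 = grng g2 ->
  sec_mul hD U V xi eta (gmul g1 g2) = line_mul (xi g1) (eta g2).
Proof.
move=> Ug Vg g12; rewrite /sec_mul; case: pselect => [h|[]]; last by exists (g1, g2).
case: cid => -[h1 h2] /= [Uh Vh h12 E].
by have [-> ->] := bmul_factor Ug Vg Uh Vh g12 h12 E.
Qed.

Lemma sec_mul_out xi eta g : ~ bmul U V g -> sec_mul hD U V xi eta g = lz g.
Proof.
move=> nUV; rewrite /sec_mul; case: pselect => // -[[h1 h2] [Uh Vh h12 E]].
by exfalso; apply: nUV; exists h1, h2.
Qed.

(** The factors of an arrow of UV depend continuously on it: they are determined by its
    range and by its source. *)
Lemma C0_mul xi eta : bissection (bmul U V) -> C0 U xi -> C0 V eta ->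
  C0 (bmul U V) (sec_mul hD U V xi eta).
Proof.
move=> bUV xiC etaC.
have pxi g : line_proj (xi g) = g by exact: C0_proj xiC.
have peta g : line_proj (eta g) = g by exact: C0_proj etaC.
have comp g1 g2 : gdom g1 = grng g2 -> gdom (line_proj (xi g1)) = grng (line_proj (eta g2)).
  by rewrite pxi peta.
apply/(C0P _ bUV); split.
- move=> g; have [[g1 [g2 [Ug Vg g12 ->]]]|nUV] := pselect (bmul U V g).
    by rewrite sec_mulE // (line_proj_mul (comp _ _ g12)) pxi peta.
  by rewrite sec_mul_out // line_zero_proj.
- by move=> g; exact: sec_mul_out.
- move=> _ [g1 [g2 [Ug Vg g12 ->]]] W; rewrite sec_mulE // => nW.
  have [A [B [nA nB AB]]] := line_mul_near (comp _ _ g12) nW.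
  have n1 : nbhs g1 (xi @^-1` A) := C0_continuous bU xiC Ug nA.
  have n2 : nbhs g2 (eta @^-1` B) := C0_continuous bV etaC Vg nB.
  have [A' nA' A'P] := bissection_lift_rng bU Ug n1.
  have [B' nB' B'P] := bissection_lift eG bV Vg n2.
  have UVg : bmul U V (gmul g1 g2) by exists g1, g2.
  have n3 : nbhs (gmul g1 g2) (@grng G @^-1` A').
    by apply: (grng_continuous eG); rewrite (grngM hG).
  have n4 : nbhs (gmul g1 g2) (@gdom G @^-1` B').
    by apply: (gdom_continuous eG); rewrite (gdomM hG).
  apply: filterS3 (bissection_nbhs bUV UVg) n3 n4 => _ [h1 [h2 [Uh Vh h12 ->]]].
  rewrite /preimage /= (grngM hG) // (gdomM hG) // => A'h B'h.
  rewrite sec_mulE //; apply: AB; last exact: comp.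
    exact: A'P.
  exact: B'P.
move=> eps eps0.
have [M1 M10 xiM] := C0_bounded bU xiC; have [M2 M20 etaM] := C0_bounded bV etaC.
have e1 : 0 < eps / (M2 + 1) by rewrite divr_gt0 //; lra.
have e2 : 0 < eps / (M1 + 1) by rewrite divr_gt0 //; lra.
have [_ _ _ /(_ _ e1)[K1 [K1c K1U K1e]]] := (C0P xi bU).1 xiC.
have [_ _ _ /(_ _ e2)[K2 [K2c K2V K2e]]] := (C0P eta bV).1 etaC.
exists (bmul K1 K2); split; first exact: compact_bmul.
  by move=> _ [h1 [h2 [/K1U Uh /K2V Vh h12 ->]]]; exists h1, h2.
move=> _ [g1 [g2 [Ug Vg g12 ->]]] nK.
rewrite sec_mulE // (line_norm_mul (comp _ _ g12)).
have [Kg1|nKg1] := pselect (K1 g1).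
  have nKg2 : ~ K2 g2 by move=> Kg2; apply: nK; exists g1, g2.
  have := K2e _ Vg nKg2; rewrite ltr_pdivlMr; last lra.
  rewrite mulrC => /(le_lt_trans _); apply; rewrite ler_wpM2r ?line_norm_ge0 //.
  by apply: le_trans (xiM _) _; lra.
have := K1e _ Ug nKg1; rewrite ltr_pdivlMr; last lra.
move=> /(le_lt_trans _); apply; rewrite ler_wpM2l ?line_norm_ge0 //.
by apply: le_trans (etaM _) _; lra.
Qed.

End Two.

Lemma sec_mulA (U V W : set G) xi eta zeta : bissection U -> bissection V -> bissection W ->
  bissection (bmul U V) -> bissection (bmul V W) ->
  (forall g, line_proj (xi g) = g) -> (forall g, line_proj (eta g) = g) ->
  (forall g, line_proj (zeta g) = g) ->
  sec_mul hD U (bmul V W) xi (sec_mul hD V W eta zeta) =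
  sec_mul hD (bmul U V) W (sec_mul hD U V xi eta) zeta.
Proof.
move=> bU bV bW bUV bVW pxi peta pzeta; apply/funext => g.
have [[g1 [_ [Ug1 [g2 [g3 [Vg2 Wg3 g23 ->]]] + ->]]]|nUVW] := pselect (bmul U (bmul V W) g).
  rewrite (grngM hG) // => g12.
  have VW23 : bmul V W (gmul g2 g3) by exists g2, g3.
  have UV12 : bmul U V (gmul g1 g2) by exists g1, g2.
  rewrite (sec_mulE bU bVW) // ?(grngM hG) // (sec_mulE bV bW) //.
  rewrite (gmulA hG) // (sec_mulE bUV bW) ?(gdomM hG) // (sec_mulE bU bV) //.
  by rewrite line_mulA // ?pxi ?peta ?pzeta.
rewrite sec_mul_out // sec_mul_out //.
by rewrite -(bmulA hG).
Qed.

(** * The Fell bundle of sections *)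

Variables (S : set (set G)) (hS : inverse_subsemigroup S).
Local Notation A := (section_bundle hD hS).
Local Notation E := (restrE A).
Local Open Scope isg_scope.

(** The index semigroup is read off the type of the bundle, as it depends on a proof
    of the groupoid axioms that is internal to the bundle. *)
Definition index_isg : inverse_semigroup := ltac:(let t := type of A in
  match t with fell_data _ ?S => exact S end).
Local Notation I := index_isg.

Definition biss (U : I) : set G := val (U : S).

Lemma biss_mul (U V : I) : biss (U ** V) = bmul (biss U) (biss V). Proof. by []. Qed.
Lemma biss_star (U : I) : biss U^! = binv (biss U). Proof. by []. Qed.

Lemma biss_inj (U V : I) : biss U = biss V -> U = V.
Proof. exact: val_inj. Qed.

Lemma bissP (U : I) : bissection (biss U).
Proof. exact: S_bissection. Qed.

Lemma bissS (W : set G) : S W -> exists U : I, biss U = W.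
Proof. by move=> SW; exists (SigSub (mem_set SW) : S). Qed.

Definition sec (U : I) (a : A U) : G -> L := val (a : C0_fib hD (U : S)).

Lemma secP (U : I) (a : A U) : C0 (biss U) (sec a).
Proof. exact: set_mem (valP (a : C0_fib hD (U : S))). Qed.

Lemma sec_mkC0 (U : I) xi : C0 (biss U) xi -> sec (mkC0 hD (U : S) xi : A U) = xi.
Proof. by move=> xiC; rewrite /sec /mkC0 insubdK //; exact: mem_set. Qed.

Lemma sec_exists (U : I) xi : C0 (biss U) xi -> exists a : A U, sec a = xi.
Proof. by move=> xiC; exists (mkC0 hD (U : S) xi); exact: sec_mkC0. Qed.

Lemma sec_proj (U : I) (a : A U) g : line_proj (sec a g) = g.
Proof. exact: C0_proj (secP a). Qed.

Lemma sec_out (U : I) (a : A U) g : ~ biss U g -> sec a g = lz g.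
Proof. exact: C0_out (secP a). Qed.

Lemma sec_zero (U : I) : sec (fzero A U) = lz. Proof. by []. Qed.

Lemma sec_add (U : I) (a b : A U) :
  sec (fadd a b) = fun g => line_add (sec a g) (sec b g).
Proof. by apply: sec_mkC0; apply: C0_add; [exact: bissP|exact: secP|exact: secP]. Qed.

Lemma sec_scale (U : I) l (a : A U) :
  sec (fscale l a) = fun g => line_scale l (sec a g).
Proof. by apply: sec_mkC0; apply: C0_scale; [exact: bissP|exact: secP]. Qed.

Lemma sec_mult (U V : I) (a : A U) (b : A V) :
  sec (fmul a b) = sec_mul hD (biss U) (biss V) (sec a) (sec b).
Proof.
by apply: sec_mkC0; apply: C0_mul; [exact: bissP|exact: bissP|exact: (bissP (U ** V))|exact: secP|exact: secP].
Qed.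

Lemma sec_star (U : I) (a : A U) :
  sec (fstar a) = fun g => line_star (sec a (ginv g)).
Proof.
by apply: sec_mkC0; apply: C0_star; [exact: bissP|exact: secP|exact: (bissP U^!)].
Qed.

Lemma ile_biss (U V : I) : ile U V -> biss U `<=` biss V.
Proof.
move=> /(congr1 biss); rewrite !biss_mul biss_star => UE g.
rewrite {1}UE => -[_ [u1 [[v [_ [Vv [u Uu <-] + ->]]] Uu1 + ->]]].
rewrite (grngV hG) => vu; rewrite (gdomM hG) ?(grngV hG) // (gdomV hG) => uu1.
rewrite (bissection_rngI (bissP U) Uu Uu1 uu1) in vu *.
by rewrite -(gmulA hG) ?(grngV hG) ?(gdomV hG) // (gmulVl hG) -vu (gmul_dom hG).
Qed.

Lemma sec_incl (U V : I) (h : ile U V) (a : A U) : sec (fincl h a) = sec a.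
Proof.
apply: sec_mkC0; apply: C0_incl (secP a); [exact: bissP|exact: bissP|exact: ile_biss].
Qed.

Lemma sec_inj (U : I) (a b : A U) : sec a = sec b -> a = b.
Proof. exact: val_inj. Qed.

(** Elements of the total space are determined by their bissection and their
    section, which frees the computations from casts between fibres. *)
Lemma dlt_eq (U V : I) (a : A U) (b : A V) : biss U = biss V -> sec a = sec b ->
  dlt a = dlt b.
Proof.
move=> /biss_inj UV; move: b; rewrite -UV => b /sec_inj ->.
by [].
Qed.

Lemma dlt_sec (U V : I) (a : A U) (b : A V) : dlt a = dlt b -> U = V /\ sec a = sec b.
Proof.
move=> h; have : (projT1 (dlt a), sec (projT2 (dlt a))) = (projT1 (dlt b), sec (projT2 (dlt b))).
  by rewrite h.
by case.
Qed.

Lemma idem_units (U : I) : Defs.idempotent U <-> biss U `<=` gunits G.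
Proof.
split=> [UU g Ug|Uu].
  have := Ug; have := congr1 biss UU; rewrite biss_mul => {1}<-.
  move=> [g1 [g2 [Ug1 Ug2 g12 E]]].
  have g1g : g1 = g by apply: (bissection_rngI (bissP U)) => //; rewrite E (grngM hG).
  have g2g : g2 = g by apply: (bissection_domI (bissP U)) => //; rewrite E (gdomM hG).
  rewrite g1g g2g in g12 E.
  have : gmul (gmul g g) (ginv g) = gmul g (ginv g) by rewrite -E.
  rewrite -(gmulA hG) ?(grngV hG) // (gmulV hG) -g12 (gmul_dom hG) => gE.
  by rewrite /gunits /= [in RHS]gE.
apply: biss_inj; rewrite biss_mul; apply/seteqP; split=> g.
  move=> [g1 [g2 [Ug1 Ug2 g12 ->]]].
  have -> : g2 = g1.
    by rewrite -(gunits_grng eG (Uu _ Ug2)) -g12 (Uu _ Ug1).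
  by rewrite -{2}(Uu _ Ug1) (gmul_dom hG).
move=> Ug; exists g, g; split => //; first by rewrite (Uu _ Ug) (gunits_grng eG (Uu _ Ug)).
by rewrite -{3}(Uu _ Ug) (gmul_dom hG).
Qed.

(** * Coefficients of sections *)

Definition cf (U : I) (a : A U) (g : G) : C := coord (sec a g).

Lemma cf_out (U : I) (a : A U) g : ~ biss U g -> cf a g = 0.
Proof. by move=> nU; rewrite /cf sec_out // coord_zero. Qed.

Lemma cf_in (U : I) (a : A U) g : cf a g != 0 -> biss U g.
Proof. by move=> a0; apply/not_notP => /(cf_out a) E; rewrite E eqxx in a0. Qed.

Lemma cf_inj (U : I) (a b : A U) : cf a =1 cf b -> a = b.
Proof.
move=> ab; apply: sec_inj; apply/funext => g; apply: coord_inj.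
  by rewrite !sec_proj.
exact: ab.
Qed.

Lemma cf_zero (U : I) g : cf (fzero A U) g = 0.
Proof. by rewrite /cf sec_zero coord_zero. Qed.

Lemma cf_add (U : I) (a b : A U) g : cf (fadd a b) g = cf a g + cf b g.
Proof. by rewrite /cf sec_add coord_add // !sec_proj. Qed.

Lemma cf_scale (U : I) l (a : A U) g : cf (fscale l a) g = l * cf a g.
Proof. by rewrite /cf sec_scale coord_scale. Qed.

Lemma cf_sub (U : I) (a b : A U) g : cf (fsub a b) g = cf a g - cf b g.
Proof. by rewrite /fsub cf_add cf_scale mulN1r. Qed.

Lemma cf_incl (U V : I) (h : ile U V) (a : A U) g : cf (fincl h a) g = cf a g.
Proof. by rewrite /cf sec_incl. Qed.

Lemma cf_mul (U V : I) (a : A U) (b : A V) g1 g2 : biss U g1 -> biss V g2 ->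
  gdom g1 = grng g2 ->
  cf (fmul a b) (gmul g1 g2) = cocycle g1 g2 * (cf a g1 * cf b g2).
Proof.
move=> Ug Vg g12; rewrite /cf sec_mult (sec_mulE (bissP U) (bissP V)) //.
by rewrite coord_mul !sec_proj.
Qed.

Lemma cf_mul_out (U V : I) (a : A U) (b : A V) g : ~ bmul (biss U) (biss V) g ->
  cf (fmul a b) g = 0.
Proof. by move=> nUV; rewrite cf_out. Qed.

Lemma cf_bounded (U : I) (a : A U) : exists2 M : R, 0 <= M & forall g, nc (cf a g) <= M.
Proof.
have [M M0 aM] := C0_bounded (bissP U) (secP a); exists M => // g.
by rewrite /cf -line_norm_coord.
Qed.

Lemma cf_through (U : I) g (l : C) (W : set G) : biss U g -> nbhs g W ->
  exists a : A U, cf a g = l /\ forall h, ~ W h -> cf a h = 0.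
Proof.
move=> Ug nW.
pose v : L := \pi_(line D) (l, lift g).
have vg : line_proj v = g by rewrite (line_projE hD) lift_pi.
have vU : biss U (line_proj v) by rewrite vg.
have vW : nbhs (line_proj v) W by rewrite vg.
have [xi [xiC xiv xiW]] := C0_through (bissP U) vU vW.
have [a aE] := sec_exists xiC; exists a; split.
  by rewrite /cf aE -{1}vg xiv coordE.
by move=> h nWh; rewrite /cf aE xiW // coord_zero.
Qed.

Lemma sec_through (U : I) (v : L) : biss U (line_proj v) ->
  exists a : A U, sec a (line_proj v) = v.
Proof.
move=> Ug; have [xi [xiC xiv _]] := C0_through (bissP U) Ug (filterT : nbhs _ setT).
by have [a aE] := sec_exists xiC; exists a; rewrite aE.
Qed.

Definition unitset (U : I) := biss U `<=` gunits G.

Lemma bmul_unitsr (U V : set G) : V `<=` gunits G ->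
  bmul U V = [set g | U g /\ V (gdom g)].
Proof.
move=> Vu; apply/seteqP; split => g.
  move=> [g1 [g2 [Ug Vg g12 ->]]].
  have <- : gdom g1 = g2 by rewrite g12 (gunits_grng eG) //; exact: Vu.
  by rewrite (gmul_dom hG); split => //; rewrite g12 (gunits_grng eG) //; exact: Vu.
move=> [Ug Vg]; exists g, (gdom g); split => //; first by rewrite (grng_dom hG).
by rewrite (gmul_dom hG).
Qed.

Lemma bmul_unitsl (U V : set G) : U `<=` gunits G ->
  bmul U V = [set g | U (grng g) /\ V g].
Proof.
move=> Uu; apply/seteqP; split => g.
  move=> [g1 [g2 [Ug Vg g12 ->]]].
  have <- : grng g2 = g1 by rewrite -g12; exact: Uu.
  by rewrite (gmul_rng hG); split => //; rewrite -g12 (Uu _ Ug).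
move=> [Ug Vg]; exists (grng g), g; split => //; first by rewrite (gdom_rng hG).
by rewrite (gmul_rng hG).
Qed.

Lemma binv_units (U : set G) : U `<=` gunits G -> binv U = U.
Proof.
move=> Uu; apply/seteqP; split => g.
  by move=> [h Uh <-]; rewrite (gunits_ginv eG) //; exact: Uu.
by move=> Ug; exists g => //; rewrite (gunits_ginv eG) //; exact: Uu.
Qed.

Lemma bmul_units (U V : set G) : U `<=` gunits G -> V `<=` gunits G ->
  bmul U V = U `&` V.
Proof.
move=> Uu Vu; rewrite bmul_unitsr //; apply/seteqP; split => g [Ug].
  by rewrite (Uu _ Ug).
by move=> Vg; split => //; rewrite (Uu _ Ug).
Qed.

Lemma unitsetP (e : Eisg I) : unitset (sval e).
Proof. by apply/idem_units; exact: svalP. Qed.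

Lemma ile_units (U V : I) : unitset U -> unitset V -> biss U `<=` biss V -> ile U V.
Proof.
move=> Uu Vu UV; apply: biss_inj; rewrite !biss_mul biss_star (binv_units Uu).
rewrite (bmul_units Vu Uu) bmul_units //; last by move=> g [_ /Uu].
by apply/seteqP; split => [g Ug|g [[]]//]; split => //; split => //; exact: UV.
Qed.

Lemma ileE_units (e f : Eisg I) : biss (sval e) `<=` biss (sval f) -> ile e f.
Proof. by move=> ef; apply: E_inj; apply: ile_units => //; exact: unitsetP. Qed.

Lemma cf_mul_unitr (U V : I) (a : A U) (b : A V) g : unitset V ->
  cf (fmul a b) g = cf a g * cf b (gdom g).
Proof.
move=> Vu; have [Ug|nUg] := pselect (biss U g); last first.
  by rewrite (cf_out a) // mul0r cf_mul_out // bmul_unitsr // => -[].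
have [Vg|nVg] := pselect (biss V (gdom g)); last first.
  by rewrite (cf_out b) // mulr0 cf_mul_out // bmul_unitsr // => -[].
rewrite -{1}(gmul_dom hG g) /cf sec_mult (sec_mulE (bissP U) (bissP V)) ?(grng_dom hG) //.
by rewrite coord_mul_unitr ?sec_proj // /gunits /= (gdom_dom hG).
Qed.

Lemma cf_mul_unitl (U V : I) (a : A U) (b : A V) g : unitset U ->
  cf (fmul a b) g = cf a (grng g) * cf b g.
Proof.
move=> Uu; have [Vg|nVg] := pselect (biss V g); last first.
  by rewrite (cf_out b) // mulr0 cf_mul_out // bmul_unitsl // => -[].
have [Ug|nUg] := pselect (biss U (grng g)); last first.
  by rewrite (cf_out a) // mul0r cf_mul_out // bmul_unitsl // => -[].
rewrite -{1}(gmul_rng hG g) /cf sec_mult (sec_mulE (bissP U) (bissP V)) ?(gdom_rng hG) //.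
by rewrite coord_mul_unitl ?sec_proj // /gunits /= (gdom_rng hG).
Qed.

Lemma cf_mul_units (U V : I) (a : A U) (b : A V) g : unitset U -> unitset V ->
  cf (fmul a b) g = cf a g * cf b g.
Proof.
move=> Uu Vu; rewrite cf_mul_unitr //; have [Ug|nUg] := pselect (biss U g).
  by rewrite (Uu _ Ug).
by rewrite (cf_out a) // !mul0r.
Qed.

Lemma cf_star_units (U : I) (a : A U) g : unitset U -> cf (fstar a) g = (cf a g)^*.
Proof.
move=> Uu; have [Ug|nUg] := pselect (biss U g); last first.
  by rewrite (cf_out a) // conjc0 cf_out // biss_star binv_units.
rewrite /cf sec_star (gunits_ginv eG) ?coord_star_unit ?sec_proj //; exact: Uu.
Qed.

Lemma cf_star_mul (U V : I) (a : A U) (b : A V) g : biss U g -> biss V g ->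
  cf (fmul (fstar a) b) (gdom g) = (cf a g)^* * cf b g.
Proof.
move=> Ug Vg; have gV : gdom (ginv g) = grng g by rewrite (gdomV hG).
have UVg : biss U^! (ginv g) by exists g.
rewrite -(gmulVl hG) /cf sec_mult (sec_mulE (bissP _) (bissP V)) //.
by rewrite sec_star (ginvK hG) coord_star_mul // !sec_proj.
Qed.

Lemma cf_star_mul_out (U V : I) (a : A U) (b : A V) x : gunits G x ->
  (forall g, biss U g -> biss V g -> gdom g = x -> False) ->
  cf (fmul (fstar a) b) x = 0.
Proof.
move=> xu UV; apply: cf_mul_out => -[_ [g2 [[g Ug <-] Vg + xE]]].
rewrite (gdomV hG) => gg2.
have : gmul g x = g2 by rewrite xE (gmulA hG) ?(gdomV hG) ?(grngV hG) // (gmulV hG) gg2 (gmul_rng hG).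
have gx : gdom g = x.
  have := congr1 (@grng G) xE; rewrite (grngM hG) ?(gdomV hG) // (grngV hG).
  by rewrite (gunits_grng eG xu).
by rewrite -gx (gmul_dom hG) => E; apply: (UV g) => //; rewrite E.
Qed.

(** Conjugation by a moves b(r(g)) to d(g), with the factor |a(g)|^2: the phase of a
    cancels. *)
Lemma cf_conj (U V : I) (a : A U) (b : A V) g : unitset V -> biss U g ->
  cf (fmul (fmul (fstar a) b) a) (gdom g) = ((nc (cf a g)) ^+ 2)%:C * cf b (grng g).
Proof.
move=> Vu Ug.
have UVg : biss U^! (ginv g) by exists g.
have [Vg|nVg] := pselect (biss V (grng g)); last first.
  rewrite (cf_out b) // mulr0 cf_mul_out // -[biss (_ ** _)]/(bmul (biss U^!) (biss V)).
  rewrite (bmul_unitsr _ Vu) => -[g1 [g2 [[Ug1 Vg1] Ug2 g12 E]]].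
  have g2g : g2 = g.
    by apply: (bissection_domI (bissP U)) => //; rewrite -[RHS](gdom_dom hG) E (gdomM hG).
  by apply: nVg; rewrite -g2g -g12.
have gV : gdom (ginv g) = grng (grng g) by rewrite (gdomV hG) (grng_rng hG).
have UVV : biss (U^! ** V) (ginv g).
  by rewrite biss_mul bmul_unitsr //; split => //; rewrite (gdomV hG).
rewrite -(gmulVl hG) /cf sec_mult (sec_mulE (bissP _) (bissP U)) ?(gdomV hG) //.
have -> : sec (fmul (fstar a) b) (ginv g) = line_mul (line_star (sec a g)) (sec b (grng g)).
  rewrite sec_mult -[X in sec_mul _ _ _ _ _ X](gmul_dom hG) (gdomV hG).
  by rewrite (sec_mulE (bissP _) (bissP V)) // sec_star (ginvK hG).
by rewrite coord_conj ?sec_proj // mulrAC mulJ_nc.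
Qed.

Lemma cf_conj_out (U V : I) (a : A U) (b : A V) x : unitset V -> gunits G x ->
  (forall g, biss U g -> gdom g = x -> False) ->
  cf (fmul (fmul (fstar a) b) a) x = 0.
Proof.
move=> Vu xu nU; apply: cf_mul_out => -[g1 [g2 [_ Ug g12 E]]].
by apply: (nU g2) => //; rewrite -(gdomM hG g12) -E.
Qed.

Lemma gunits_bissection : bissection (gunits G).
Proof.
have hom (f : G -> G) : (forall x, gunits G x -> f x = x) -> homeo_on (gunits G) f.
  move=> fE; have fim (O : set G) : f @` (gunits G `&` O) = gunits G `&` O.
    apply/seteqP; split => [_ [y [yu Oy] <-]|y [yu Oy]]; first by rewrite fE.
    by exists y => //; exact: fE.
  split.
  - apply/subspace_continuousP => x xu W; have {}xE := fE x xu => nW0.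
    have nW : nbhs x W by rewrite -xE; exact: nW0.
    change (nbhs x [set y | gunits G y -> W (f y)]).
    by apply: filterS nW => y Wy yu; rewrite fE.
  - by move=> x y /set_mem/fE + /set_mem/fE => -> ->.
  - by move=> V oV; exists V => //; rewrite fim -{2}[gunits G]setIT fim setIT.
split; first exact: gunits_open.
  exact: hom.
by apply: hom => x; exact: gunits_grng.
Qed.

(** A section supported in the units is a section over the bissection of all units,
    hence it is continuous at every unit. *)
Lemma cf_continuous (U : I) (a : A U) x : unitset U -> gunits G x -> {for x, continuous (cf a)}.
Proof.
move=> Uu xu; apply: coord_continuous => //; first by move=> g; rewrite sec_proj.
have aC : C0 (gunits G) (sec a).
  exact: (C0_incl (bissP U) gunits_bissection Uu (secP a)).
exact: (C0_continuous gunits_bissection aC xu).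
Qed.

(** * Formal sums over the units *)

Definition cfE (e : Eisg I) (a : E e) : G -> C := @cf (sval e) a.

Lemma dltE_eq (e f : Eisg I) (a : E e) (b : E f) : biss (sval e) = biss (sval f) ->
  cfE a =1 cfE b -> dlt a = dlt b.
Proof.
move=> /biss_inj/E_inj ef; move: a b; rewrite -ef => a b ab.
by rewrite (cf_inj ab).
Qed.

Lemma cfE_zero (e : Eisg I) g : cfE (fzero E e) g = 0.
Proof. exact: (@cf_zero (sval e)). Qed.

Lemma cfE_add (e : Eisg I) (a b : E e) g : cfE (fadd a b) g = cfE a g + cfE b g.
Proof. exact: (@cf_add (sval e)). Qed.

Lemma cfE_incl (e f : Eisg I) (h : ile e f) (a : E e) g : cfE (fincl h a) g = cfE a g.
Proof. exact: (@cf_incl (sval e) (sval f) (ile_val h)). Qed.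

Lemma cfE_mul (e f : Eisg I) (a : E e) (b : E f) g : cfE (fmul a b) g = cfE a g * cfE b g.
Proof. by apply: (@cf_mul_units (sval e) (sval f)); exact: unitsetP. Qed.

Lemma cfE_star (e : Eisg I) (a : E e) g : cfE (fstar a) g = (cfE a g)^*.
Proof. by apply: (@cf_star_units (sval e)); exact: unitsetP. Qed.

Definition ev (u : fsum A) (g : G) : C := \sum_(p <- u) cf (projT2 p) g.
Definition evE (u : fsum E) (g : G) : C := \sum_(p <- u) cfE (projT2 p) g.

Lemma ev_incl (u : fsum E) g : ev (fs_incl u) g = evE u g.
Proof. by rewrite /ev /fs_incl big_map. Qed.

Lemma ev_cat u v g : ev (u ++ v) g = ev u g + ev v g.
Proof. exact: big_cat. Qed.

Lemma ev_scale l u g : ev (fs_scale l u) g = l * ev u g.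
Proof.
rewrite /ev big_map mulr_sumr; apply: eq_bigr => p _ /=; exact: cf_scale.
Qed.

Lemma ev_fs_eq u v : fs_eq u v -> ev u = ev v.
Proof.
move=> uv; apply/funext => g; elim: uv => {u v}.
- by [].
- by move=> u v _ ->.
- by move=> u v w _ -> _ ->.
- by move=> u u' v v' _ uE _ vE; rewrite !ev_cat uE vE.
- by move=> u v; rewrite !ev_cat addrC.
- by move=> U; rewrite /ev big_seq1 big_nil /=; exact: cf_zero.
- by move=> U a b; rewrite /ev big_cons !big_seq1 /= cf_add.
- by move=> U V UV a; rewrite /ev !big_seq1 /= cf_incl.
Qed.

Lemma fs_incl_mul (u v : fsum E) : fs_incl (fs_mul u v) = fs_mul (fs_incl u) (fs_incl v).
Proof.
rewrite /fs_incl /fs_mul; elim: u => //= p u IH; rewrite map_cat IH; congr (_ ++ _).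
by rewrite -!map_comp.
Qed.

Lemma fs_incl_star (u : fsum E) : fs_incl (fs_star u) = fs_star (fs_incl u).
Proof. by rewrite /fs_incl /fs_star -!map_comp. Qed.

Lemma fs_incl_scale l (u : fsum E) : fs_incl (fs_scale l u) = fs_scale l (fs_incl u).
Proof. by rewrite /fs_incl /fs_scale -!map_comp. Qed.

Lemma fs_incl_cat (u v : fsum E) : fs_incl (u ++ v) = fs_incl u ++ fs_incl v.
Proof. exact: map_cat. Qed.

Lemma fs_incl_eq (u v : fsum E) : fs_eq u v -> fs_eq (fs_incl u) (fs_incl v).
Proof.
elim=> {u v}; rewrite /= ?fs_incl_cat.
- by move=> u; exact: fs_eq_refl.
- by move=> u v _; exact: fs_eq_sym.
- by move=> u v w _ + _; exact: fs_eq_trans.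
- by move=> u u' v v' _ + _; rewrite !fs_incl_cat; exact: fs_eq_cat.
- by move=> u v; rewrite !fs_incl_cat; exact: fs_eq_catC.
- by move=> e; exact: fs_eq_zero.
- by move=> e a b; exact: fs_eq_add.
- by move=> e f ef a; exact: (@fs_eq_incl R _ A (sval e) (sval f) (ile_val ef) a).
Qed.

Lemma evE_cat u v g : evE (u ++ v) g = evE u g + evE v g.
Proof. exact: big_cat. Qed.

Lemma evE_scale l u g : evE (fs_scale l u) g = l * evE u g.
Proof. by rewrite -!ev_incl fs_incl_scale ev_scale. Qed.

Lemma evE_fs_eq u v : fs_eq u v -> evE u = evE v.
Proof.
by move=> /fs_incl_eq/ev_fs_eq uv; apply/funext => g; rewrite -!ev_incl uv.
Qed.

Lemma evE_mul u v g : evE (fs_mul u v) g = evE u g * evE v g.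
Proof.
elim: u => [|p u IH]; first by rewrite /evE !big_nil mul0r.
rewrite (fs_mul_catl [:: p] u v) evE_cat IH (evE_cat [:: p] u) mulrDl; congr (_ + _).
rewrite /evE /fs_mul /= cats0 big_map big_seq1 mulr_sumr; apply: eq_bigr => r _.
exact: cfE_mul.
Qed.

Lemma evE_star u g : evE (fs_star u) g = (evE u g)^*.
Proof.
rewrite /evE big_map rmorph_sum; apply: eq_bigr => p _ /=.
exact: cfE_star.
Qed.

(** Functions on the unit space by which sections can be multiplied *)
Definition multiplier (phi : G -> C) :=
  (forall x, gunits G x -> {for x, continuous phi}) /\
  exists M : R, forall x, gunits G x -> nc (phi x) <= M.

Lemma multiplier_cst l : multiplier (fun=> l).
Proof. by split => [x _|]; [exact: cst_continuous|exists (nc l)]. Qed.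

Lemma multiplierM phi psi : multiplier phi -> multiplier psi ->
  multiplier (fun g => phi g * psi g).
Proof.
move=> [phic [M phiM]] [psic [M' psiM]]; split=> [x xu|].
  by apply: (@continuousM _ _ phi psi); [exact: phic|exact: psic].
exists (M * M') => x xu; rewrite ncM; apply: ler_pM; rewrite ?nc_ge0 //.
  exact: phiM.
exact: psiM.
Qed.

Lemma multiplierD phi psi : multiplier phi -> multiplier psi ->
  multiplier (fun g => phi g + psi g).
Proof.
move=> [phic [M phiM]] [psic [M' psiM]]; split=> [x xu|].
  by apply: (@continuousD _ C^o _ phi psi); [exact: phic|exact: psic].
exists (M + M') => x xu; apply: le_trans (ncD _ _) _; apply: lerD; [exact: phiM|exact: psiM].
Qed.

Lemma multiplierJ phi : multiplier phi -> multiplier (fun g => (phi g)^*).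
Proof.
move=> [phic [M phiM]]; split=> [x xu|]; last by exists M => x xu; rewrite ncJ; exact: phiM.
apply/cvg_CP => e e0; have /cvg_CP/(_ e e0) := phic x xu.
by apply: filterS => y; rewrite -rmorphB ncJ.
Qed.

Lemma multiplier_real (f : G -> R) (M : R) : (forall x, gunits G x -> {for x, continuous f}) ->
  (forall x, gunits G x -> `|f x| <= M) -> multiplier (fun g => (f g)%:C).
Proof.
move=> fc fM; split=> [x xu|]; last by exists M => x xu; rewrite ncC; exact: fM.
apply/cvg_CP => e e0; have /cvg_RP/(_ e e0) := fc x xu.
by apply: filterS => y; rewrite -rmorphB ncC.
Qed.

Lemma multiplier_cfE (e : Eisg I) (a : E e) : multiplier (cfE a).
Proof.
split=> [x xu|]; first by apply: cf_continuous => //; exact: unitsetP.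
by have [M _ aM] := @cf_bounded (sval e) a; exists M => x _; exact: aM.
Qed.

Lemma multiplier_evE u : multiplier (evE u).
Proof.
elim: u => [|p u IH].
  rewrite (_ : evE [::] = fun=> 0); first exact: multiplier_cst.
  by apply/funext => g; rewrite /evE big_nil.
rewrite (_ : evE (p :: u) = fun g => cfE (projT2 p) g + evE u g).
  by apply: multiplierD => //; exact: multiplier_cfE.
by apply/funext => g; rewrite /evE big_cons.
Qed.

Definition smulf (phi : G -> C) (e : Eisg I) (a : E e) : E e :=
  mkC0 hD (sval e : S) (fun g => line_scale (phi g) (@sec (sval e) a g)).

Lemma cfE_smulf phi e (a : E e) g : multiplier phi -> cfE (smulf phi a) g = phi g * cfE a g.
Proof.
move=> [phic [M phiM]]; rewrite /cfE /cf /smulf.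
have -> : sec (mkC0 hD (sval e : S) (fun g => line_scale (phi g) (@sec (sval e) a g)) : A (sval e)) =
    fun g => line_scale (phi g) (@sec (sval e) a g).
  apply: sec_mkC0; apply: (C0_scal (bissP (sval e)) (M := M)).
  - exact: secP.
  - by move=> x /unitsetP; exact: phic.
  - by move=> x /unitsetP; exact: phiM.
by rewrite coord_scale.
Qed.

Definition smul phi (u : fsum E) : fsum E := [seq dlt (smulf phi (projT2 p)) | p <- u].

Lemma evE_smul phi u g : multiplier phi -> evE (smul phi u) g = phi g * evE u g.
Proof.
move=> mphi; rewrite /evE big_map mulr_sumr; apply: eq_bigr => p _.
exact: cfE_smulf.
Qed.

Lemma smulA phi psi u : multiplier phi -> multiplier psi ->
  smul phi (smul psi u) = smul (fun g => phi g * psi g) u.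
Proof.
move=> mphi mpsi; rewrite /smul -map_comp; apply: eq_map => p /=.
apply: dltE_eq => [//|g]; rewrite !cfE_smulf //; last exact: multiplierM.
by rewrite mulrA.
Qed.

Lemma smul_cst l u : smul (fun=> l) u = fs_scale l u.
Proof.
by apply: eq_map => p; apply: dltE_eq.
Qed.

Lemma smulD phi psi u : multiplier phi -> multiplier psi ->
  fs_eq (smul phi u ++ smul psi u) (smul (fun g => phi g + psi g) u).
Proof.
move=> mphi mpsi; elim: u => [|p u IH]; first exact: fs_eq_refl.
apply: (fs_eq_trans (fs_eq_ACA [:: _] _ [:: _] _)).
apply: (@fs_eq_cat _ _ _ _ [:: _] _ _ _ IH).
apply: (fs_eq_trans (fs_eq_add _ _)).
rewrite (_ : dlt _ = dlt (smulf (fun g => phi g + psi g) (projT2 p))); first exact: fs_eq_refl.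
apply: dltE_eq => [//|g]; rewrite cfE_smulf; last exact: multiplierD.
by rewrite cfE_add !cfE_smulf // mulrDl.
Qed.

(** The product of formal sums over the units is the multiplication by a
    function: the product of a in A_e and b in A_f lies in A_(ef), which is
    included in A_f, and the inclusions are identified. *)
Lemma fs_mul_smul v u : fs_eq (fs_mul v u) (smul (evE v) u).
Proof.
elim: u => [|r u IH].
  by rewrite (_ : fs_mul v [::] = [::]); [exact: fs_eq_refl|elim: v].
apply: (fs_eq_trans (fs_mul_catr v [:: r] u)).
apply: (@fs_eq_cat _ _ _ _ [:: _] _ _ _ IH).
elim: v {IH} => [|p v IH].
  rewrite (_ : dlt _ = dlt (fzero E (projT1 r))); first exact/fs_eq_sym/fs_eq_zero.
  apply: dltE_eq => [//|g]; rewrite cfE_smulf; last exact: multiplier_evE.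
  by rewrite /evE big_nil mul0r cfE_zero.
rewrite (fs_mul_catl [:: p] v).
apply: (@fs_eq_trans _ _ _ _ [:: dlt (smulf (cfE (projT2 p)) (projT2 r)); dlt (smulf (evE v) (projT2 r))]).
  apply: (@fs_eq_cat _ _ _ _ [:: _] _ [:: _] _ IH).
  have ile_r : ile (projT1 p ** projT1 r) (projT1 r).
    apply: ileE_units => x; rewrite biss_mul bmul_unitsl; last exact: unitsetP.
    by case.
  apply: (fs_eq_trans (fs_eq_incl ile_r _)).
  rewrite (_ : dlt _ = dlt (smulf (cfE (projT2 p)) (projT2 r))); first exact: fs_eq_refl.
  apply: dltE_eq => [//|g]; rewrite cfE_smulf; last exact: multiplier_cfE.
  by rewrite cfE_incl cfE_mul.
apply: (fs_eq_trans (fs_eq_add _ _)).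
rewrite (_ : dlt _ = dlt (smulf (evE (p :: v)) (projT2 r))); first exact: fs_eq_refl.
apply: dltE_eq => [//|g]; rewrite cfE_smulf; last exact: multiplier_evE.
rewrite cfE_add !cfE_smulf; [|exact: multiplier_evE|exact: multiplier_cfE].
by rewrite -mulrDl /evE big_cons.
Qed.

(** * Seminorms and the sup norm *)

Lemma evE_out (u : fsum E) g : ~ gunits G g -> evE u g = 0.
Proof.
move=> nu; rewrite /evE big1 // => -[e a] _; apply: cf_out => /unitsetP.
by move=> gu; exact: nu.
Qed.

Section Bound.
Variable p : fsum E -> R.
Hypothesis pP : cstar_seminorm p.

Lemma csnE_smul (w : G -> C) (u : fsum E) : multiplier w ->
  p (smul w u) ^+ 2 = p (smul (fun g => (w g * evE u g)^* * w g) u).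
Proof.
move=> mw; rewrite -(csn_cstar pP) (csn_eq pP (fs_mul_smul _ _)) smulA //; last exact: multiplier_evE.
congr (p (smul _ u)); apply/funext => g.
by rewrite evE_star evE_smul.
Qed.

(** A C*-seminorm is at most the sup norm. Let f be the function of u, g its conjugate,
    H = |f|^2 and P = p(g u) = p(u)^2. Then P^2 = p(H g u). The functions
    w = g (H + i K) and w = g (H - i K), where H^2 + K^2 = 1, have the same modulus as
    f, whence p(w u) = P for both of them; their sum is 2 H g, so that 2 P^2 <= 2 P. *)
Lemma csnE_le1 (u : fsum E) : (forall g, nc (evE u g) <= 1) -> p u <= 1.
Proof.
move=> u1; pose f := evE u; pose fJ g := (f g)^*.
pose H g : R := nc (f g) ^+ 2; pose K g : R := Num.sqrt (1 - H g ^+ 2).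
have mf : multiplier f by exact: multiplier_evE.
have mfJ : multiplier fJ by exact: multiplierJ.
have HE g : fJ g * f g = (H g)%:C by exact: mulJ_nc.
have H01 g : 0 <= H g <= 1.
  by rewrite sqr_ge0 /= expr_le1 // ?nc_ge0 //; exact: u1.
have Hc x : gunits G x -> {for x, continuous H}.
  move=> xu; have fc := mf.1 x xu.
  have hc : {for x, continuous (fun g => nc (f g))}.
    by apply: (@continuous_comp _ _ _ f); [exact: fc|exact: nc_continuous].
  exact: (@continuousM _ _ _ _ _ hc hc).
have HK g : H g ^+ 2 + K g ^+ 2 = 1.
  rewrite sqr_sqrtr; first by rewrite addrC subrK.
  rewrite subr_ge0.
  by have /andP[H0 H1] := H01 g; rewrite expr_le1.
have K01 g : 0 <= K g <= 1.
  rewrite sqrtr_ge0 /= -(@expr_le1 _ 2) ?sqrtr_ge0 //.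
  by have := HK g; have := sqr_ge0 (H g); lra.
have Kc x : gunits G x -> {for x, continuous K}.
  move=> xu; apply: (@continuous_comp _ _ _ (fun g => 1 - H g ^+ 2)); last exact: sqrt_continuous.
  apply: (@continuousB _ R^o _ (fun=> 1) (fun g => H g ^+ 2)); first exact: cst_continuous.
  exact: (@continuousM _ _ _ _ _ (Hc x xu) (Hc x xu)).
have mH : multiplier (fun g => (H g)%:C).
  by apply: (@multiplier_real _ 1) => // x _; have := H01 x => /andP[? ?]; rewrite ger0_norm.
have mK : multiplier (fun g => (K g)%:C).
  by apply: (@multiplier_real _ 1) => // x _; have := K01 x => /andP[? ?]; rewrite ger0_norm.
have mJ (s : C) : multiplier (fun g => fJ g * ((H g)%:C + s * (K g)%:C)).
  apply: multiplierM => //; apply: multiplierD => //.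
  by apply: multiplierM => //; exact: multiplier_cst.
pose P := p (smul fJ u).
have P0 : P = p u ^+ 2.
  rewrite -(csn_cstar pP) (csn_eq pP (fs_mul_smul _ _)); congr (p (smul _ u)).
  by apply/funext => g; rewrite evE_star.
have P1 : P ^+ 2 = p (smul (fun g => (H g)%:C * fJ g) u).
  rewrite /P csnE_smul //; congr (p (smul _ u)); apply/funext => g.
  by rewrite HE conjc_real.
have PW (s : C) : s^* = - s -> s * s = -1 ->
    p (smul (fun g => fJ g * ((H g)%:C + s * (K g)%:C)) u) <= P.
  move=> sJ ss; have Pge0 : 0 <= P by rewrite P0 sqr_ge0.
  rewrite -[leRHS]ger0_norm //; apply: le_trans (ler_norm _) _.
  rewrite -ler_sqr ?nnegrE ?normr_ge0 // !real_normK ?num_real //.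
  rewrite csnE_smul // P1 le_eqVlt; apply/orP; left; apply/eqP; congr (p (smul _ u)).
  apply/funext => g.
  have JM (x y : C) : (x * y)^* = x^* * y^* by exact: (rmorphM (@conjc R)).
  have JD (x y : C) : (x + y)^* = x^* + y^* by exact: (rmorphD (@conjc R)).
  rewrite mulrAC HE JM JD JM !conjc_real sJ.
  move: (H g) (K g) (HK g) (fJ g) => a b ab c.
  transitivity (a%:C * c * (a%:C ^+ 2 - s * s * b%:C ^+ 2)); first by ring.
  by rewrite ss mulN1r opprK -!rmorphXn -rmorphD /= ab mulr1.
have P2 : 2 * P ^+ 2 <= P + P.
  have -> : 2 * P ^+ 2 = p (smul (fun g => 2 * ((H g)%:C * fJ g)) u).
    have -> : smul (fun g => 2 * ((H g)%:C * fJ g)) u =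
        fs_scale 2 (smul (fun g => (H g)%:C * fJ g) u).
      by rewrite -smul_cst smulA //; [exact: multiplier_cst|exact: multiplierM].
    rewrite P1 (csnZ pP); congr (_ * _).
    by rewrite -[2 in RHS](rmorph_nat (real_complex R)) ncC normr_nat.
  have E2 : fs_eq (smul (fun g => fJ g * ((H g)%:C + 'i * (K g)%:C)) u ++
                  smul (fun g => fJ g * ((H g)%:C + (- 'i) * (K g)%:C)) u)
      (smul (fun g => 2 * ((H g)%:C * fJ g)) u).
    rewrite (_ : (fun g => 2 * _) = fun g => fJ g * ((H g)%:C + 'i * (K g)%:C) +
      fJ g * ((H g)%:C + (- 'i) * (K g)%:C)); first exact: smulD.
    by apply/funext => g; ring.
  rewrite -(csn_eq pP E2); apply: le_trans (csn_add pP _ _) _.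
  have iJ : 'i^* = - 'i :> C by apply/eqP; rewrite eq_complex /= oppr0 !eqxx.
  have ii : 'i * 'i = -1 :> C by rewrite -expr2 sqr_i.
  apply: lerD; first exact: PW iJ ii.
  by apply: PW; [rewrite -[in RHS]iJ; exact: (rmorphN (@conjc R))|rewrite mulrNN].
have P3 : P <= 1.
  rewrite leNgt; apply/negP => P1'; have : P < P ^+ 2 by rewrite expr2 ltr_pMr; lra.
  lra.
rewrite leNgt; apply/negP => pu1; move: P3; rewrite P0 leNgt => /negP; apply.
by rewrite expr_gt1 //; lra.
Qed.

Lemma csnE_le (u : fsum E) (M : R) : 0 <= M -> (forall g, nc (evE u g) <= M) -> p u <= M.
Proof.
move=> M0 uM; apply/ler_addgt0Pr => e e0.
have K0 : 0 < M + e by lra.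
have ncK : nc ((M + e)^-1)%:C = (M + e)^-1 by rewrite ncC ger0_norm // invr_ge0 ltW.
have : p (fs_scale ((M + e)^-1)%:C u) <= 1.
  apply: csnE_le1 => g; rewrite evE_scale ncM ncK mulrC ler_pdivrMr // mul1r.
  by apply: le_trans (uM g) _; lra.
by rewrite (csnZ pP) ncK mulrC ler_pdivrMr // mul1r.
Qed.

End Bound.

Lemma csn_incl (p : fsum A -> R) : cstar_seminorm p ->
  cstar_seminorm (fun u : fsum E => p (fs_incl u)).
Proof.
move=> pP; split=> [u v /fs_incl_eq/(csn_eq pP)//|u v|l u|u v|u].
- by rewrite fs_incl_cat; exact: (csn_add pP).
- by rewrite fs_incl_scale; exact: (csn_scale pP).
- by rewrite fs_incl_mul; exact: (csn_mul pP).
- by rewrite fs_incl_mul fs_incl_star; exact: (csn_cstar pP).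
Qed.

Lemma evE_csn x : cstar_seminorm (fun u : fsum E => nc (evE u x)).
Proof.
split=> [u v /evE_fs_eq -> //|u v|l u|u v|u].
- by rewrite evE_cat; exact: ncD.
- by rewrite evE_scale ncM.
- by rewrite evE_mul ncM.
- by rewrite evE_mul evE_star nc_mulJ.
Qed.

(** By the C*-identity the norm of a is controlled by that of the function of the
    element (star a) a, which lies over the units. *)
Lemma fnorm_bound (U : I) (a : A U) : exists2 M : R, 0 <= M &
  forall p : fsum A -> R, cstar_seminorm p -> p [:: dlt a] <= M.
Proof.
have [M M0 aM] := cf_bounded a; exists M => // p pP.
pose aa : E (src_idem U) := fmul (fstar a) a.
have h : p (fs_incl [:: dlt aa]) <= M ^+ 2.
  apply: (csnE_le (csn_incl pP)); first exact: sqr_ge0.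
  move=> x; rewrite /evE big_seq1 /= /cfE /=.
  have [xu|nxu] := pselect (gunits G x); last first.
    rewrite cf_out ?nc0 ?sqr_ge0 // => Ux; apply: nxu.
    exact: (@unitsetP (src_idem U) x Ux).
  have [[g [Ug gx]]|nU] := pselect (exists g, biss U g /\ gdom g = x).
    by rewrite -gx cf_star_mul // nc_mulJ ler_sqr ?nnegrE ?nc_ge0.
  rewrite cf_star_mul_out ?nc0 ?sqr_ge0 // => g Ug _ gx.
  by apply: nU; exists g.
have : p [:: dlt a] ^+ 2 <= M ^+ 2 by rewrite -(csn_cstar pP).
by rewrite leNgt => /negP h'; rewrite leNgt; apply/negP => pM; apply: h'; rewrite !expr2; nra.
Qed.

Lemma lawsA : star_laws A.
Proof.
split.
- move=> U a; apply: cf_inj => g.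
  by rewrite cf_add cf_scale cf_zero mulN1r subrr.
- by move=> U l m a; apply: cf_inj => g; rewrite !cf_scale mulrA.
- by move=> U a; apply: cf_inj => g; rewrite !cf_scale mul1r.
- move=> U V l a b; apply: cf_inj => g; rewrite cf_scale.
  have [[g1 [g2 [Ug Vg g12 ->]]]|nUV] := pselect (bmul (biss U) (biss V) g); last first.
    by rewrite !cf_mul_out // mulr0.
  by rewrite !cf_mul // cf_scale; ring.
- move=> U V l a b; apply: cf_inj => g; rewrite cf_scale.
  have [[g1 [g2 [Ug Vg g12 ->]]]|nUV] := pselect (bmul (biss U) (biss V) g); last first.
    by rewrite !cf_mul_out // mulr0.
  by rewrite !cf_mul // cf_scale; ring.
- move=> U a; apply: dlt_eq; first by rewrite !biss_star (binvK hG).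
  by apply/funext => g; rewrite !sec_star line_starK (ginvK hG).
- move=> U l a; apply: sec_inj; apply/funext => g.
  by rewrite sec_star !sec_scale sec_star line_starZ.
move=> u; elim: u => [|[U a] u [M uM]].
  by exists 0 => p pP; rewrite (csn_nil pP).
have [M' _ aM] := fnorm_bound a; exists (M' + M) => p pP.
apply: le_trans (csn_add pP [:: dlt a] u) _; apply: lerD; [exact: aM|exact: uM].
Qed.

Lemma lawsE : star_laws E.
Proof.
have [h1 h2 h3 h4 h5 h6 h7 _] := lawsA.
split.
- by move=> e a; exact: (h1 (sval e)).
- by move=> e l m a; exact: (h2 (sval e)).
- by move=> e a; exact: (h3 (sval e)).
- by move=> e f l a b; exact: (h4 (sval e) (sval f)).
- by move=> e f l a b; exact: (h5 (sval e) (sval f)).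
- move=> e a; have [UE aE] := dlt_sec (h6 (sval e) a).
  by apply: dltE_eq => [|g]; [rewrite -UE|rewrite /cfE /cf aE].
- by move=> e l a; exact: (h7 (sval e)).
move=> u.
have [M M0 uM] : exists2 M : R, 0 <= M & forall g, nc (evE u g) <= M.
  have [_ [M uM]] := multiplier_evE u; exists `|M| => // g.
  have [gu|ngu] := pselect (gunits G g); first exact: le_trans (uM g gu) (ler_norm _).
  by rewrite evE_out // nc0.
by exists M => p pP; exact: csnE_le.
Qed.

Lemma envE_le (u : fsum E) (M : R) : 0 <= M -> (forall g, nc (evE u g) <= M) -> env_norm u <= M.
Proof. by move=> M0 uM; apply: (csnE_le (env_norm_cstar lawsE)). Qed.

Lemma evE_le (u : fsum E) x : nc (evE u x) <= env_norm u.
Proof. exact: (env_norm_sup lawsE u (evE_csn x)). Qed.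

Lemma env_norm_incl (u : fsum E) : env_norm (fs_incl u) <= env_norm u.
Proof.
apply: (csnE_le (csn_incl (env_norm_cstar lawsA))); first exact: (env_norm_ge0 lawsE).
by move=> g; exact: evE_le.
Qed.

(** * The regular representation *)

Section RegularRepresentation.

Implicit Types u v w : fsum A.

Lemma dlt_mulA (U V W : I) (a : A U) (b : A V) (c : A W) :
  dlt (fmul a (fmul b c)) = dlt (fmul (fmul a b) c).
Proof.
apply: dlt_eq; first by rewrite !biss_mul (bmulA hG).
rewrite !sec_mult; apply: (sec_mulA (bissP U) (bissP V) (bissP W) (bissP (U ** V)) (bissP (V ** W))).
- by move=> g; rewrite sec_proj.
- by move=> g; rewrite sec_proj.
- by move=> g; rewrite sec_proj.
Qed.

Lemma ginvM (g h : G) : gdom g = grng h -> ginv (gmul g h) = gmul (ginv h) (ginv g).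
Proof.
move=> gh; have [s sg] := tw_pi_surj hD g; have [t th] := tw_pi_surj hD h.
have piV (r : tw_S D) : tw_pi (ginv r) = ginv (tw_pi r) by case: (tw_pi_hom hD).
have st : gdom s = grng t by apply/composable_pi; rewrite sg th.
rewrite -sg -th -(tw_piM hD) // -!piV -(tw_piM hD) ?(gdomV hSg) ?(grngV hSg) //.
by rewrite ginv_mul.
Qed.

Lemma dlt_starM (U V : I) (a : A U) (b : A V) :
  dlt (fstar (fmul a b)) = dlt (fmul (fstar b) (fstar a)).
Proof.
apply: dlt_eq.
  rewrite biss_star !biss_mul !biss_star; apply/seteqP; split.
    move=> _ [_ [g [h [Ug Vh gh ->]]] <-]; exists (ginv h), (ginv g); split.
    - by exists h.
    - by exists g.
    - by rewrite (gdomV hG) (grngV hG).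
    - exact: ginvM.
  move=> _ [_ [_ [[h Vh <-] [g Ug <-] + ->]]]; rewrite (gdomV hG) (grngV hG) => /esym gh.
  by exists (gmul g h); [exists g, h|exact: ginvM].
rewrite sec_star !sec_mult; apply/funext => k.
have [[g [h [Ug Vh gh kE]]]|nUV] := pselect (bmul (biss U) (biss V) (ginv k)); last first.
  rewrite sec_mul_out // line_star_zero (ginvK hG) sec_mul_out //.
  move=> [_ [_ [[h Vh <-] [g Ug <-] + kE]]]; rewrite (gdomV hG) (grngV hG) => /esym gh.
  by apply: nUV; exists g, h; split => //; rewrite kE -ginvM // (ginvK hG).
rewrite kE (sec_mulE (bissP U) (bissP V)) //.
have -> : k = gmul (ginv h) (ginv g) by rewrite -ginvM // -kE (ginvK hG).
rewrite (sec_mulE (bissP _) (bissP _)) ?(gdomV hG) ?(grngV hG) //; last 2 first.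
- by exists h.
- by exists g.
rewrite !sec_star !(ginvK hG).
have := sec_proj a g; have := sec_proj b h.
have [l [s ->]] := lineP (sec a g); have [m [t ->]] := lineP (sec b h).
rewrite !(line_projE hD) /= => th sg.
have st : gdom s = grng t by apply/composable_pi; rewrite sg th.
rewrite line_mulE // !line_starE line_mulE ?(gdomV hSg) ?(grngV hSg) //.
by rewrite ginv_mul // (rmorphM (@conjc R)) mulrC.
Qed.

Lemma ev_mul_sum u v g : ev (fs_mul u v) g =
  \sum_(p <- u) \sum_(r <- v) cf (fmul (projT2 p) (projT2 r)) g.
Proof.
elim: u => [|p u IH]; first by rewrite /ev !big_nil.
rewrite (fs_mul_catl [:: p] u v) ev_cat IH big_cons; congr (_ + _).
by rewrite /ev /fs_mul /= cats0 big_map.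
Qed.

Lemma fs_mulA u v w : fs_mul (fs_mul u v) w = fs_mul u (fs_mul v w).
Proof.
elim: u => // p u IH.
rewrite (fs_mul_catl [:: p] u v) fs_mul_catl IH (fs_mul_catl [:: p] u (fs_mul v w)).
congr (_ ++ _) => {u IH}.
elim: v => // r v IH.
have cons x : fs_mul [:: p] (r :: x) = dlt (fmul (projT2 p) (projT2 r)) :: fs_mul [:: p] x by [].
have catr x y : fs_mul [:: p] (x ++ y) = fs_mul [:: p] x ++ fs_mul [:: p] y.
  by rewrite /fs_mul /= !cats0 map_cat.
rewrite cons (fs_mul_catl [:: dlt _] _ w) IH (fs_mul_catl [:: r] v w) catr.
congr (_ ++ _); rewrite /fs_mul /= !cats0 -map_comp; apply: eq_map => s /=.
exact/esym/dlt_mulA.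
Qed.

Lemma ev_adjoint u v w g : ev (fs_mul (fs_star (fs_mul u v)) w) g =
  ev (fs_mul (fs_star v) (fs_mul (fs_star u) w)) g.
Proof.
rewrite -fs_mulA !ev_mul_sum /fs_star big_map.
rewrite [RHS](_ : _ = \sum_(p <- v) \sum_(r <- u) \sum_(s <- w)
   cf (fmul (fmul (fstar (projT2 p)) (fstar (projT2 r))) (projT2 s)) g); last first.
  elim: v => [|p v IH]; first by rewrite !big_nil.
  rewrite [map _ _]/= (fs_mul_catl [:: dlt (fstar (projT2 p))]) big_cat big_cons IH /=; congr (_ + _).
  by rewrite /fs_mul /= cats0 !big_map.
rewrite [RHS]exchange_big /=; elim: u => [|p u IH]; first by rewrite !big_nil.
rewrite (fs_mul_catl [:: p] u v) big_cat big_cons IH /=; congr (_ + _).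
rewrite /fs_mul /= cats0 big_map; apply: eq_bigr => r _; apply: eq_bigr => s _ /=.
have := dlt_starM (projT2 p) (projT2 r) => h.
have /(congr1 (fun z : ftot A => cf (fmul (projT2 z) (projT2 s)) g)) := h.
by [].
Qed.

(** An arrow t has at most one factorisation with second factor in a given bissection,
    so that every coefficient of the product of z by a term over this bissection is a
    multiple of one coefficient of z. *)
Lemma ev_mul_ext u v w : ev u = ev v -> ev (fs_mul u w) = ev (fs_mul v w).
Proof.
have key (z : fsum A) (r : ftot A) (t : G) : \sum_(p <- z) cf (fmul (projT2 p) (projT2 r)) t =
    if pselect (exists g, biss (projT1 r) g /\ gdom g = gdom t) is left h then
      let g := sval (cid h) in
      cocycle (gmul t (ginv g)) g * (ev z (gmul t (ginv g)) * cf (projT2 r) g) else 0.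
  case: pselect => [h|nh]; last first.
    rewrite big1 // => p _; apply: cf_mul_out => -[g1 [g2 [_ Vg g12 tE]]].
    by apply: nh; exists g2; split => //; rewrite tE (gdomM hG).
  case: cid => g [Vg gt].
  transitivity (cocycle (gmul t (ginv g)) g * (ev z (gmul t (ginv g)) * cf (projT2 r) g)); last by [].
  rewrite /ev mulr_suml mulr_sumr; apply: eq_bigr => p _.
  have c1 : gdom t = grng (ginv g) by rewrite (grngV hG).
  have c2 : gdom (gmul t (ginv g)) = grng g by rewrite (gdomM hG) // (gdomV hG).
  have tE : gmul (gmul t (ginv g)) g = t.
    by rewrite -(gmulA hG) ?(gdomV hG) // (gmulVl hG) gt (gmul_dom hG).
  have [Ug|nUg] := pselect (biss (projT1 p) (gmul t (ginv g))).
    by have := cf_mul (projT2 p) (projT2 r) Ug Vg c2; rewrite tE => ->.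
  rewrite (cf_out (projT2 p) nUg) mul0r mulr0 cf_mul_out // => -[g1 [g2 [Ug1 Vg2 g12 tE']]].
  have g2g : g2 = g by apply: (bissection_domI (bissP _) Vg2 Vg); rewrite gt tE' (gdomM hG).
  apply: nUg; rewrite tE' g2g -(gmulA hG) ?(grngV hG) ?(gmulV hG) -?g2g //.
  by rewrite -g12 (gmul_dom hG).
move=> uv; apply/funext => t; rewrite !ev_mul_sum exchange_big [RHS]exchange_big /=.
by apply: eq_bigr => r _; rewrite !key uv.
Qed.

Variable x : G.
Hypothesis xu : gunits G x.

(** The point of the fibre of the source map over [x], if any, at which a term of
    a formal sum is supported *)
Definition fibre_pt (p : ftot A) : option G :=
  match pselect (exists g, biss (projT1 p) g /\ gdom g = x) with
  | left h => Some (sval (cid h)) | right _ => None end.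

Lemma fibre_ptP (p : ftot A) g : fibre_pt p = Some g <-> biss (projT1 p) g /\ gdom g = x.
Proof.
rewrite /fibre_pt; case: pselect => [h|nh]; last by split => // h; exfalso; apply: nh; exists g.
case: cid => g' /= [Ug' g'x]; split=> [[<-]//|[Ug gx]]; congr Some.
by apply: (bissection_domI (bissP _) Ug' Ug); rewrite gx.
Qed.

Definition inner v w : C := ev (fs_mul (fs_star v) w) x.

Lemma inner_term (p r : ftot A) (T : seq G) : uniq T -> {in T, forall t, gdom t = x} ->
  (forall g, fibre_pt p = Some g -> g \in T) ->
  cf (fmul (fstar (projT2 p)) (projT2 r)) x =
  \sum_(t <- T) (cf (projT2 p) t)^* * cf (projT2 r) t.
Proof.
move=> uT Tx pT; have [[g [Ug gx]]|nU] := pselect (exists g, biss (projT1 p) g /\ gdom g = x).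
  have gT : g \in T by apply: pT; apply/fibre_ptP.
  rewrite (bigD1_seq g) //= big1_seq ?addr0; last first.
    move=> t /andP[tg tT]; rewrite (cf_out (projT2 p)) ?conjc0 ?mul0r // => Ut.
    by move/eqP: tg; apply; apply: (bissection_domI (bissP _) Ut Ug); rewrite gx Tx.
  have [Vg|nVg] := pselect (biss (projT1 r) g); first by rewrite -gx cf_star_mul.
  rewrite (cf_out (projT2 r) nVg) mulr0 cf_star_mul_out // => h Uh Vh hx.
  by apply: nVg; rewrite (bissection_domI (bissP _) Ug Uh) // gx.
rewrite cf_star_mul_out //; last by move=> g Ug _ gx; apply: nU; exists g.
rewrite big1_seq // => t /andP[_ tT]; rewrite (cf_out (projT2 p)) ?conjc0 ?mul0r // => Ut.
by apply: nU; exists t; split => //; exact: Tx.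
Qed.

(** The form is the inner product of the square-summable functions on the fibre of the
    source map over x, the space of the regular representation. *)
Lemma inner_sum v w (T : seq G) : uniq T -> {in T, forall t, gdom t = x} ->
  {subset pmap fibre_pt v <= T} ->
  inner v w = \sum_(t <- T) (ev v t)^* * ev w t.
Proof.
move=> uT Tx vT; elim: v vT => [|p v IH] vT.
  rewrite /inner ev_mul_sum big_nil big1 // => t _.
  by rewrite /ev big_nil conjc0 mul0r.
have vT' : {subset pmap fibre_pt v <= T}.
  by move=> t tv; apply: vT => /=; case: (fibre_pt p) => //= g; rewrite inE tv orbT.
have pT g : fibre_pt p = Some g -> g \in T by move=> pg; apply: vT; rewrite /= pg mem_head.
have -> : inner (p :: v) w = inner [:: p] w + inner v w.
  by rewrite /inner (fs_star_cat [:: p] v) fs_mul_catl ev_cat.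
rewrite IH //; rewrite /inner ev_mul_sum big_seq1 /=.
transitivity (\sum_(t <- T) (cf (projT2 p) t)^* * ev w t + \sum_(t <- T) (ev v t)^* * ev w t).
  congr (_ + _); rewrite (eq_bigr (fun r => \sum_(t <- T) (cf (projT2 p) t)^* * cf (projT2 r) t)).
    by rewrite exchange_big /=; apply: eq_bigr => t _; rewrite mulr_sumr.
  by move=> r _; apply: inner_term.
rewrite -big_split /=; apply: eq_bigr => t _.
by rewrite -mulrDl {3}/ev big_cons (rmorphD (@conjc R)).
Qed.

Lemma fibre_pts_dom v t : t \in undup (pmap fibre_pt v) -> gdom t = x.
Proof.
rewrite mem_undup; elim: v => //= p v IH.
case pE : (fibre_pt p) => [g|] //=; rewrite inE => /orP[/eqP ->|//].
by case: ((fibre_ptP p g).1 pE).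
Qed.

Lemma ev_fibre v t : gdom t = x -> t \notin pmap fibre_pt v -> ev v t = 0.
Proof.
move=> tx; elim: v => [|p v IH] /=; first by rewrite /ev big_nil.
rewrite /ev big_cons -/(ev v t); case pE : (fibre_pt p) => [g|] /=.
  rewrite inE negb_or => /andP[tg /IH ->]; rewrite addr0 cf_out // => Ut.
  by move: tg; have := (fibre_ptP p t).2 (conj Ut tx); rewrite pE => -[->]; rewrite eqxx.
move=> /IH ->; rewrite addr0 cf_out // => Ut.
by have := (fibre_ptP p t).2 (conj Ut tx); rewrite pE.
Qed.

Definition sqnorm v : R := complex.Re (inner v v).

Lemma sqnorm_sum v (T : seq G) : uniq T -> {in T, forall t, gdom t = x} ->
  {subset pmap fibre_pt v <= T} -> sqnorm v = \sum_(t <- T) nc (ev v t) ^+ 2.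
Proof.
move=> uT Tx vT; rewrite /sqnorm (inner_sum _ uT Tx vT).
rewrite (eq_bigr (fun t => (nc (ev v t) ^+ 2)%:C)); last by move=> t _; exact: mulJ_nc.
by rewrite -rmorph_sum.
Qed.

Lemma common_fibre v w : exists T : seq G, [/\ uniq T, {in T, forall t, gdom t = x},
  {subset pmap fibre_pt v <= T} & {subset pmap fibre_pt w <= T}].
Proof.
exists (undup (pmap fibre_pt (v ++ w))); split.
- exact: undup_uniq.
- exact: fibre_pts_dom.
- by move=> t tv; rewrite mem_undup pmap_cat mem_cat tv.
- by move=> t tv; rewrite mem_undup pmap_cat mem_cat tv orbT.
Qed.

Lemma sqnorm_ge0 v : 0 <= sqnorm v.
Proof.
have [T [uT Tx vT _]] := common_fibre v v.
by rewrite (sqnorm_sum uT Tx vT); apply: sumr_ge0 => t _; rewrite sqr_ge0.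
Qed.

Lemma inner_le v w : nc (inner v w) ^+ 2 <= sqnorm v * sqnorm w.
Proof.
have [T [uT Tx vT wT]] := common_fibre v w.
rewrite (inner_sum _ uT Tx vT) (sqnorm_sum uT Tx vT) (sqnorm_sum uT Tx wT).
have h : nc (\sum_(t <- T) (ev v t)^* * ev w t) <= \sum_(t <- T) nc (ev v t) * nc (ev w t).
  elim: (T) => [|t s IH]; first by rewrite !big_nil nc0.
  rewrite !big_cons; apply: le_trans (ncD _ _) _; apply: lerD => //.
  by rewrite ncM ncJ.
apply: le_trans (sum_CauchySchwarz T (fun t => nc_ge0 (ev v t)) (fun t => nc_ge0 (ev w t))).
rewrite ler_sqr ?nnegrE ?nc_ge0 //; apply: sumr_ge0 => t _.
by rewrite mulr_ge0 ?nc_ge0.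
Qed.

Definition rnorm v : R := Num.sqrt (sqnorm v).

Lemma rnorm_ge0 v : 0 <= rnorm v. Proof. exact: sqrtr_ge0. Qed.

Lemma rnorm_sqr v : rnorm v ^+ 2 = sqnorm v.
Proof. by rewrite sqr_sqrtr // sqnorm_ge0. Qed.

Lemma inner_rnorm v w : nc (inner v w) <= rnorm v * rnorm w.
Proof.
rewrite -ler_sqr ?nnegrE ?nc_ge0 ?mulr_ge0 ?rnorm_ge0 // exprMn !rnorm_sqr.
exact: inner_le.
Qed.

Lemma inner_self v : inner v v = (sqnorm v)%:C.
Proof.
have [T [uT Tx vT _]] := common_fibre v v.
rewrite (inner_sum _ uT Tx vT) (sqnorm_sum uT Tx vT) rmorph_sum.
by apply: eq_bigr => t _; exact: mulJ_nc.
Qed.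

Lemma sqnorm_ext v v' : (forall t, gdom t = x -> ev v t = ev v' t) -> sqnorm v = sqnorm v'.
Proof.
move=> vv'; have [T [uT Tx vT v'T]] := common_fibre v v'.
rewrite (sqnorm_sum uT Tx vT) (sqnorm_sum uT Tx v'T); apply: eq_big_seq => t tT.
by rewrite vv' // Tx.
Qed.

Lemma sqnorm_scale l v : sqnorm (fs_scale l v) = nc l ^+ 2 * sqnorm v.
Proof.
have [T [uT Tx vT wT]] := common_fibre v (fs_scale l v).
rewrite (sqnorm_sum uT Tx vT) (sqnorm_sum uT Tx wT) mulr_sumr; apply: eq_bigr => t _.
by rewrite ev_scale ncM exprMn.
Qed.

Lemma rnorm_scale l v : rnorm (fs_scale l v) = nc l * rnorm v.
Proof.
by rewrite /rnorm sqnorm_scale sqrtrM ?sqr_ge0 // sqrtr_sqr ger0_norm // nc_ge0.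
Qed.

Lemma inner_catr v w w' : inner v (w ++ w') = inner v w + inner v w'.
Proof.
have [T [uT Tx vT _]] := common_fibre v v.
rewrite !(inner_sum _ uT Tx vT) -big_split; apply: eq_bigr => t _.
by rewrite ev_cat mulrDr.
Qed.

Lemma inner_catl v v' w : inner (v ++ v') w = inner v w + inner v' w.
Proof. by rewrite /inner fs_star_cat fs_mul_catl ev_cat. Qed.

Lemma rnorm_cat v w : rnorm (v ++ w) <= rnorm v + rnorm w.
Proof.
rewrite -ler_sqr ?nnegrE ?addr_ge0 ?rnorm_ge0 // rnorm_sqr /sqnorm.
rewrite inner_catl !inner_catr !inner_self !raddfD /= -!rnorm_sqr sqrrD.
have h1 := le_trans (ler_norm _) (le_trans (Re_nc _) (inner_rnorm v w)).
have h2 := le_trans (ler_norm _) (le_trans (Re_nc _) (inner_rnorm w v)).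
by move: h1 h2; rewrite mulr2n; move: (complex.Re _) (complex.Re _) => a b; lra.
Qed.

Lemma rnorm_mul_adjoint u w z : nc (inner (fs_mul u w) z) <= rnorm w * rnorm (fs_mul (fs_star u) z).
Proof. by rewrite /inner ev_adjoint; exact: inner_rnorm. Qed.

Lemma rnorm_mul_sqr u w : rnorm (fs_mul u w) ^+ 2 <= rnorm w * rnorm (fs_mul (fs_mul (fs_star u) u) w).
Proof.
rewrite rnorm_sqr fs_mulA; apply: le_trans (rnorm_mul_adjoint u w (fs_mul u w)).
by rewrite inner_self ncC ler_norm.
Qed.

(** For a in a fibre, (star a) a acts as the multiplication by a bounded function of
    the range. *)
Lemma rnorm_mul_bounded u : exists2 M : R, 0 <= M & forall w, rnorm (fs_mul u w) <= M * rnorm w.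
Proof.
elim: u => [|[U a] u [M M0 uM]].
  exists 0 => // w; rewrite mul0r (_ : fs_mul [::] w = [::]) // /rnorm.
  by rewrite /sqnorm /inner ev_mul_sum big_nil sqrtr0.
have [M' M'0 aM] := cf_bounded a; exists (M' + M); first exact: addr_ge0.
move=> w; rewrite (fs_mul_catl [:: dlt a] u w) mulrDl.
apply: le_trans (rnorm_cat _ _) _; apply: lerD => //.
have h0 : rnorm (fs_mul (fs_mul (fs_star [:: dlt a]) [:: dlt a]) w) <= M' ^+ 2 * rnorm w.
  rewrite -ler_sqr ?nnegrE ?mulr_ge0 ?sqr_ge0 ?rnorm_ge0 // exprMn !rnorm_sqr.
  have [T [uT Tx vT wT]] := common_fibre w (fs_mul (fs_mul (fs_star [:: dlt a]) [:: dlt a]) w).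
  rewrite (sqnorm_sum uT Tx vT) (sqnorm_sum uT Tx wT) mulr_sumr; apply: ler_sum => t _.
  have aau : unitset (U^! ** U : I) by exact: (@unitsetP (src_idem U)).
  have -> : ev (fs_mul (fs_mul (fs_star [:: dlt a]) [:: dlt a]) w) t =
      cf (fmul (fstar a) a) (grng t) * ev w t.
    rewrite ev_mul_sum big_seq1 /ev mulr_sumr; apply: eq_bigr => r _ /=.
    by rewrite cf_mul_unitl.
  rewrite ncM exprMn ler_wpM2r ?sqr_ge0 // ler_sqr ?nnegrE ?nc_ge0 ?sqr_ge0 //.
  have [[g [Ug gx]]|nU] := pselect (exists g, biss U g /\ gdom g = grng t).
    by rewrite -gx cf_star_mul // nc_mulJ ler_sqr ?nnegrE ?nc_ge0.
  rewrite cf_star_mul_out ?nc0 ?sqr_ge0 //; first exact: gunits_rng.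
  by move=> g Ug _ gx; apply: nU; exists g.
rewrite -ler_sqr ?nnegrE ?mulr_ge0 ?rnorm_ge0 // exprMn.
apply: le_trans (rnorm_mul_sqr _ _) _.
by rewrite expr2 mulrCA ler_wpM2l ?rnorm_ge0.
Qed.

Definition op_norm u : R := sup [set r | exists2 w, rnorm w <= 1 & r = rnorm (fs_mul u w)].

Lemma op_norm_has_sup u : has_sup [set r | exists2 w, rnorm w <= 1 & r = rnorm (fs_mul u w)].
Proof.
split.
  exists (rnorm (fs_mul u [::])), [::] => //.
  by rewrite /rnorm /sqnorm /inner ev_mul_sum big_nil sqrtr0.
have [M M0 uM] := rnorm_mul_bounded u; exists M => _ [w w1 ->].
by apply: le_trans (uM w) _; rewrite ler_piMr.
Qed.

Lemma op_norm_ge0 u : 0 <= op_norm u.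
Proof.
apply: le_trans (rnorm_ge0 (fs_mul u [::])) _; apply: ub_le_sup; first by case: (op_norm_has_sup u).
by exists [::] => //; rewrite /rnorm /sqnorm /inner ev_mul_sum big_nil sqrtr0.
Qed.

Lemma op_norm_mul u w : rnorm (fs_mul u w) <= op_norm u * rnorm w.
Proof.
have [w0|w0] := eqVneq (rnorm w) 0.
  have [M _ uM] := rnorm_mul_bounded u; have := uM w.
  by rewrite w0 !mulr0.
have w1 : 0 < rnorm w by rewrite lt_neqAle eq_sym w0 rnorm_ge0.
rewrite -ler_pdivrMr //; apply: ub_le_sup; first by case: (op_norm_has_sup u).
have ncw : nc ((rnorm w)^-1)%:C = (rnorm w)^-1 by rewrite ncC ger0_norm // invr_ge0 ltW.
exists (fs_scale ((rnorm w)^-1)%:C w); first by rewrite rnorm_scale ncw mulVf.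
by rewrite (fs_mulZr lawsA) rnorm_scale ncw mulrC.
Qed.

Lemma op_norm_le u M : 0 <= M -> (forall w, rnorm (fs_mul u w) <= M * rnorm w) -> op_norm u <= M.
Proof.
move=> M0 uM; apply: ge_sup; first by case: (op_norm_has_sup u).
by move=> _ [w w1 ->]; apply: le_trans (uM w) _; rewrite ler_piMr.
Qed.

Lemma op_norm_star u : op_norm (fs_star u) <= op_norm u.
Proof.
apply: op_norm_le; first exact: op_norm_ge0.
move=> w; have [->|z0] := eqVneq (rnorm (fs_mul (fs_star u) w)) 0.
  by rewrite mulr_ge0 ?op_norm_ge0 ?rnorm_ge0.
have z1 : 0 < rnorm (fs_mul (fs_star u) w) by rewrite lt_neqAle eq_sym z0 rnorm_ge0.
rewrite -(ler_pM2r z1) -expr2; apply: le_trans (rnorm_mul_sqr _ _) _.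
rewrite (fs_starK lawsA) fs_mulA [leRHS]mulrAC [leLHS]mulrC.
by rewrite ler_wpM2r ?rnorm_ge0 //; exact: op_norm_mul.
Qed.

Lemma op_norm_csn : cstar_seminorm op_norm.
Proof.
have extn u v w : ev u = ev v -> rnorm (fs_mul u w) = rnorm (fs_mul v w).
  by move=> uv; rewrite /rnorm; congr Num.sqrt; apply: sqnorm_ext => t _; rewrite (ev_mul_ext w uv).
split=> [u v /ev_fs_eq uv|u v|l u|u v|u].
- by congr sup; apply/seteqP; split=> _ [w w1 ->]; exists w => //; apply: extn.
- apply: op_norm_le; first by rewrite addr_ge0 ?op_norm_ge0.
  move=> w; rewrite fs_mul_catl mulrDl; apply: le_trans (rnorm_cat _ _) _.
  by apply: lerD; exact: op_norm_mul.
- rewrite -[complex.Re _]/(nc l).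
  have le l' u' : op_norm (fs_scale l' u') <= nc l' * op_norm u'.
    apply: op_norm_le; first by rewrite mulr_ge0 ?nc_ge0 ?op_norm_ge0.
    move=> w; rewrite (fs_mulZl lawsA) rnorm_scale -mulrA ler_wpM2l ?nc_ge0 //.
    exact: op_norm_mul.
  apply/eqP; rewrite eq_le le /=.
  have [->|l0] := eqVneq l 0; first by rewrite nc0 mul0r op_norm_ge0.
  have := le l^-1 (fs_scale l u); rewrite (fs_scaleA lawsA) mulVf // (fs_scale1 lawsA).
  have nl : 0 < nc l by rewrite lt_neqAle eq_sym nc_eq0 l0 nc_ge0.
  by rewrite ncV mulrC ler_pdivlMr // mulrC.
- apply: op_norm_le; first by rewrite mulr_ge0 ?op_norm_ge0.
  move=> w; rewrite fs_mulA; apply: le_trans (op_norm_mul _ _) _.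
  by rewrite -mulrA ler_wpM2l ?op_norm_ge0 // op_norm_mul.
apply/eqP; rewrite eq_le; apply/andP; split.
  apply: op_norm_le; first exact: sqr_ge0.
  move=> w; rewrite fs_mulA; apply: le_trans (op_norm_mul _ _) _.
  rewrite expr2 -mulrA; apply: ler_pM; rewrite ?op_norm_ge0 ?rnorm_ge0 //.
    exact: op_norm_star.
  exact: op_norm_mul.
rewrite -[leRHS]sqr_sqrtr ?op_norm_ge0 // ler_sqr ?nnegrE ?op_norm_ge0 ?sqrtr_ge0 //.
apply: op_norm_le; first exact: sqrtr_ge0.
move=> w; rewrite -ler_sqr ?nnegrE ?mulr_ge0 ?sqrtr_ge0 ?rnorm_ge0 //.
rewrite exprMn [X in _ <= X * _]sqr_sqrtr ?op_norm_ge0 //; apply: le_trans (rnorm_mul_sqr u w) _.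
rewrite expr2 mulrCA ler_wpM2l ?rnorm_ge0 //; exact: op_norm_mul.
Qed.

(** The value at x of a function in C*(E) is a matrix coefficient of the regular
    representation at x, for the vector concentrated at x. Since the latter is a
    representation of the algebra of the whole Fell bundle, C*(E) embeds in C*(A). *)
Lemma evE_le_incl (u : fsum E) : wide S -> nc (evE u x) <= env_norm (fs_incl u).
Proof.
move=> [Scov _].
have [W SW Wx] : (\bigcup_(U in S) U) x by rewrite Scov.
have [U UW] := bissS SW.
have Ux : biss U x by rewrite UW.
have ex : biss (U^! ** U) x.
  rewrite biss_mul; exists (ginv x), x; split => //.
  - by exists x.
  - by rewrite (gdomV hG).
  - by rewrite (gmulVl hG) (xu : gdom x = x).
have [b [b1 _]] := cf_through 1 ex (filterT : nbhs x setT).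
apply: le_trans (env_norm_sup lawsA (fs_incl u) op_norm_csn).
have bu : unitset (U^! ** U : I) by exact: (@unitsetP (src_idem U)).
have b0 t : gdom t = x -> t <> x -> cf b t = 0.
  by move=> tx ntx; apply: cf_out => /bu tu; apply: ntx; rewrite -tx.
have N1 : rnorm [:: dlt b] = 1.
  have [T [uT Tx vT _]] := common_fibre [:: dlt b] [:: dlt b].
  have xT : x \in T by apply: vT; rewrite /= (fibre_ptP (dlt b) x).2 // mem_head.
  rewrite /rnorm (sqnorm_sum uT Tx vT) (bigD1_seq x) //= /ev big_seq1 /= b1 nc1 expr1n.
  rewrite big1_seq ?addr0 ?sqrtr1 // => t /andP[/eqP tx tT].
  by rewrite big_seq1 /= b0 ?nc0 ?expr0n //; exact: Tx.
have : rnorm (fs_mul (fs_incl u) [:: dlt b]) <= op_norm (fs_incl u).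
  by apply: le_trans (op_norm_mul _ _) _; rewrite N1 mulr1.
apply: le_trans; rewrite -[leLHS]ger0_norm ?nc_ge0 // -sqrtr_sqr; apply: ler_wsqrtr.
set z := fs_mul _ _.
have zx : ev z x = evE u x.
  rewrite ev_mul_sum -ev_incl; apply: eq_bigr => p _; rewrite big_seq1 /=.
  by rewrite cf_mul_unitr // (xu : gdom x = x) b1 mulr1.
have [T [uT Tx vT _]] := common_fibre z z.
rewrite (sqnorm_sum uT Tx vT) -zx.
have [xT|xnT] := boolP (x \in T).
  rewrite (bigD1_seq x) //= lerDl; apply: sumr_ge0 => t _; exact: sqr_ge0.
rewrite ev_fibre ?nc0 ?expr0n //=; first by apply: sumr_ge0 => t _; exact: sqr_ge0.
by apply/negP => /vT xT; rewrite xT in xnT.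
Qed.

End RegularRepresentation.

(** * Characters of the algebra of the units *)

Hypothesis wS : wide S.
Local Notation X := (Xsp A).
Let slE : star_laws E := lawsE.
Let slA : star_laws A := lawsA.

Lemma src_idemP (U : I) x : gunits G x ->
  biss (U^! ** U) x <-> exists g, biss U g /\ gdom g = x.
Proof.
move=> xu; rewrite biss_mul; split.
  move=> [_ [g [[h Uh <-] Ug + xE]]]; rewrite (gdomV hG) => hg; exists g; split => //.
  by rewrite -(xu : gdom x = x) xE (gdomM hG) // (gdomV hG).
move=> [g [Ug <-]]; exists (ginv g), g; split => //; first by exists g.
  by rewrite (gdomV hG).
by rewrite (gmulVl hG).
Qed.

Lemma rng_idemP (U : I) x : gunits G x ->
  biss (U ** U^!) x <-> exists g, biss U g /\ grng g = x.
Proof.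
move=> xu; rewrite biss_mul; split.
  move=> [g [_ [Ug [h Uh <-] + xE]]]; rewrite (grngV hG) => gh; exists g; split => //.
  by rewrite -(gunits_grng eG xu) xE (grngM hG) // (grngV hG).
move=> [g [Ug <-]]; exists g, (ginv g); split => //; first by exists g.
  by rewrite (grngV hG).
by rewrite (gmulV hG).
Qed.

Lemma wide_cover g : exists U : I, biss U g.
Proof.
case: wS => cov _; have [W SW Wg] : (\bigcup_(U in S) U) g by rewrite cov.
by have [U UW] := bissS SW; exists U; rewrite UW.
Qed.

Lemma wide_refine (U V : I) g : biss U g -> biss V g ->
  exists W : I, [/\ biss W g, biss W `<=` biss U & biss W `<=` biss V].
Proof.
move=> Ug Vg; case: wS => _ /(_ (biss U) (biss V) g).
case=> // [||W [SW Wg WUV]]; [exact: set_mem (valP (U : S))|exact: set_mem (valP (V : S))|].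
have [W' W'W] := bissS SW; exists W'; rewrite W'W; split => // h /WUV[] //.
Qed.

Lemma unit_idem x : gunits G x -> exists e : Eisg I, biss (sval e) x.
Proof.
move=> xu; have [U Ux] := wide_cover x; exists (src_idem U).
by apply/(src_idemP U xu); exists x.
Qed.

Definition evC (x : G) (c : Cstar E) : C := ext_fun (fun u => evE u x) c.

Lemma evC_cst x (u : fsum E) : evC x (mkC (fun=> u)) = evE u x.
Proof.
apply: (ext_cst slE (psi := fun u => evE u x));
  [by move=> {}u v; exact: evE_cat|by move=> l {}u; exact: evE_scale|by move=> v; exact: evE_le].
Qed.

Lemma evC_rep x c : tendsto (fun n => evE (repC c n) x) (evC x c).
Proof.
apply: (ext_rep (psi := fun u => evE u x));
  [by move=> u v; exact: evE_cat|by move=> l u; exact: evE_scale|by move=> v; exact: evE_le].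
Qed.

Lemma evC_mkC x (u : nat -> fsum E) : env_cauchy u -> tendsto (fun n => evE (u n) x) (evC x (mkC u)).
Proof.
apply: (ext_mkC slE (psi := fun u => evE u x));
  [by move=> {}u v; exact: evE_cat|by move=> l {}u; exact: evE_scale|by move=> v; exact: evE_le].
Qed.

Lemma evC_character x : gunits G x -> is_character (evC x).
Proof.
move=> xu; apply: (ext_character slE (psi := fun u => evE u x)).
- by move=> u v; exact: evE_cat.
- by move=> l u; exact: evE_scale.
- by move=> v; exact: evE_le.
- by move=> u v; exact: evE_mul.
- by move=> u; exact: evE_star.
have [e ex] := unit_idem xu.
have [b [b1 _]] := cf_through 1 ex (filterT : nbhs x setT).
exists [:: @dlt _ _ E e b]; rewrite /evE big_seq1 /cfE /= b1; exact: oner_neq0.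
Qed.

Lemma mkC_cst_eq (u v : fsum E) : fs_eq u v -> mkC (fun=> u) = mkC (fun=> v).
Proof.
move=> uv; apply: (mkC_ext slE); [exact: cauchy_cst|exact: cauchy_cst|move=> _].
by rewrite /fs_sub (csn_eq (env_norm_cstar slE) (fs_eq_catr _ uv)) (csn_sub_self slE (env_norm_cstar slE)).
Qed.

Section Character.
Variable chi : Cstar E -> C.
Hypothesis chiP : is_character chi.

Let X (u : fsum E) : C := chi (mkC (fun=> u)).

Let X_eq u v : fs_eq u v -> X u = X v.
Proof. by move=> uv; rewrite /X (mkC_cst_eq uv). Qed.

Let X_cat u v : X (u ++ v) = X u + X v.
Proof. by rewrite /X -(chr_add chiP) (CaddE slE) //; exact: cauchy_cst. Qed.

Let X_scale l u : X (fs_scale l u) = l * X u.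
Proof. by rewrite /X -(chr_scale chiP) (CscaleE slE) //; exact: cauchy_cst. Qed.

Let X_mul u v : X (fs_mul u v) = X u * X v.
Proof. by rewrite /X -(chr_mul chiP) (CmulE slE) //; exact: cauchy_cst. Qed.

Let X_smul u v : X (smul (evE v) u) = X v * X u.
Proof. by rewrite -X_mul; apply/X_eq/fs_eq_sym/fs_mul_smul. Qed.

Let X_bound : exists2 M : R, 0 < M & forall u (K : R), 0 <= K ->
  (forall g, nc (evE u g) <= K) -> nc (X u) <= M * K.
Proof.
have [M M0 XM] := chr_cst_le slE chiP; exists M => // u K K0 uK.
by apply: le_trans (XM u) _; rewrite ler_wpM2l ?(ltW M0) //; exact: envE_le.
Qed.

Let X_neq0 : exists (e : Eisg I) (a : E e), X [:: dlt a] != 0.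
Proof.
apply: contrapT => nX; have [x0 x00] := chr_neq0 chiP; apply: x00.
have X0 u : X u = 0.
  rewrite /X (chr_sum slE _ chiP) big1 // => -[e a] _ /=.
  by apply: contrapT => /eqP ae; apply: nX; exists e, a.
apply/eqP; rewrite -nc_eq0; apply/eqP/le_anti; rewrite nc_ge0 andbT.
have [M M0 chiM] := chr_le slE chiP.
apply/ler_addgt0Pr => d d0; rewrite add0r.
have [|a [y [-> yn]]] := @Cstar_dense _ _ _ slE x0 (d / M); first by rewrite divr_gt0.
rewrite (chr_add chiP) [chi _]X0 add0r; apply: le_trans (chiM y) _.
by rewrite mulrC -ler_pdivlMr.
Qed.

Let kerpos (w : fsum E) := X w = 0 /\ forall g, 0 <= evE w g.

Let ker_pos v : X v = 0 -> kerpos (fs_mul (fs_star v) v).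
Proof.
move=> v0; split; first by rewrite X_mul v0 mulr0.
by move=> g; rewrite evE_mul evE_star mulJ_nc ler0c sqr_ge0.
Qed.

Let damp_le (s eps a : R) : 0 <= s -> a <= eps * (1 + s) ->
  nc ((1 + s)^-1)%:C * a <= eps.
Proof.
move=> s0 h; have d0 : 0 < 1 + s by rewrite ltr_wpDr.
rewrite ncC (ger0_norm (ltW _)) ?invr_gt0 // [leLHS]mulrC ler_pdivrMr //.
Qed.

Let X_damp (u w : fsum E) phi : X w = 0 -> multiplier phi ->
  (fun g => phi g + evE w g * phi g) = (fun=> 1) -> X u = X (smul phi u).
Proof.
move=> w0 mphi one; have mw := multiplier_evE w.
have X1 : X (smul (fun=> 1) u) = X u by rewrite (smul_cst 1 u) X_scale mul1r.
have := X_eq (smulD u mphi (multiplierM mw mphi)).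
rewrite one X1 X_cat -(smulA u mw mphi) X_smul w0 mul0r addr0.
by move=> ->.
Qed.

(** If the kernel of the character had no common zero in U_e, then by compactness some
    w >= 0 in the kernel would be at least 1 on the compact set outside which a is
    small. Dividing a by 1 + t w does not change the value of the character, and makes a
    as small as wanted: the character would vanish at a. *)
Let ker_point (e : Eisg I) (a : E e) : X [:: dlt a] != 0 ->
  exists x, biss (sval e) x /\ forall v, X v = 0 -> evE v x = 0.
Proof.
move=> Xa; apply: contrapT => nx.
have kx x : biss (sval e) x -> exists v, X v = 0 /\ evE v x <> 0.
  move=> ex; apply: contrapT => nv; apply: nx; exists x; split => // v v0.
  by apply: contrapT => vx; apply: nv; exists v.
have [M M0 XM] := X_bound.
have eps0 : 0 < nc (X [:: dlt a]) / 2 / M.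
  by rewrite !divr_gt0 // lt_neqAle eq_sym nc_eq0 Xa nc_ge0.
have aC := @secP (sval e) a.
have [_ _ _ /(_ _ eps0)[K [Kc KU Ke]]] := (C0P _ (bissP (sval e))).1 aC.
have [w [[Xw w0] wK]] : exists w, kerpos w /\ forall y, K y -> 1 <= evE w y.
  (* Nonnegative elements of the kernel can be added: the property of dominating a
     given one defines a filter, along which the local lower bounds hold together. *)
  pose F : set_system (fsum E) := [set P | exists2 w0, kerpos w0 &
    forall w, kerpos w -> (forall y, evE w0 y <= evE w y) -> P w].
  have FF : Filter F.
    split.
    - exists [::] => //; split; last by move=> g; rewrite /evE big_nil.
      by rewrite -[[::]](_ : fs_scale 0 [::] = [::]) // X_scale mul0r.
    - move=> P Q [w1 [X1 w1p] h1] [w2 [X2 w2p] h2]; exists (w1 ++ w2).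
        by split; [rewrite X_cat X1 X2 addr0|move=> g; rewrite evE_cat addr_ge0].
      move=> w kw w12; split; [apply: h1|apply: h2] => // y; apply: le_trans (w12 y);
        by rewrite evE_cat ?lerDl ?lerDr.
    - by move=> P Q PQ [w0 kw0 h]; exists w0 => // w kw ww0; exact/PQ/h.
  have /compact_near_coveringP := Kc.
  move=> /(_ _ F (fun w y => kerpos w -> 1 <= evE w y) FF).
  have h y : K y -> \forall y' \near y & w \near F, kerpos w -> 1 <= evE w y'.
    move=> Ky; have yu : gunits G y by exact: unitsetP (KU _ Ky).
    have [v [Xv vy]] := kx y (KU _ Ky).
    have cy : 0 < nc (evE v y) by rewrite lt_neqAle eq_sym nc_eq0 nc_ge0 andbT; exact/eqP.
    (* k |v|^2 is at least 1 where |v| is at least half of its value at y. *)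
    pose k : R := 4 / nc (evE v y) ^+ 2.
    have k0 : 0 < k by rewrite divr_gt0 // exprn_gt0.
    have [Xw w0] := ker_pos Xv.
    exists ([set y' | nc (evE v y' - evE v y) < nc (evE v y) / 2],
       [set w | kerpos w -> forall y', evE (fs_scale k%:C (fs_mul (fs_star v) v)) y' <= evE w y']).
      split => /=.
        have /cvg_CP := (multiplier_evE v).1 y yu; apply.
        by rewrite divr_gt0.
      exists (fs_scale k%:C (fs_mul (fs_star v) v)).
        split; first by rewrite X_scale Xw mulr0.
        by move=> g; rewrite evE_scale mulr_ge0 // ler0c ltW.
      by move=> w _ h _.
    move=> [y' w] /= [hy' hw] kw; apply: le_trans (hw kw y').
    rewrite evE_scale evE_mul evE_star mulJ_nc -rmorphM /= lecR.
    have : nc (evE v y) / 2 <= nc (evE v y').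
      have := ncD (evE v y') (evE v y - evE v y'); rewrite addrC subrK (ncB (evE v y)); lra.
    rewrite /k mulrAC ler_pdivlMr ?exprn_gt0 // mul1r => vz; nra.
  move=> /(_ h)[w kw wK]; exists w; split => // y Ky.
  by apply: (wK w) => //.
have [B B0 aB] := @cf_bounded (sval e) a.
set eps := nc (X [:: dlt a]) / 2 / M in eps0 Ke.
have epsM : M * eps = nc (X [:: dlt a]) / 2 by rewrite /eps mulrC divfK // (gt_eqF M0).
clearbody eps.
pose h g : R := complex.Re (evE w g).
have wE g : evE w g = (h g)%:C by rewrite /h RRe_real // ger0_real.
have h0 g : 0 <= h g by rewrite -lecR -wE.
have hK y : K y -> 1 <= h y by move=> Ky; rewrite -lecR -wE; exact: wK.
have [t t0 Bt] : exists2 t : R, 0 <= t & B = eps * t.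
  by exists (B / eps); [exact: divr_ge0 (ltW eps0)|rewrite mulrC divfK // (gt_eqF eps0)].
have d1 g : 1 <= 1 + t * h g by rewrite lerDl mulr_ge0.
have d0 g : 0 < 1 + t * h g by exact: lt_le_trans ltr01 (d1 g).
pose phi g : C := ((1 + t * h g)^-1)%:C.
have mphi : multiplier phi.
  apply: (@multiplier_real (fun g => (1 + t * h g)^-1) 1) => [x xu|x _]; last first.
    rewrite ger0_norm; [by rewrite invf_le1 // d1|by rewrite invr_ge0 ltW].
  have hc : {for x, continuous h}.
    apply/cvg_RP => r r0; have /cvg_CP/(_ r r0) := (multiplier_evE w).1 x xu.
    apply: filterS => y; apply: le_lt_trans; rewrite /h; apply: le_trans (Re_nc _).
    by case: (evE w y) (evE w x) => a1 b1 [a2 b2].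
  have dc : {for x, continuous (fun g => 1 + t * h g)}.
    apply: (@continuousD _ R^o _ (fun=> 1) (fun g => t * h g)); first exact: cst_continuous.
    by apply: (@continuousM _ _ (fun=> t) h) => //; exact: cst_continuous.
  by apply: (@continuousV _ _ (fun g => 1 + t * h g)) => //; rewrite gt_eqF.
pose u := [:: dlt a]; pose u' := smul phi u.
have XE : X u = X u'.
  apply: (X_damp u (w := fs_scale t%:C w)) mphi _; first by rewrite X_scale Xw mulr0.
  apply/funext => g; rewrite evE_scale wE /phi -!rmorphM -rmorphD.
  rewrite -[X in X + _]mul1r -mulrDl divff //; exact: lt0r_neq0.
have : nc (X u) <= M * eps.
  rewrite XE; apply: XM; first exact: ltW.
  move=> g; rewrite (evE_smul u g mphi) {1}/u /evE big_seq1 ncM.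
  apply: damp_le (mulr_ge0 t0 (h0 g)) _.
  have [Kg|nKg] := pselect (K g).
    apply: le_trans (aB g) _.
    rewrite Bt; apply: (ler_wpM2l (ltW eps0)).
    have := ler_wpM2l t0 (hK g Kg); rewrite mulr1; lra.
  have [Ug|nUg] := pselect (biss (sval e) g); last first.
    rewrite /cfE (cf_out _ nUg) nc0; exact: mulr_ge0 (ltW eps0) (ltW (d0 g)).
  have := Ke g Ug nKg; rewrite line_norm_coord => /ltW h1.
  apply: le_trans h1 _; rewrite -[leLHS]mulr1.
  exact: ler_wpM2l (ltW eps0) _ _ (d1 g).
have Xa0 : 0 < nc (X u) by rewrite lt_neqAle eq_sym nc_eq0 Xa nc_ge0.
by rewrite epsM -/u; lra.
Qed.

(** The kernel of the character is contained in that of the evaluation at the point, so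
    that both are proportional, hence equal. *)
Lemma character_point : exists x, gunits G x /\ chi =1 evC x.
Proof.
have [e [a Xa]] := X_neq0; have [x [ex kerx]] := ker_point Xa.
have xu : gunits G x by exact: unitsetP ex.
exists x; split => //; apply: (chr_ext slE) => //; first exact: evC_character.
move=> v; rewrite evC_cst -/(X v).
pose u0 := fs_scale (X [:: dlt a])^-1 [:: dlt a].
have X1 : X u0 = 1 by rewrite X_scale mulVf.
have lin w : evE w x = X w * evE u0 x.
  have := kerx (w ++ fs_scale (- X w) u0); rewrite X_cat X_scale X1 mulr1 subrr.
  by move=> /(_ erefl); rewrite evE_cat evE_scale mulNr => /subr0_eq.
have [b [b1 _]] := cf_through 1 ex (filterT : nbhs x setT).
have bx : evE [:: @dlt _ _ E e b] x = 1 by rewrite /evE big_seq1.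
have u0x : evE u0 x != 0.
  by apply/eqP => u00; move: (lin [:: @dlt _ _ E e b]); rewrite bx u00 mulr0 => /eqP; rewrite oner_eq0.
have := lin (fs_mul u0 u0); rewrite X_mul X1 mulr1 mul1r evE_mul => /eqP.
rewrite -[eqbRHS]mulr1 (inj_eq (mulfI u0x)) => /eqP u01.
by rewrite lin u01 mulr1.
Qed.

End Character.

(** * The spectrum is the unit space *)

Lemma spectrum_pt_ex (x : X) : exists y, gunits G y /\ (val x : Cstar E -> C) =1 evC y.
Proof. exact: (character_point (set_mem (valP x))). Qed.

Definition spectrum_pt (x : X) : G := sval (cid (spectrum_pt_ex x)).

Lemma spectrum_pt_unit (x : X) : gunits G (spectrum_pt x).
Proof. by case: (svalP (cid (spectrum_pt_ex x))). Qed.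

Lemma evalX_upt c (x : X) : evalX c x = @evC (spectrum_pt x) c.
Proof. by have [_ h] := svalP (cid (spectrum_pt_ex x)); exact: h. Qed.

Lemma evalE_upt (e : Eisg I) (b : A (sval e)) (x : X) : evalE b x = cf b (spectrum_pt x).
Proof. by rewrite /evalE evalX_upt /Cdelta evC_cst /evE big_seq1. Qed.

Lemma spectrum_pt_inj : injective spectrum_pt.
Proof.
move=> x y xy; apply: val_inj; apply/funext => c.
by have := evalX_upt c x; rewrite xy -evalX_upt.
Qed.

Lemma unit_separation x y (W : set G) : gunits G x -> nbhs x W ->
  @evC x =1 evC y -> W y.
Proof.
move=> xu nW xy; have [e ex] := unit_idem xu.
have [b [b1 bW]] := cf_through 1 ex nW; apply: contrapT => nWy.
have := xy (mkC (fun=> [:: @dlt _ _ E e b])); rewrite !evC_cst /evE !big_seq1 /cfE /= b1 bW //.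
by move/eqP; rewrite oner_eq0.
Qed.

Lemma spectrum_pt_surj x : gunits G x -> exists y : X, spectrum_pt y = x.
Proof.
move=> xu.
pose y : X := SigSub (mem_set (evC_character xu) : (evC x : {ptws Cstar E -> C}) \in _).
exists y; apply: contrapT => /nesym yx.
have [V [W [oV oW Vx Wy VW]]] := gunits_hausdorff eG xu (spectrum_pt_unit y) yx.
apply: (VW (spectrum_pt y)) => //; first exact: spectrum_pt_unit.
apply: (unit_separation xu); first exact: open_nbhs_nbhs.
by move=> c; rewrite -evalX_upt.
Qed.

Lemma spectrum_pt_continuous : continuous spectrum_pt.
Proof.
move=> x W nW; have [e ex] := unit_idem (spectrum_pt_unit x).
have [b [b1 bW]] := cf_through 1 ex nW.
pose c := mkC (fun=> [:: @dlt _ _ E e b]).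
have ec : (fun f : {ptws Cstar E -> C} => f c) @ nbhs (val x : {ptws Cstar E -> C}) --> (val x : _ -> _) c.
  exact: (@proj_continuous _ (fun=> C) c).
have x1 : (val x : _ -> _) c = 1 by rewrite -[LHS]/(evalX c x) evalX_upt evC_cst /evE big_seq1.
have n1 : nbhs (val x : {ptws Cstar E -> C}) [set f | nc (f c - 1) < 1].
  by move: ec; rewrite x1 => /cvg_CP; apply.
have : nbhs x ((val : X -> {ptws Cstar E -> C}) @^-1` [set f | nc (f c - 1) < 1]).
  exact: (@initial_continuous _ _ (val : X -> {ptws Cstar E -> C})).
apply: filterS => y /=; rewrite -[(val y : _ -> _) c]/(evalX c y) evalX_upt evC_cst /evE big_seq1.
move=> y1; apply: contrapT => nWy; move: y1; rewrite /cfE /= bW //.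
by rewrite sub0r ncN nc1 ltxx.
Qed.

Lemma evC_near (c : Cstar E) x (e : R) : gunits G x -> 0 < e ->
  \forall y \near x, gunits G y -> nc (evC y c - evC x c) < e.
Proof.
move=> xu e0; have e4 : 0 < e / 4 by rewrite divr_gt0.
have [N hN] := repC_cauchy c e4.
have unif y : nc (evE (repC c N) y - evC y c) <= e / 4.
  apply/ler_addgt0Pr => d d0; have [M hM] := evC_rep y c d0.
  have := hM _ (leq_maxr N M); have := hN _ _ (leqnn N) (leq_maxl N M).
  have := evE_le (fs_sub (repC c N) (repC c (maxn N M))) y.
  rewrite /fs_sub evE_cat evE_scale mulN1r.
  have := ncD (evE (repC c N) y - evE (repC c (maxn N M)) y) (evE (repC c (maxn N M)) y - evC y c).
  rewrite addrA subrK; lra.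
have /cvg_CP/(_ _ e4) := (multiplier_evE (repC c N)).1 x xu.
apply: filterS => y hy yu.
rewrite (_ : evC y c - evC x c = (evC y c - evE (repC c N) y) +
  ((evE (repC c N) y - evE (repC c N) x) + (evE (repC c N) x - evC x c))); last by ring.
apply: le_lt_trans (ncD _ _) _; have := ncD (evE (repC c N) y - evE (repC c N) x) (evE (repC c N) x - evC x c).
have := unif x; have := unif y; rewrite (ncB (evE _ y) (evC y c)); lra.
Qed.

(** Elements of C*(E) are uniform limits of continuous functions on the unit space, so
    that x |-> evC x is continuous for the pointwise topology. *)
Lemma spectrum_pt_nbhs (x : X) (P : set X) : nbhs x P ->
  \forall y \near spectrum_pt x, forall z, spectrum_pt z = y -> P z.
Proof.
move=> [_ [[V oV <-] /= Vx VP]].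
pose F : set_system (Cstar E -> C) := evC @ within (gunits G) (nbhs (spectrum_pt x)).
have FV : {ptws, F --> (val x : Cstar E -> C)}.
  apply: ptws_cvg => c; apply/cvg_CP => e e0.
  have -> : (val x : _ -> _) c = @evC (spectrum_pt x) c by exact: evalX_upt.
  have : \forall y \near spectrum_pt x, gunits G y -> nc (evC y c - @evC (spectrum_pt x) c) < e.
    by apply: evC_near => //; exact: spectrum_pt_unit.
  by [].
have : F V by apply: FV; exact: open_nbhs_nbhs.
move=> FV'; have : \forall y \near spectrum_pt x, gunits G y -> V (evC y) by [].
apply: filterS => y Vy z zy; apply: VP.
have zE : (val z : Cstar E -> C) = @evC y.
  by apply/funext => c; rewrite -zy; exact: evalX_upt.
have yu : gunits G y by rewrite -zy; exact: spectrum_pt_unit.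
by have := Vy yu; rewrite -zE.
Qed.

(** * The partial homeomorphisms of the spectrum *)

Definition arrow (U : I) (x : G) : G := xget x [set g | biss U g /\ gdom g = x].

Lemma arrowE (U : I) g : biss U g -> arrow U (gdom g) = g.
Proof.
move=> Ug; rewrite /arrow; case: xgetP => [h _ [Uh hg]|h]; last by case: (h g).
exact: (bissection_domI (bissP U)).
Qed.

Lemma arrowP (U : I) x : gunits G x -> biss (U^! ** U) x ->
  biss U (arrow U x) /\ gdom (arrow U x) = x.
Proof.
move=> xu /(src_idemP U xu)[g [Ug <-]].
by rewrite arrowE.
Qed.

Lemma UsetP (e : Eisg I) (x : X) : Uset e x <-> biss (sval e) (spectrum_pt x).
Proof.
split=> [[b]|ex]; first by rewrite evalE_upt => /cf_in.
have [b [b1 _]] := cf_through 1 ex (filterT : nbhs (spectrum_pt x) setT).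
by exists b; rewrite evalE_upt b1 oner_eq0.
Qed.

Lemma Uset_src (U : I) (x : X) : Uset (src_idem U) x <-> exists g, biss U g /\ gdom g = spectrum_pt x.
Proof. by rewrite UsetP; apply: src_idemP; exact: spectrum_pt_unit. Qed.

Lemma sqvE (U : I) (a : A U) (x : X) g : biss U g -> gdom g = spectrum_pt x ->
  sqv a x = ((nc (cf a g)) ^+ 2)%:C.
Proof.
by move=> Ug gx; rewrite /sqv evalE_upt -gx (cf_star_mul a a Ug Ug) mulJ_nc.
Qed.

Lemma sqv_out (U : I) (a : A U) (x : X) : ~ Uset (src_idem U) x -> sqv a x = 0.
Proof.
move=> nU; rewrite /sqv evalE_upt; apply: cf_out => h.
by apply: nU; apply/UsetP.
Qed.

Lemma domvP (U : I) (a : A U) (x : X) :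
  domv a x <-> exists g, [/\ biss U g, gdom g = spectrum_pt x & cf a g != 0].
Proof.
rewrite /domv /=; split=> [a0|[g [Ug gx a0]]]; last first.
  by rewrite (sqvE _ Ug gx) ltcR; apply: exprn_gt0; rewrite lt_neqAle eq_sym nc_eq0 a0 nc_ge0.
have [Ux|nUx] := pselect (Uset (src_idem U) x); last by rewrite sqv_out ?ltxx in a0.
have [g [Ug gx]] := (Uset_src U x).1 Ux; exists g; split => //.
by apply: contraTneq a0 => a0; rewrite (sqvE _ Ug gx) a0 nc0 expr0n /= ltxx.
Qed.

Lemma nc_cf_star (U : I) (a : A U) g : nc (cf (fstar a) (ginv g)) = nc (cf a g).
Proof.
by rewrite -!line_norm_coord sec_star /= line_norm_star // ginvK.
Qed.

Lemma domv_starP (U : I) (a : A U) (x : X) :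
  domv (fstar a) x <-> exists g, [/\ biss U g, grng g = spectrum_pt x & cf a g != 0].
Proof.
rewrite domvP; split=> [[_ [[g Ug <-] + +]]|[g [Ug gx a0]]].
  rewrite (gdomV hG) => gx a0; exists g; split => //.
  by rewrite -nc_eq0 -nc_cf_star nc_eq0.
exists (ginv g); split; [by exists g|by rewrite (gdomV hG)|].
by rewrite -nc_eq0 nc_cf_star nc_eq0.
Qed.

Lemma conj_idem_proof (U : I) (e : Eisg I) : Defs.idempotent (U^! ** sval e ** U).
Proof.
apply/idem_units => g; rewrite biss_mul => -[h [u [+ Uu hu ->]]].
rewrite biss_mul => -[_ [x [[v Uv <-] ex + hE]]]; rewrite (gdomV hG) => vx.
have xu : gunits G x by exact: unitsetP ex.
have xE : grng v = x by rewrite vx gunits_grng.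
have hE' : h = ginv v by rewrite hE -xE -(gdomV hG) (gmul_dom hG).
have uv : u = v by apply: (bissection_rngI (bissP U)) => //; rewrite -hu hE' (gdomV hG).
by rewrite hE' uv /gunits /= (gmulVl hG) (gdom_dom hG).
Qed.

Definition conj_idem (U : I) (e : Eisg I) : Eisg I := exist _ _ (conj_idem_proof U e).

Definition fs_conj (U : I) (a : A U) (u : fsum E) : fsum E :=
  [seq @dlt _ _ E (conj_idem U (projT1 p)) (fmul (fmul (fstar a) (projT2 p : A (sval (projT1 p)))) a) | p <- u].

Lemma fs_incl_conj (U : I) (a : A U) (u : fsum E) :
  fs_incl (fs_conj a u) = fs_mul (fs_mul [:: dlt (fstar a)] (fs_incl u)) [:: dlt a].
Proof.
rewrite /fs_mul /fs_incl /fs_conj /= cats0; elim: u => //= p u IH.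
by rewrite IH.
Qed.

Lemma evE_conj (U : I) (a : A U) (u : fsum E) g : biss U g ->
  evE (fs_conj a u) (gdom g) = ((nc (cf a g)) ^+ 2)%:C * evE u (grng g).
Proof.
move=> Ug; rewrite /evE big_map mulr_sumr; apply: eq_bigr => p _.
by apply: cf_conj => //; exact: unitsetP.
Qed.

Lemma evE_conj_out (U : I) (a : A U) (u : fsum E) x : gunits G x ->
  (forall g, biss U g -> gdom g = x -> False) -> evE (fs_conj a u) x = 0.
Proof.
move=> xu nx; rewrite /evE big_map big1 // => p _.
by apply: cf_conj_out => //; exact: unitsetP.
Qed.

Lemma fs_conj_bounded (U : I) (a : A U) : exists2 K : R, 0 <= K & forall u v : fsum E,
  env_norm (fs_sub (fs_conj a u) (fs_conj a v)) <= K * env_norm (fs_sub u v).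
Proof.
have [M M0 aM] := cf_bounded a; exists (M ^+ 2); first exact: sqr_ge0.
move=> u v; have n0 := env_norm_ge0 slE (fs_sub u v).
apply: envE_le => [|x]; first by rewrite mulr_ge0 ?sqr_ge0.
have [xu|nxu] := pselect (gunits G x); last first.
  by rewrite evE_out // nc0 mulr_ge0 ?sqr_ge0.
rewrite /fs_sub evE_cat evE_scale.
have [[g [Ug gx]]|nx] := pselect (exists g, biss U g /\ gdom g = x); last first.
  rewrite !evE_conj_out // ?mulr0 ?addr0 ?nc0 ?mulr_ge0 ?sqr_ge0 // => g Ug gx;
    by apply: nx; exists g.
rewrite -gx !evE_conj // mulrCA -mulrDr -evE_scale -evE_cat ncM ncC.
apply: ler_pM; rewrite ?nc_ge0 ?normr_ge0 //; last exact: evE_le.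
rewrite ger0_norm ?sqr_ge0 // lerXn2r ?nnegrE ?nc_ge0 //.
Qed.

Lemma incl_cauchy (u : nat -> fsum E) : env_cauchy u -> env_cauchy (fun n => fs_incl (u n)).
Proof.
move=> uC e e0; have [N uN] := uC e e0; exists N => m n Nm Nn.
rewrite /fs_sub -fs_incl_scale -fs_incl_cat.
by apply: le_lt_trans (env_norm_incl _) _; exact: uN.
Qed.

Lemma Cincl_mkC (u : nat -> fsum E) : env_cauchy u -> Cincl (mkC u) = mkC (fun n => fs_incl (u n)).
Proof.
move=> uC; apply/(mkC_eq slA); [exact/incl_cauchy/repC_cauchy|exact: incl_cauchy|].
move=> e e0; have [N uN] := rep_mkC slE uC e0; exists N => n Nn.
rewrite /fs_sub -fs_incl_scale -fs_incl_cat.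
by apply: le_lt_trans (env_norm_incl _) _; exact: uN.
Qed.

Lemma Cincl_inj_at (c c' : Cstar E) x : gunits G x -> Cincl c = Cincl c' -> evC x c = evC x c'.
Proof.
move=> xu cc'.
have inclC (v : Cstar E) := incl_cauchy (repC_cauchy v).
have small := (mkC_eq slA (inclC c) (inclC c')).1 cc'.
apply: (tendsto_unique (evC_rep x c)) => e e0.
have e2 : 0 < e / 2 by rewrite divr_gt0.
have [N1 h1] := small _ e2; have [N2 h2] := evC_rep x c' e2.
exists (maxn N1 N2) => n; rewrite geq_max => /andP[/h1 H1 /h2 H2].
move: H1; rewrite /fs_sub -fs_incl_scale -fs_incl_cat => H1.
have := evE_le_incl xu (repC c n ++ fs_scale (-1) (repC c' n)) wS.
rewrite evE_cat evE_scale mulN1r.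
have := ncD (evE (repC c n) x - evE (repC c' n) x) (evE (repC c' n) x - evC x c').
rewrite addrA subrK; lra.
Qed.

Lemma conj_exists (U : I) (a : A U) (b : Cstar E) : exists c : Cstar E,
  Cincl c = Cmul (Cmul (Cdelta (fstar a)) (Cincl b)) (Cdelta a) /\
  forall g, biss U g -> evC (gdom g) c = ((nc (cf a g)) ^+ 2)%:C * evC (grng g) b.
Proof.
have [K K0 aK] := fs_conj_bounded a; have bC := repC_cauchy b.
have cC : env_cauchy (fun n => fs_conj a (repC b n)) by exact: cauchy_map K0 aK bC.
exists (mkC (fun n => fs_conj a (repC b n))); split=> [|g Ug].
  have iC := incl_cauchy bC.
  have dC (V : I) (d : A V) : env_cauchy (fun=> [:: dlt d]) by exact: (cauchy_cst slA).
  rewrite Cincl_mkC // /Cdelta /Cincl (CmulE slA) // (CmulE slA) //; last first.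
    by apply: (cauchy_mul slA).
  by congr mkC; apply/funext => n; exact: fs_incl_conj.
apply: (tendsto_unique (evC_mkC (gdom g) cC)) => e e0.
set k := nc (cf a g) ^+ 2; have k0 : 0 <= k by exact: sqr_ge0.
have k1 : 0 < k + 1 by rewrite ltr_wpDl.
have ek : 0 < e / (k + 1) by rewrite divr_gt0.
have [N hN] := evC_rep (grng g) b ek; exists N => n /hN.
rewrite evE_conj // -mulrBr ncM ncC ger0_norm // ltr_pdivlMr // => h.
apply: le_lt_trans h; rewrite mulrC ler_wpM2l ?nc_ge0 // lerDl //.
Qed.

(** Conjugation by a on C*(A) induces b |-> |a|^2 (b o r o d^-1) on functions, by
    [conj_exists], and the function is determined by the element of C*(A), by
    [Cincl_inj_at]. *)
Lemma theta_eltE (U : I) (a : A U) (x : X) g : biss U g -> gdom g = spectrum_pt x -> cf a g != 0 ->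
  spectrum_pt (theta_elt a x) = grng g.
Proof.
move=> Ug gx a0.
have k0 : ((nc (cf a g)) ^+ 2)%:C != 0 :> C.
  by rewrite eq_complex /= eqxx andbT expf_eq0 /= nc_eq0.
have [y yr] := spectrum_pt_surj (gdom_rng hG g : gunits G (grng g)).
rewrite /theta_elt; case: xgetP => [z _ [_ hz]|h]; last first.
  case: (h y); split; first by apply/domv_starP; exists g.
  move=> b; have [c [cE cev]] := conj_exists a b; exists c => //.
  by rewrite !evalX_upt -gx cev // (sqvE _ Ug gx) yr.
suff -> : z = y by [].
apply: val_inj; apply/funext => b; rewrite -[LHS]/(evalX b z) -[RHS]/(evalX b y).
have [c cE] := hz b; have [c' [cE' cev]] := conj_exists a b.
rewrite (sqvE _ Ug gx) !evalX_upt (Cincl_inj_at (spectrum_pt_unit x) (etrans cE (esym cE'))).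
by rewrite -gx cev // yr => /(mulfI k0).
Qed.

(** Some section of U does not vanish at g, and then [theta_eltE] applies. *)
Lemma thetaE (U : I) (x : X) g : biss U g -> gdom g = spectrum_pt x -> spectrum_pt (theta U x) = grng g.
Proof.
move=> Ug gx.
have [y yr] := spectrum_pt_surj (gdom_rng hG g : gunits G (grng g)).
rewrite /theta; case: xgetP => [z _ [_ hz]|h]; last first.
  case: (h y); split; first by apply/UsetP/(rng_idemP U (spectrum_pt_unit y)); exists g.
  move=> a /domvP[g' [Ug' g'x a0]].
  have gg' : g' = g by apply: (bissection_domI (bissP U)) => //; rewrite g'x.
  apply: spectrum_pt_inj.
  by rewrite yr (theta_eltE Ug' g'x a0) gg'.
have [a [a1 _]] := cf_through 1 Ug (filterT : nbhs g setT).
have a0 : cf a g != 0 by rewrite a1 oner_eq0.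
by rewrite -(hz a) ?(theta_eltE Ug gx a0) //; apply/domvP; exists g.
Qed.

(** * The groupoid of germs *)

Definition pregerm_arrow (p : pregerm A) : G := arrow ((val p).1 : I) (spectrum_pt (val p).2).

Lemma pregerm_arrowP (p : pregerm A) :
  biss ((val p).1 : I) (pregerm_arrow p) /\ gdom (pregerm_arrow p) = spectrum_pt (val p).2.
Proof.
apply: arrowP; first exact: spectrum_pt_unit.
by have := set_mem (valP p) => /UsetP.
Qed.

Lemma pregerm_arrowE (p : pregerm A) g : biss ((val p).1 : I) g -> gdom g = spectrum_pt (val p).2 -> pregerm_arrow p = g.
Proof. by move=> Ug gx; rewrite /pregerm_arrow -gx arrowE. Qed.

Lemma refine_idem (U W : I) : biss W `<=` biss U -> U ** (W^! ** W) = W.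
Proof.
move=> WU; apply: biss_inj; rewrite biss_mul bmul_unitsr; last first.
  exact: (@unitsetP (src_idem W)).
apply/seteqP; split => [h [Uh]|h Wh].
  move=> /(src_idemP W (gdom_dom hG h : gunits G _))[w [Ww wh]].
  by rewrite (bissection_domI (bissP U) Uh (WU _ Ww) (esym wh)).
split; first exact: WU.
by apply/src_idemP; [exact: gdom_dom|exists h].
Qed.

(** If two bissections share the arrow with source x, wideness yields a smaller one W
    through this arrow, and both restrict to W on the source of W. *)
Lemma germ_eqP (p q : pregerm A) : germ_eq p q <-> pregerm_arrow p = pregerm_arrow q.
Proof.
have [Up px] := pregerm_arrowP p; have [Uq qx] := pregerm_arrowP q; split.
  move=> [xx [e [/UsetP ex se]]]; apply/esym/pregerm_arrowE; last by rewrite px xx.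
  have : biss ((val p).1 ** sval e) (pregerm_arrow p).
    rewrite biss_mul bmul_unitsr; last exact: unitsetP.
    by split => //; rewrite px.
  rewrite se biss_mul bmul_unitsr; last exact: unitsetP.
  by case.
move=> pq; split; first by apply: spectrum_pt_inj; rewrite -px pq qx.
move: Uq; rewrite -pq => Uq.
have [W [Wg WU WV]] := wide_refine Up Uq.
exists (src_idem W); split; last exact: etrans (refine_idem WU) (esym (refine_idem WV)).
by apply/UsetP/src_idemP; [exact: spectrum_pt_unit|exists (pregerm_arrow p)].
Qed.

Lemma germ_piP (p q : pregerm A) : \pi_(germ A) p = \pi_(germ A) q <-> pregerm_arrow p = pregerm_arrow q.
Proof.
rewrite -germ_eqP; apply: cquotP => [{}p|{}p {}q|{}p {}q r]; rewrite !germ_eqP //.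
by move=> -> ->.
Qed.

Definition germ_arrow (g : germ A) : G := pregerm_arrow (repr g).

Lemma germ_arrow_pi p : germ_arrow (\pi_(germ A) p) = pregerm_arrow p.
Proof. by apply/germ_piP; rewrite reprK. Qed.

Lemma germ_arrow_inj : injective germ_arrow.
Proof. by move=> g h /germ_piP; rewrite !reprK. Qed.

Lemma germ_arrowP (g : germ A) :
  biss (germ_s g : I) (germ_arrow g) /\ gdom (germ_arrow g) = spectrum_pt (germ_x g).
Proof. exact: pregerm_arrowP. Qed.

Lemma germ_arrow_mk d (U : I) (x : X) g : biss U g -> gdom g = spectrum_pt x ->
  germ_arrow (mkgerm d U x) = g.
Proof.
move=> Ug gx; rewrite /mkgerm germ_arrow_pi.
have m : (U, x) \in [set p : I * X | Uset (src_idem p.1) p.2].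
  by apply/mem_set/Uset_src; exists g.
by apply: pregerm_arrowE; rewrite insubdK.
Qed.

Lemma pregerm_exists (U : I) g : biss U g -> exists p : pregerm A,
  (val p).1 = U /\ spectrum_pt (val p).2 = gdom g.
Proof.
move=> Ug; have [x xg] := spectrum_pt_surj (gdom_dom hG g : gunits G _).
have m : (U, x) \in [set p : I * X | Uset (src_idem p.1) p.2].
  by apply/mem_set/Uset_src; exists g; split=> //; exact: esym xg.
by exists (SigSub m).
Qed.

Lemma germ_arrow_surj g : exists h, germ_arrow h = g.
Proof.
have [U Ug] := wide_cover g.
have [p [pU px]] := pregerm_exists Ug.
by exists (\pi_(germ A) p); rewrite germ_arrow_pi; apply: pregerm_arrowE; rewrite ?pU.
Qed.

Lemma germ_arrow_basic (U : I) (V : set X) (h : germ A) : V `<=` Uset (src_idem U) ->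
  germ_basic U V h <-> biss U (germ_arrow h) /\ exists2 x, V x & spectrum_pt x = gdom (germ_arrow h).
Proof.
move=> VU; split.
  move=> [p [<- Vp] ->]; rewrite germ_arrow_pi; have [? px] := pregerm_arrowP p; split => //.
  by exists (val p).2.
move=> [Uh [x Vx xh]].
have m : (U, x) \in [set p : I * X | Uset (src_idem p.1) p.2] by apply/mem_set/VU.
exists (SigSub m) => //; apply: germ_arrow_inj; rewrite germ_arrow_pi.
by apply/esym/pregerm_arrowE.
Qed.

Local Notation germ_subbase := [set B : set (germ A) | exists s U,
  [/\ open U, U `<=` Uset (src_idem s) & B = germ_basic s U]].

Lemma germ_basic_open (U : I) (V : set X) : open V -> V `<=` Uset (src_idem U) ->
  open (germ_basic U V : set (germ A)).
Proof.
move=> oV VU; exists [set germ_basic U V]; last by rewrite bigcup_set1.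
have fin : finI_from germ_subbase id (germ_basic U V : set (germ A)).
  by apply: (finI_from1 id); exists U, V.
by move=> _ ->; exact: fin.
Qed.

Lemma germ_cvg (T : Type) (F : set_system T) (f : T -> germ A) (g : germ A) : Filter F ->
  (forall (U : I) (V : set X), open V -> V `<=` Uset (src_idem U) ->
    germ_basic U V g -> F (f @^-1` germ_basic U V)) ->
  f @ F --> g.
Proof.
move=> FF h P [_ [[Q Qb <-]] [W QW Wg] QP].
have FW : F (f @^-1` W).
  have [B BS WE] := Qb _ QW; rewrite -WE preimage_bigcap.
  apply: filter_bigI => N NB; have [U [V [oV VU NE]]] := set_mem (BS N NB).
  by rewrite /= NE; apply: h => //; move: Wg; rewrite -WE -NE; apply.
by apply: filterS FW => t Wt; apply: QP; exists W.
Qed.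

Lemma germ_arrow_continuous : continuous germ_arrow.
Proof.
move=> g P; rewrite nbhsE => -[Q [oQ Qg] QP].
have [Ug gx] := germ_arrowP g; set U := germ_s g : I in Ug.
have [oU _ _] := bissP U.
have nUQ : nbhs (germ_arrow g) (biss U `&` Q) by apply: open_nbhs_nbhs; split => //; exact: openI.
pose V : set X := spectrum_pt @^-1` (interior (@gdom G @` (biss U `&` Q))).
have VU : V `<=` Uset (src_idem U).
  by move=> x /interior_subset[h [Uh _] hx]; apply/Uset_src; exists h.
have oV : open V.
  have /continuousP := @spectrum_pt_continuous; apply.
  exact: open_interior.
have : nbhs g (germ_basic U V).
  apply: open_nbhs_nbhs; split; first exact: germ_basic_open.
  apply/germ_arrow_basic => //; split => //; exists (germ_x g) => //.
  by rewrite /V /= -gx; apply: gdom_nbhs eG _ _ nUQ.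
apply: filterS => h /(germ_arrow_basic _ VU)[Uh [x /interior_subset[k [Uk Qk] kx] xh]].
apply: QP; rewrite (_ : germ_arrow h = k) //.
by apply: (bissection_domI (bissP U)) => //; rewrite -xh kx.
Qed.

Lemma germ_arrow_inv_continuous (f : G -> germ A) : cancel f germ_arrow -> continuous f.
Proof.
move=> fK g; apply: germ_cvg => U W oW WU; move=> /(germ_arrow_basic _ WU).
rewrite fK => -[Ug [x Wx xg]].
have n1 : nbhs g (biss U).
  by apply: open_nbhs_nbhs; split => //; have [] := bissP U.
have n2 : nbhs (gdom g) [set y | forall z, spectrum_pt z = y -> W z].
  by rewrite -xg; apply: spectrum_pt_nbhs; exact: open_nbhs_nbhs.
have n3 := gdom_continuous eG n2.
move: n1 n3; apply: filterS2 => h Uh hW; apply/germ_arrow_basic => //.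
have [y yh] := spectrum_pt_surj (gdom_dom hG h : gunits G _).
by rewrite fK; split => //; exists y => //; apply: hW.
Qed.

Lemma germ_arrow_dom (g : germ A) : germ_arrow (germ_dom g) = gdom (germ_arrow g).
Proof.
have [Ug gx] := germ_arrowP g; apply: germ_arrow_mk; last by rewrite (gdom_dom hG).
by apply/src_idemP; [exact: gdom_dom|exists (germ_arrow g)].
Qed.

Lemma germ_arrow_rng (g : germ A) : germ_arrow (germ_rng g) = grng (germ_arrow g).
Proof.
have [Ug gx] := germ_arrowP g; apply: germ_arrow_mk.
  by apply/rng_idemP; [exact: gdom_rng|exists (germ_arrow g)].
by rewrite (gdom_rng hG) (thetaE Ug gx).
Qed.

Lemma germ_arrow_inv (g : germ A) : germ_arrow (germ_inv g) = ginv (germ_arrow g).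
Proof.
have [Ug gx] := germ_arrowP g; apply: germ_arrow_mk; first by exists (germ_arrow g).
by rewrite (gdomV hG) (thetaE Ug gx).
Qed.

Lemma germ_arrow_mul (g h : germ A) : gdom (germ_arrow g) = grng (germ_arrow h) ->
  germ_arrow (germ_mul g h) = gmul (germ_arrow g) (germ_arrow h).
Proof.
move=> gh; have [Ug gx] := germ_arrowP g; have [Uh hx] := germ_arrowP h.
apply: germ_arrow_mk; first by exists (germ_arrow g), (germ_arrow h).
by rewrite (gdomM hG).
Qed.

Lemma germ_arrow_iso : @topological_groupoid_iso (germ_groupoid A) G germ_arrow.
Proof.
have [f fK] := choice germ_arrow_surj.
split.
  exists f; split; [exact: germ_arrow_continuous|exact: germ_arrow_inv_continuous| |exact: fK].
  by move=> g; apply: germ_arrow_inj; rewrite fK.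
split; [by move=> g; rewrite -germ_arrow_dom|by move=> g; rewrite -germ_arrow_rng| |exact: germ_arrow_inv].
by move=> g h gh; apply: germ_arrow_mul; rewrite -germ_arrow_dom -germ_arrow_rng; congr germ_arrow.
Qed.

(** * The vectors of the abstract line bundle *)

Definition preL_arrow (p : preL A) : G := arrow (projT1 (val p).1 : I) (spectrum_pt (val p).2).

Definition preL_vec (p : preL A) : L := sec (projT2 (val p).1 : A (projT1 (val p).1 : I)) (preL_arrow p).

Lemma preL_arrowP (p : preL A) :
  biss (projT1 (val p).1 : I) (preL_arrow p) /\ gdom (preL_arrow p) = spectrum_pt (val p).2.
Proof.
apply: arrowP; first exact: spectrum_pt_unit.
by have := set_mem (valP p) => /UsetP.
Qed.

Lemma preL_vec_proj p : line_proj (preL_vec p) = preL_arrow p.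
Proof. exact: sec_proj. Qed.

Lemma dlt_cast (U V : I) (b : A V) : U = V -> exists d : A U, dlt d = dlt b.
Proof. by move=> UV; subst; exists b. Qed.

Lemma eq_atP (x : X) (U V : I) (a : A U) (b : A V) g : biss U g -> gdom g = spectrum_pt x ->
  eq_at x (dlt a) (dlt b) <-> U = V /\ sec a g = sec b g.
Proof.
move=> Ug gx; split.
  move: {-2}(dlt a) {-2}(dlt b) (erefl (dlt a)) (erefl (dlt b)) => p q + + pq.
  case: pq => s c d h0 /dlt_sec[sU ca] /dlt_sec[sV db].
  split; first by rewrite -sU.
  subst s; rewrite -ca -db; apply: coord_inj; first by rewrite !sec_proj.
  move: h0; rewrite (sqvE _ Ug gx) cf_sub => /(congr1 (@complex.Re R)) /= /eqP.
  by rewrite expf_eq0 /= nc_eq0 subr_eq0 => /eqP.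
move=> [UV ab]; subst V; apply: EqAt; rewrite (sqvE _ Ug gx) cf_sub /cf ab subrr nc0.
by rewrite expr0n.
Qed.

Lemma arrow_germ (U V : I) (e : Eisg I) x g : U ** sval e = V ** sval e ->
  biss (sval e) x -> biss U g -> gdom g = x -> biss V g.
Proof.
move=> UV ex Ug gx; have : biss (U ** sval e) g.
  rewrite biss_mul bmul_unitsr; last exact: unitsetP.
  by rewrite /= gx.
rewrite UV biss_mul bmul_unitsr; last exact: unitsetP.
by case.
Qed.

Lemma germ_refine (U V : I) g : biss U g -> biss V g -> exists e : Eisg I,
  biss (sval e) (gdom g) /\ U ** sval e = V ** sval e.
Proof.
move=> Ug Vg; have [W [Wg WU WV]] := wide_refine Ug Vg.
exists (src_idem W); split; last exact: etrans (refine_idem WU) (esym (refine_idem WV)).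
by apply/src_idemP; [exact: gdom_dom|exists g].
Qed.

(** As for germs, two bissections through an arrow can be restricted to a common one,
    where the sections only have to be compared at this arrow. *)
Lemma preL_eqP (p q : preL A) : preL_eq p q <-> preL_vec p = preL_vec q.
Proof.
have [Up px] := preL_arrowP p; have [Uq qx] := preL_arrowP q.
move: Up Uq px qx; rewrite /preL_vec; set g := preL_arrow p; set h := preL_arrow q => Ug Vh gx hx.
set a := projT2 (val p).1 : A (projT1 (val p).1 : I).
set b := projT2 (val q).1 : A (projT1 (val q).1 : I).
split.
  move=> [xx [e [c [c0 UV]]]].
  have cx : cf c (gdom g) != 0 by rewrite gx -evalE_upt.
  have ex := cf_in cx.
  have gh : h = g.
    apply: (bissection_domI (bissP _) Vh); last by rewrite hx -xx gx.
    exact: (arrow_germ UV ex Ug).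
  have Ueg : biss ((projT1 (val p).1 : I) ** sval e) g.
    by rewrite biss_mul bmul_unitsr //; exact: unitsetP.
  move=> /(eq_atP _ _ Ueg gx)[_ /(congr1 coord)].
  rewrite -![coord _]/(cf _ _) !cf_mul_unitr; try exact: unitsetP.
  move=> /(mulIf cx) ab; rewrite gh; apply: coord_inj => //.
  by rewrite !sec_proj.
move=> ab; have gh : h = g by have := congr1 (@line_proj _ _) ab; rewrite !sec_proj.
rewrite gh in Vh hx ab.
split; first by apply: spectrum_pt_inj; rewrite -gx hx.
have [e [ex UV]] := germ_refine Ug Vh.
have [c [c1 _]] := cf_through 1 ex (filterT : nbhs (gdom g) setT).
exists e, c; split => //; first by rewrite evalE_upt -gx c1 oner_eq0.
have Ueg : biss ((projT1 (val p).1 : I) ** sval e) g.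
  by rewrite biss_mul bmul_unitsr //; exact: unitsetP.
apply/(eq_atP _ _ Ueg gx); split => //; apply: coord_inj; first by rewrite !sec_proj.
rewrite -![coord _]/(cf _ _) !cf_mul_unitr; try exact: unitsetP.
by rewrite /cf ab.
Qed.

Lemma LA_piP (p q : preL A) : \pi_(LA A) p = \pi_(LA A) q <-> preL_vec p = preL_vec q.
Proof.
rewrite -preL_eqP; apply: cquotP => [{}p|{}p {}q|{}p {}q r]; rewrite !preL_eqP //.
by move=> -> ->.
Qed.

Definition line_vec (v : LA A) : L := preL_vec (repr v).

Lemma line_vec_pi p : line_vec (\pi_(LA A) p) = preL_vec p.
Proof. by apply/LA_piP; rewrite reprK. Qed.

Lemma line_vec_inj : injective line_vec.
Proof. by move=> v w /LA_piP; rewrite !reprK. Qed.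

Lemma line_vecP (v : LA A) : exists g, [/\ biss (L_s v : I) g, gdom g = spectrum_pt (L_x v),
  line_vec v = sec (L_a v : A (L_s v : I)) g & line_proj (line_vec v) = g].
Proof.
exists (preL_arrow (repr v)); have [h1 h2] := preL_arrowP (repr v); split => //.
exact: preL_vec_proj.
Qed.

Lemma preL_vecE (p : preL A) g : biss (projT1 (val p).1 : I) g -> gdom g = spectrum_pt (val p).2 ->
  preL_vec p = sec (projT2 (val p).1 : A (projT1 (val p).1 : I)) g.
Proof. by move=> Ug gx; rewrite /preL_vec /preL_arrow -gx arrowE. Qed.

Lemma line_vec_mk d (U : I) (a : A U) (x : X) g : biss U g -> gdom g = spectrum_pt x ->
  line_vec (mkL d a x) = sec a g.
Proof.
move=> Ug gx; rewrite /mkL line_vec_pi.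
have m : (dlt a, x) \in [set p : ftot A * X | Uset (src_idem (projT1 p.1)) p.2].
  by apply/mem_set/Uset_src; exists g.
have pE : val (insubd d (dlt a, x)) = (dlt a, x) by rewrite insubdK.
move: (insubd d (dlt a, x)) pE => p pE.
have Up : biss (projT1 (val p).1 : I) g by rewrite pE.
have px : gdom g = spectrum_pt (val p).2 by rewrite pE.
by rewrite (preL_vecE Up px) pE.
Qed.

Lemma preL_exists (U : I) (a : A U) g : biss U g -> exists p : preL A,
  (val p).1 = dlt a /\ spectrum_pt (val p).2 = gdom g.
Proof.
move=> Ug; have [x xg] := spectrum_pt_surj (gdom_dom hG g : gunits G _).
have m : (dlt a, x) \in [set p : ftot A * X | Uset (src_idem (projT1 p.1)) p.2].
  by apply/mem_set/Uset_src; exists g; split=> //; exact: esym xg.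
by exists (SigSub m).
Qed.

Lemma line_vec_surj l : exists v, line_vec v = l.
Proof.
have [U Ul] := wide_cover (line_proj l).
have [a al] := sec_through Ul.
have [p [pa px]] := preL_exists a Ul.
exists (\pi_(LA A) p); rewrite line_vec_pi.
have Up : biss (projT1 (val p).1 : I) (line_proj l) by rewrite pa.
by rewrite (preL_vecE Up (esym px)) pa.
Qed.

Lemma line_vec_proj v : line_proj (line_vec v) = germ_arrow (L_proj v).
Proof.
rewrite /L_proj germ_arrow_pi; have [g [Ug gx _ ->]] := line_vecP v.
by apply/esym/pregerm_arrowE.
Qed.

Lemma line_vec_norm v : line_norm (line_vec v) = L_norm v.
Proof.
have [g [Ug gx -> _]] := line_vecP v.
by rewrite /L_norm (sqvE _ Ug gx) /= sqrtr_sqr ger0_norm ?nc_ge0 // line_norm_coord.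
Qed.

Lemma line_vec_scale l v : line_vec (L_scale l v) = line_scale l (line_vec v).
Proof.
have [g [Ug gx -> _]] := line_vecP v.
by rewrite (line_vec_mk _ _ Ug gx) sec_scale.
Qed.

Lemma line_vec_mul v w : gdom (line_proj (line_vec v)) = grng (line_proj (line_vec w)) ->
  line_vec (L_mul v w) = line_mul (line_vec v) (line_vec w).
Proof.
have [g [Ug gx -> ->]] := line_vecP v; have [h [Vh hx -> ->]] := line_vecP w => gh.
rewrite (@line_vec_mk _ _ _ _ (gmul g h)); [|by exists g, h|by rewrite (gdomM hG)].
by rewrite sec_mult (sec_mulE (bissP _) (bissP _)).
Qed.

Lemma line_vec_star v : line_vec (L_star v) = line_star (line_vec v).
Proof.
have [g [Ug gx -> _]] := line_vecP v.
rewrite (@line_vec_mk _ _ _ _ (ginv g)); first by rewrite sec_star ginvK.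
  by exists g.
by rewrite (gdomV hG) (thetaE Ug gx).
Qed.

Lemma line_vec_add v w : line_proj (line_vec v) = line_proj (line_vec w) ->
  line_vec (L_add v w) = line_add (line_vec v) (line_vec w).
Proof.
move=> vw; rewrite /L_add; case: xgetP => [u _|noadd].
  move=> [p [q [e [c [d [[vE wE] xx c1 dE ->]]]]]].
  have [Up px] := preL_arrowP p; have [Uq qx] := preL_arrowP q.
  have gh : preL_arrow p = preL_arrow q by rewrite -!preL_vec_proj -!line_vec_pi -vE -wE.
  have cx : cf c (gdom (preL_arrow p)) = 1 by rewrite px -evalE_upt.
  have ex : biss (sval e) (gdom (preL_arrow p)) by apply: (@cf_in _ c); rewrite cx oner_eq0.
  have Ueg : biss ((projT1 (val p).1 : I) ** sval e) (preL_arrow p).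
    by rewrite biss_mul bmul_unitsr //; exact: unitsetP.
  rewrite (line_vec_mk _ _ Ueg px) vE wE !line_vec_pi.
  have [_ dq] := dlt_sec dE.
  apply: coord_inj.
    rewrite sec_proj line_proj_add ?preL_vec_proj // gh //.
  rewrite coord_add ?preL_vec_proj // -[LHS]/(cf _ _) cf_add.
  rewrite cf_mul_unitr; last exact: unitsetP.
  rewrite cx mulr1 {2}/cf dq -[coord (sec (fmul _ _) _)]/(cf _ _).
  rewrite cf_mul_unitr; last exact: unitsetP.
  by rewrite cx mulr1 /preL_vec /cf gh.
exfalso; have [Uv vx] := preL_arrowP (repr v); have [Uw wx] := preL_arrowP (repr w).
have gh : preL_arrow (repr w) = preL_arrow (repr v) by rewrite -!preL_vec_proj.
rewrite gh in Uw wx.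
have [e [ex UV]] := germ_refine Uv Uw.
have [c [c1 _]] := cf_through 1 ex (filterT : nbhs (gdom (preL_arrow (repr v))) setT).
have [d dE] := dlt_cast (fmul (projT2 (val (repr w)).1 : A (projT1 (val (repr w)).1 : I)) c) UV.
apply: (noadd (mkL (repr v) (fadd (fmul (projT2 (val (repr v)).1) c) d) (val (repr v)).2)).
exists (repr v), (repr w), e, c, d; split => //; first by rewrite !reprK.
  by apply: spectrum_pt_inj; rewrite -vx wx.
by rewrite evalE_upt -vx.
Qed.

Lemma line_vec_section (U : I) (a : A U) (g : germ A) : biss U (germ_arrow g) ->
  line_vec (L_section a g) = sec a (germ_arrow g).
Proof.
move=> Ug; have [_ gx] := germ_arrowP g.
exact: line_vec_mk Ug gx.
Qed.

(** * Uniqueness of the topology of the line bundle *)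

Lemma germ_basicT (U : I) (g : germ A) : germ_basic U setT g <-> biss U (germ_arrow g).
Proof.
split=> [[p [<- _] ->]|Ug]; first by rewrite germ_arrow_pi; have [] := pregerm_arrowP p.
have [p [pU px]] := pregerm_exists Ug.
exists p => //; apply: germ_arrow_inj; rewrite germ_arrow_pi.
by apply/esym/pregerm_arrowE; rewrite ?pU.
Qed.

Section Uniqueness.
Variables (O : topology_on (LA A)) (OL : is_L_topology O).
Local Notation LO := (retop O).

Lemma Lproj_cvg (v : LO) : L_proj w @[w --> v] --> (L_proj v : germ A).
Proof. by have [[+ _] _ _ _ _] := OL; apply. Qed.

Lemma Lnorm_cvg (v : LO) : L_norm w @[w --> v] --> L_norm v.
Proof. by have [_ + _ _ _] := OL; apply. Qed.

Lemma Ladd_cvg (T : Type) (F : set_system T) (f h : T -> LO) (v w : LO) : Filter F ->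
  (\forall t \near F, L_proj (f t) = L_proj (h t)) -> L_proj v = L_proj w ->
  f @ F --> v -> h @ F --> w -> (fun t => L_add (f t) (h t) : LO) @ F --> (L_add v w : LO).
Proof.
move=> FF fh vw fv hw W nW; have [_ _ [addc _] _ _] := OL.
have := @within_near _ _ _ _ (v, w) W addc vw nW; case=> -[P Q] /= [nP nQ] PQ.
move: fh (hw Q nQ) (fv P nP); apply: filterS3 => t e Qt Pt.
exact: (PQ (f t, h t) (conj Pt Qt) e).
Qed.

Lemma Lscale_cvg l (v : LO) : (L_scale l w : LO) @[w --> v] --> (L_scale l v : LO).
Proof. by have [_ _ [_ +] _ _] := OL; move=> /(_ l); apply. Qed.

Lemma Lsection_cvg (U : I) (a : A U) (g : germ A) : biss U (germ_arrow g) ->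
  (L_section a h : LO) @[h --> g] --> (L_section a g : LO).
Proof.
move=> Ug W nW; have [_ _ _ _ /(_ U a) secc] := OL.
have := within_near secc ((germ_basicT U g).2 Ug) nW.
have nU : nbhs g (germ_arrow @^-1` biss U).
  by apply: (@germ_arrow_continuous g); apply: open_nbhs_nbhs; split => //; have [] := bissP U.
by move: nU; apply: filterS2 => h Uh; apply; exact/germ_basicT.
Qed.

End Uniqueness.

Lemma L_projP (v w : LA A) : L_proj v = L_proj w <-> line_proj (line_vec v) = line_proj (line_vec w).
Proof. by rewrite !line_vec_proj; split => [->//|/germ_arrow_inj]. Qed.

Lemma L_proj_scale l (v : LA A) : L_proj (L_scale l v) = L_proj v.
Proof. by apply/L_projP; rewrite line_vec_scale line_proj_scale. Qed.

Lemma L_proj_add (v w : LA A) : L_proj v = L_proj w -> L_proj (L_add v w) = L_proj v.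
Proof. by move=> /L_projP vw; apply/L_projP; rewrite line_vec_add // line_proj_add. Qed.

Lemma L_proj_section (U : I) (a : A U) (g : germ A) : biss U (germ_arrow g) ->
  L_proj (L_section a g) = g.
Proof.
move=> Ug; apply: germ_arrow_inj.
by rewrite -line_vec_proj line_vec_section // sec_proj.
Qed.

Lemma L_addK (v w : LA A) : L_proj v = L_proj w -> L_add (L_add v (L_scale (-1) w)) w = v.
Proof.
move=> /L_projP vw; apply: line_vec_inj.
have vw' : line_proj (line_vec v) = line_proj (line_vec (L_scale (-1) w)) by rewrite line_vec_scale line_proj_scale.
have vw2 : line_proj (line_vec (L_add v (L_scale (-1) w))) = line_proj (line_vec w).
  by rewrite line_vec_add // line_proj_add.
apply: coord_inj; first by rewrite line_vec_add // line_proj_add // vw2.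
by rewrite line_vec_add // coord_add // line_vec_add // coord_add // line_vec_scale coord_scale mulN1r subrK.
Qed.

Lemma L_norm_sub_self (v : LA A) : L_norm (L_add v (L_scale (-1) v)) = 0.
Proof.
rewrite -line_vec_norm line_vec_add line_vec_scale ?line_proj_scale //.
by rewrite line_subv line_norm_zero.
Qed.

(** Let s be a section through v0. When v tends to v0 for the first topology, the norm
    of v - s(v) tends to 0, where s(v) is the value of s over the projection of v. By
    the axiom on the zero section, v - s(v) tends to v0 - v0 for the second topology,
    and so does s(v) to v0, hence v to v0. *)
Lemma L_topology_finer (O O' : topology_on (LA A)) : is_L_topology O -> is_L_topology O' ->
  forall v : LA A, (nbhs (v : retop O) : set_system (LA A)) --> (v : retop O').
Proof.
move=> OL OL' v0.
have [U Uv] := wide_cover (germ_arrow (L_proj v0)).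
have Uv' : biss U (line_proj (line_vec v0)) by rewrite line_vec_proj.
have [a av] := sec_through Uv'.
have av0 : L_section a (L_proj v0) = v0.
  by apply: line_vec_inj; rewrite line_vec_section // -line_vec_proj.
set F : set_system (LA A) := nbhs (v0 : retop O).
have FF : ProperFilter F by exact: (@nbhs_pfilter (retop O) v0).
pose s (v : LA A) := L_section a (L_proj v).
have Un : \forall v \near F, biss U (germ_arrow (L_proj v)).
  have nU : nbhs (L_proj v0) (germ_arrow @^-1` biss U).
    by apply: germ_arrow_continuous; apply: open_nbhs_nbhs; split => //; have [] := bissP U.
  exact: (Lproj_cvg OL nU).
have sF O1 : is_L_topology O1 -> (s v : retop O1) @[v --> F] --> (v0 : retop O1).
  move=> OL1; rewrite -{1}av0 => W /(Lsection_cvg OL1 Uv) nW.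
  exact: (Lproj_cvg OL nW).
pose r (v : LA A) := L_add v (L_scale (-1) (s v)).
have sp : \forall v \near F, L_proj v = L_proj (s v).
  by apply: filterS Un => v Uv1; rewrite L_proj_section.
have rp : \forall v \near F, L_proj (r v) = L_proj v.
  by apply: filterS sp => v sp; rewrite L_proj_add // L_proj_scale.
pose z0 := L_add v0 (L_scale (-1) v0).
have z0p : L_proj z0 = L_proj v0 by rewrite L_proj_add // L_proj_scale.
have rO : (r v : retop O) @[v --> F] --> (z0 : retop O).
  apply: (Ladd_cvg OL).
  - by apply: filterS sp => v; rewrite L_proj_scale.
  - by rewrite L_proj_scale.
  - by [].
  - move=> W nW; exact: (sF _ OL _ (Lscale_cvg OL nW)).
have rO' : (r v : retop O') @[v --> F] --> (z0 : retop O').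
  have [_ _ _ zax _] := OL'.
  apply: (zax (r @ F) (L_proj v0) z0).
  - exact: z0p.
  - exact: L_norm_sub_self.
  - by move=> W; rewrite -z0p => /(Lproj_cvg OL) nW; exact: rO nW.
  - by move=> W; rewrite -[X in nbhs X](L_norm_sub_self v0) => /(Lnorm_cvg OL) nW; exact: rO nW.
have sum : \forall v \near F, L_add (r v) (s v) = v.
  by apply: filterS sp => v; exact: L_addK.
have rs : \forall v \near F, L_proj (r v) = L_proj (s v).
  by move: rp sp; apply: filterS2 => v -> ->.
have := Ladd_cvg OL' _ rs z0p rO' (sF _ OL'); rewrite (_ : L_add z0 v0 = v0); last by rewrite L_addK.
move=> h W nW; have := h FF W nW => {h}.
by move: sum; apply: filterS2 => v /= ->.
Qed.

(** * Existence of the topology of the line bundle *)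

Lemma pull_L_topology : is_L_topology (pull_topology line_vec).
Proof.
set T := retop (pull_topology line_vec).
have lc (v : T) (W : set L) : nbhs (line_vec v) W -> nbhs v (line_vec @^-1` W).
  by move=> nW; apply/pull_nbhsP; exists W.
have [f fK] := choice germ_arrow_surj.
have fc := germ_arrow_inv_continuous fK.
have Kf g : f (germ_arrow g) = g by apply: germ_arrow_inj; rewrite fK.
split.
- split.
    move=> v P; rewrite -{1}(Kf (L_proj v)) -line_vec_proj => /fc/line_proj_continuous/lc.
    by apply: filterS => w /=; rewrite /preimage /= line_vec_proj Kf.
  move=> _ [W oW <-].
  rewrite (_ : _ @` _ = germ_arrow @^-1` (@line_proj _ D @` W)).
    have /continuousP := @germ_arrow_continuous; apply.
    exact: line_proj_open.
  apply/seteqP; split => [_ [v Wv <-]|g [l Wl lg]].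
    by exists (line_vec v) => //; rewrite line_vec_proj.
  have [v vl] := line_vec_surj l; exists v; first by rewrite /= vl.
  by rewrite -(Kf (L_proj v)) -line_vec_proj vl lg Kf.
- move=> v W; rewrite -{1}line_vec_norm => /line_norm_continuous/lc.
  by apply: filterS => w; rewrite /preimage /= line_vec_norm.
- split.
    apply/subspace_continuousP => -[v w] /= vw P /pull_nbhsP[W nW WP].
    have vw' : line_proj (line_vec v) = line_proj (line_vec w) by rewrite !line_vec_proj vw.
    move: nW; rewrite line_vec_add // => /(line_add_near vw')[P1 [P2 [n1 n2 h]]].
    exists (line_vec @^-1` P1, line_vec @^-1` P2); first by split; exact: lc.
    move=> [v' w'] [/= h1 h2] vw2; apply: WP; rewrite /preimage /=.
    have vw2' : line_proj (line_vec v') = line_proj (line_vec w') by rewrite !line_vec_proj vw2.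
    by rewrite line_vec_add //; exact: h.
  move=> l v P /pull_nbhsP[W nW WP].
  move: nW; rewrite line_vec_scale => /line_scale_near[e e0 [P1 nP1 h]].
  apply: filterS (lc _ _ nP1) => w Pw; apply: WP; rewrite /preimage /= line_vec_scale.
  by apply: h => //; rewrite subrr nc0.
- move=> F g z FF zg z0 Fg F0 P /pull_nbhsP[W nW WP].
  have : line_vec @ F --> line_vec z.
    apply: (@line_zero_cvg T F line_vec (line_vec z) (@filter_filter _ _ FF)); first by rewrite line_vec_norm.
      move=> V; rewrite line_vec_proj zg => nV.
      have h : F ((fun v => L_proj v) @^-1` (germ_arrow @^-1` V)).
        by apply: Fg; exact: germ_arrow_continuous.
      by apply: (@filterS _ F _ _ _ _ h) => w; rewrite /preimage /= line_vec_proj.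
    move=> V nV; have h : F ((fun v => L_norm v) @^-1` V) by exact: F0.
    by apply: (@filterS _ F _ _ _ _ h) => w; rewrite /preimage /= line_vec_norm.
  move=> /(_ W nW) h; apply: (@filterS _ F _ _ _ _ h) => w; exact: WP.
- move=> U a; apply/subspace_continuousP => g /germ_basicT Ug P /pull_nbhsP[W nW WP].
  move: nW; rewrite line_vec_section // => /(C0_continuous (bissP (U : I)) (secP a) Ug).
  move=> /germ_arrow_continuous nV.
  change (nbhs g [set h | germ_basic U setT h -> P (L_section a h)]).
  apply: (@filterS _ (nbhs (g : germ A)) _ _ _ _ nV) => h Wh /germ_basicT Uh.
  by apply: WP; rewrite /preimage /= line_vec_section.
Qed.

Lemma LB_topology : is_L_topology (xget (discrete_top (LA A)) (@is_L_topology R _ A)).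
Proof. by case: xgetP => // /(_ _ pull_L_topology). Qed.

Lemma line_vec_continuous : continuous (line_vec : LB A -> L).
Proof.
move=> v W nW; apply: (L_topology_finer LB_topology pull_L_topology).
by apply/pull_nbhsP; exists W.
Qed.

Lemma line_vec_inv_continuous (k : L -> LA A) : cancel k line_vec -> continuous (k : L -> LB A).
Proof.
move=> kK l P nP.
have /pull_nbhsP[W nW WP] := L_topology_finer pull_L_topology LB_topology nP.
by move: nW; rewrite kK; apply: filterS => l' Wl; apply: WP; rewrite /preimage /= kK.
Qed.

(** * Unit vectors *)

Local Notation SA := (Sigma_groupoid A).

Lemma line1_inj (s t : Sg) : [ln 1, s] = [ln 1, t] -> s = t.
Proof.
move=> /(line_eqP hD)[z zc [/= z1 ->]].
by move: z1; rewrite mulr1 => <-; rewrite (tw_act1 hD).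
Qed.

Definition vec (l : L) : LA A := sval (cid (line_vec_surj l)).

Lemma vecK : cancel vec line_vec.
Proof. by move=> l; rewrite /vec; case: cid. Qed.

Lemma sigma_tw_ex (v : SA) : exists s, line_vec (val v) = [ln 1, s].
Proof.
have /= nv := set_mem (valP v); have [l [s vE]] := lineP (line_vec (val v)).
have lc : circle l.
  by apply: circle_nc; rewrite -nv -line_vec_norm vE (line_normE hD).
by exists (tw_act l s); rewrite line_act // mulr1.
Qed.

(** Every vector [l, s] of norm one is the class [1, z s] for the unit complex number
    z = l. *)
Definition sigma_tw (v : SA) : Sg := sval (cid (sigma_tw_ex v)).

Lemma sigma_twP (v : SA) : line_vec (val v) = [ln 1, sigma_tw v].
Proof. by rewrite /sigma_tw; case: cid. Qed.

Lemma sigma_tw_inj : injective sigma_tw.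
Proof.
move=> v w vw; apply/val_inj/line_vec_inj.
by rewrite !sigma_twP vw.
Qed.

Lemma vec_unitary s : L_norm (vec [ln 1, s]) = 1.
Proof. by rewrite -line_vec_norm vecK (line_normE hD) /=; exact: nc1. Qed.

Definition unitary (s : Sg) : SA :=
  SigSub (mem_set (vec_unitary s) : (vec [ln 1, s] : LB A) \in [set v : LB A | L_norm v = 1]).

Lemma unitaryK : cancel unitary sigma_tw.
Proof. by move=> s; apply: line1_inj; rewrite -sigma_twP /= vecK. Qed.

Lemma sigma_twK : cancel sigma_tw unitary.
Proof. by move=> v; apply: sigma_tw_inj; rewrite unitaryK. Qed.

(** A vector close to [1, s] is a class [m, t] with m close to 1 and t close to s; if it
    is also [1, s'], then s' is the translate of t by m, which is close to s. *)
Lemma sigma_tw_continuous : continuous sigma_tw.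
Proof.
move=> v N nN; set s0 := sigma_tw v in nN.
have a1 : nbhs (tw_act 1 s0) N by rewrite (tw_act1 hD).
have [e e0 [B nB BN]] := act_near (@circle1 R) a1.
have nW : nbhs [ln 1, s0] [set l | forall s, l = [ln 1, s] -> N s].
  apply/line_nbhsP; exists e => //; exists B => // m t m1 Bt s.
  move=> /(line_eqP hD)[z zc [/= zm tE]].
  have z0 : z != 0 by apply: contra_eq_neq zm => ->; rewrite mul0r oner_eq0.
  have mE : m = z^-1 by rewrite -[LHS](mulKf z0) -zm mulr1.
  have mc : circle m by rewrite mE; exact: circleV.
  have -> : s = tw_act m t by rewrite tE -(tw_actM hD) // mE mulVf // (tw_act1 hD).
  exact: BN.
have n1 : nbhs (val v : LB A) (line_vec @^-1` [set l | forall s, l = [ln 1, s] -> N s]).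
  by apply: line_vec_continuous; rewrite sigma_twP.
have n2 : nbhs v (val @^-1` (line_vec @^-1` [set l | forall s, l = [ln 1, s] -> N s])).
  exact: (@initial_continuous _ _ (val : SA -> LB A) v _ n1).
by apply: filterS n2 => w /(_ _ (sigma_twP w)).
Qed.

Lemma unitary_continuous : continuous unitary.
Proof.
move=> s P [_ [[V oV <-] /= Vs VP]].
have c : continuous (fun t : Sg => vec [ln 1, t] : LB A).
  move=> t; apply: (@continuous_comp _ _ _ (fun t : Sg => [ln 1, t])).
    apply: (@continuous_comp _ _ _ (fun t : Sg => (1 : C, t))).
      exact: pair_continuous.
    exact: pi_continuous.
  by apply: line_vec_inv_continuous; exact: vecK.
have n1 : nbhs s ((fun t : Sg => vec [ln 1, t] : LB A) @^-1` V).
  by apply: c; exact: open_nbhs_nbhs.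
by apply: filterS n1 => t Vt; exact: VP.
Qed.

Lemma L_norm_mul (v w : LA A) : gdom (line_proj (line_vec v)) = grng (line_proj (line_vec w)) ->
  L_norm (L_mul v w) = L_norm v * L_norm w.
Proof. by move=> vw; rewrite -!line_vec_norm line_vec_mul // line_norm_mul. Qed.

Lemma sigma_tw_composable (v w : SA) : gdom (sigma_tw v) = grng (sigma_tw w) <->
  gdom (line_proj (line_vec (val v))) = grng (line_proj (line_vec (val w))).
Proof. by rewrite !sigma_twP !(line_projE hD) /=; exact: composable_pi. Qed.

Lemma sigma_tw_mul (v w : SA) : gdom (sigma_tw v) = grng (sigma_tw w) ->
  sigma_tw (Sigma_mul v w) = gmul (sigma_tw v) (sigma_tw w).
Proof.
move=> vw; have vw' := (sigma_tw_composable v w).1 vw.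
apply: line1_inj; rewrite -sigma_twP /Sigma_mul insubdK; last first.
  apply: mem_set; rewrite /= L_norm_mul //.
  have /= -> := set_mem (valP v); have /= -> := set_mem (valP w); exact: mulr1.
by rewrite line_vec_mul // !sigma_twP line_mulE // mulr1.
Qed.

Lemma sigma_tw_inv (v : SA) : sigma_tw (Sigma_inv v) = ginv (sigma_tw v).
Proof.
apply: line1_inj; rewrite -sigma_twP /Sigma_inv insubdK; last first.
  apply: mem_set; rewrite /= -line_vec_norm line_vec_star line_norm_star // line_vec_norm.
  exact: (set_mem (valP v)).
by rewrite line_vec_star sigma_twP line_starE rmorph1.
Qed.

Lemma sigma_tw_dom (v : SA) : sigma_tw (gdom v) = gdom (sigma_tw v).
Proof.
rewrite -[gdom v]/(Sigma_mul (Sigma_inv v) v) sigma_tw_mul sigma_tw_inv; first exact: (gmulVl hSg).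
exact: (gdomV hSg).
Qed.

Lemma sigma_tw_rng (v : SA) : sigma_tw (grng v) = grng (sigma_tw v).
Proof.
rewrite -[grng v]/(Sigma_mul v (Sigma_inv v)) sigma_tw_mul sigma_tw_inv; first exact: (gmulV hSg).
by rewrite (grngV hSg).
Qed.

Lemma sigma_tw_iso : topological_groupoid_iso sigma_tw.
Proof.
split.
  exists unitary; split; [exact: sigma_tw_continuous|exact: unitary_continuous|exact: sigma_twK|exact: unitaryK].
split; [by move=> v; rewrite sigma_tw_dom|by move=> v; rewrite sigma_tw_rng| |exact: sigma_tw_inv].
by move=> v w vw; apply: sigma_tw_mul; rewrite -sigma_tw_dom -sigma_tw_rng vw.
Qed.

Lemma sigma_tw_pi (v : SA) : tw_pi (sigma_tw v) = germ_arrow (Sigma_pi v).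
Proof. by rewrite /Sigma_pi -line_vec_proj sigma_twP (line_projE hD). Qed.

Definition sigma_tw_iota (z : C) (u : germ_groupoid A) : SA := unitary (tw_iota D z (germ_arrow u)).

Lemma sigma_tw_iotaP : is_Sigma_iota sigma_tw_iota.
Proof.
move=> z u zc uu; have xu : gunits G (germ_arrow u).
  by rewrite /gunits /= -germ_arrow_dom; congr germ_arrow.
set x := germ_arrow u in xu.
have pix : tw_pi (tw_iota D 1 x) = x by rewrite (tw_pi_iota hD) //; exact: circle1.
have pv : L_proj (vec [ln 1, tw_iota D 1 x]) = u.
  by apply: germ_arrow_inj; rewrite -line_vec_proj vecK (line_projE hD).
have c1 := @circle1 R.
exists (vec [ln 1, tw_iota D 1 x]); last first.
  apply: line_vec_inj; rewrite line_vec_scale !vecK line_scaleE mulr1.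
  rewrite -[z in RHS]mulr1 -line_act // /tw_act pix (gunits_grng eG xu).
  by rewrite -(tw_iotaM hD) // mulr1.
split => // w wu.
have pw : line_proj (line_vec w) = x by rewrite line_vec_proj wu.
have [m [t wE]] := lineP (line_vec w).
have pt : tw_pi t = x by rewrite -pw wE (line_projE hD).
have rt : grng t = tw_iota D 1 x by rewrite (rng_iota hD) pt (gunits_grng eG xu).
have dt : gdom t = tw_iota D 1 x by rewrite (dom_iota hD) pt xu.
have pvx : line_proj (line_vec (vec [ln 1, tw_iota D 1 x])) = x by rewrite vecK (line_projE hD).
split; apply: line_vec_inj.
  rewrite line_vec_mul ?pvx ?pw ?(gunits_grng eG xu) //.
  by rewrite vecK wE line_mulE -?rt ?(gdom_rng hSg) // mul1r (gmul_rng hSg).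
rewrite line_vec_mul ?pvx ?pw ?(gunits_grng eG xu) //.
by rewrite vecK wE line_mulE -?dt ?(grng_dom hSg) // mulr1 (gmul_dom hSg).
Qed.

End Twist.

Theorem proposition3p33 (R : realType) (D : twist_data R)
    (hD : is_twisted_etale_groupoid D)
    (S : set (set (tw_G D))) (hS : inverse_subsemigroup S) (wS : wide S) :
  exists2 D' : twist_data R,
    is_twisted_groupoid_of (section_bundle hD hS) D' &
    twisted_groupoid_iso D' D.
Proof.
pose A := section_bundle hD hS.
exists (@TwistData R (germ_groupoid A) (Sigma_groupoid A)
  (@sigma_tw_iota _ _ hD _ hS wS) (@Sigma_pi _ _ A)).
  by exists (@sigma_tw_iota _ _ hD _ hS wS) => //; exact: sigma_tw_iotaP.
exists (@sigma_tw _ _ hD _ hS wS), (@germ_arrow _ _ hD _ hS wS); split.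
- exact: sigma_tw_iso.
- exact: germ_arrow_iso.
- exact: sigma_tw_pi.
- by move=> z u _ _; exact: unitaryK.
Qed.
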